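(* Let $G$ be a group in the class $\mathcal{C}$. Then $G$ is left orderable if and only if $G$ is locally indicable.
   Context: A group $G$ is left ordered if it has a total order $\le$ with $x\le y\Rightarrow gx\le gy$ for all $g,x,y\in G$; left orderable means it admits such an order. A group is locally indicable if every nontrivial finitely generated subgroup has a quotient isomorphic to $\mathbb{Z}$. Let $\mathcal{P}$ be the group (under composition) of piecewise linear (differentiable except at finitely many points) orientation preserving self-homeomorphisms of $[0,1]$. Let $\mathrm{NS}$ be the class of groups containing no nonabelian free subsemigroup. $\mathcal{C}$ is the smallest class of groups containing all $\mathrm{NS}$-groups and the group $\mathcal{P}$, and closed under taking subgroups, homomorphic images, group extensions and directed unions. *)

(* Defs.v *)
From Stdlib Require Import Reals ZArith List.
Import ListNotations.
Open Scope R_scope.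

Record Grp := {
  carrier :> Type;
  gmul : carrier -> carrier -> carrier;
  gone : carrier;
  ginv : carrier -> carrier;
  gmulA : forall x y z, gmul x (gmul y z) = gmul (gmul x y) z;
  gmul1 : forall x, gmul gone x = x;
  gmulV : forall x, gmul (ginv x) x = gone
}.
Arguments gmul {g}.
Arguments gone {g}.
Arguments ginv {g}.

Definition is_hom (G H : Grp) (f : G -> H) : Prop :=
  forall x y : G, f (gmul x y) = gmul (f x) (f y).

Definition injective {A B} (f : A -> B) := forall x y, f x = f y -> x = y.
Definition surjective {A B} (f : A -> B) := forall y, exists x, f x = y.

Definition left_order (G : Grp) (le : G -> G -> Prop) : Prop :=
  (forall x, le x x) /\
  (forall x y, le x y -> le y x -> x = y) /\
  (forall x y z, le x y -> le y z -> le x z) /\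
  (forall x y, le x y \/ le y x) /\
  (forall g x y, le x y -> le (gmul g x) (gmul g y)).

Definition left_orderable (G : Grp) : Prop := exists le, left_order G le.

Inductive gen_by (G : Grp) (s : list G) : G -> Prop :=
| gen_in : forall x, In x s -> gen_by G s x
| gen_one : gen_by G s gone
| gen_mul : forall x y, gen_by G s x -> gen_by G s y -> gen_by G s (gmul x y)
| gen_inv : forall x, gen_by G s x -> gen_by G s (ginv x).

Definition locally_indicable (G : Grp) : Prop :=
  forall s : list G, (exists x, gen_by G s x /\ x <> gone) ->
    exists f : G -> Z,
      (forall x y, gen_by G s x -> gen_by G s y -> f (gmul x y) = (f x + f y)%Z) /\
      (forall n : Z, exists x, gen_by G s x /\ f x = n).

Fixpoint eval_word (G : Grp) (a b : G) (w : list bool) : G :=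
  match w with
  | [] => gone
  | c :: w' => gmul (if c then a else b) (eval_word G a b w')
  end.

Definition free_subsemigroup2 (G : Grp) (a b : G) : Prop :=
  forall w1 w2 : list bool, w1 <> [] -> w2 <> [] ->
    eval_word G a b w1 = eval_word G a b w2 -> w1 = w2.

Definition NS (G : Grp) : Prop := ~ exists a b : G, free_subsemigroup2 G a b.

Fixpoint strictly_sorted (l : list R) : Prop :=
  match l with
  | x :: ((y :: _) as l') => x < y /\ strictly_sorted l'
  | _ => True
  end.

Definition PL01 (f : R -> R) : Prop :=
  exists (l : list R),
    strictly_sorted (0 :: l ++ [1]) /\
    forall u v, (exists l1 l2, 0 :: l ++ [1] = l1 ++ u :: v :: l2) ->
      exists a c, forall x, u <= x <= v -> f x = a * x + c.

Definition PLhomeo01 (f : R -> R) : Prop :=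
  PL01 f /\ f 0 = 0 /\ f 1 = 1 /\
  (forall x y, 0 <= x -> x < y -> y <= 1 -> f x < f y).

Definition embeds_in_P (G : Grp) : Prop :=
  exists phi : G -> (R -> R),
    (forall g, PLhomeo01 (phi g)) /\
    (forall g h x, 0 <= x <= 1 -> phi (gmul g h) x = phi g (phi h x)) /\
    (forall g h, (forall x, 0 <= x <= 1 -> phi g x = phi h x) -> g = h).

(** The class C: smallest class containing NS-groups and P, closed under
    subgroups, homomorphic images, extensions and directed unions
    (all up to isomorphism, subgroups being images of injective homomorphisms). *)
Inductive inC : Grp -> Prop :=
| C_NS : forall G, NS G -> inC G
| C_P : forall G, embeds_in_P G -> inC G
| C_sub : forall (G H : Grp) (f : H -> G),
    is_hom H G f -> injective f -> inC G -> inC H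
| C_quot : forall (G H : Grp) (f : G -> H),
    is_hom G H f -> surjective f -> inC G -> inC H
| C_ext : forall (N G Q : Grp) (i : N -> G) (p : G -> Q),
    is_hom N G i -> injective i -> is_hom G Q p -> surjective p ->
    (forall g, p g = gone <-> exists n, i n = g) ->
    inC N -> inC Q -> inC G
| C_dunion : forall (G : Grp) (I : Type) (H : I -> Grp) (f : forall i, H i -> G),
    (forall i, is_hom (H i) G (f i)) -> (forall i, injective (f i)) ->
    (forall i j, exists k,
       (forall x, exists y, f k y = f i x) /\ (forall x, exists y, f k y = f j x)) ->
    (forall g, exists i x, f i x = g) ->
    (forall i, inC (H i)) -> inC G.

(* Main.v *)
(** The proof works with the left preorders of a group H, that is, with its actions on chains.
    Such a preorder "has drift" if there is a nonzero homomorphism tau : H -> R such that every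
    finite set of elements with tau > 0 moves some common point upwards.  If every nontrivial left
    preorder of every finitely generated subgroup of G has drift and G is left orderable, then every
    nontrivial finitely generated subgroup of G maps onto a nonzero finitely generated subgroup of R.

    This property passes from N to an extension H of N when H / N is NS or a group of PL
    homeomorphisms (or a quotient of a subgroup of such a group).  Let H be finitely generated.
    Either, for some limit of the given preorder, H / N acts nontrivially on the chain of convex
    hulls of N-orbits; or finitely many elements of N dominate H uniformly, and then the
    homomorphisms belonging to the finitely generated subgroups of N converge along an ultrafilter
    to some tau on N.  As tau is unique up to scaling, H multiplies it by a character lam.  If lam is
    nontrivial, ln lam is the required homomorphism.  Otherwise tau extends to H as a translation
    number when its image is dense, and when its image is discrete H / N acts on a circle and the
    rotation number has to be shown additive.

    The two questions about H / N reduce to the following: elements with arbitrarily large fixed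
    points have arbitrarily large common fixed points.  Then comparison at infinity is a bi-invariant
    total preorder, and Hölder's theorem applies.  Two elements without common fixed points cross
    and generate a free subsemigroup, which settles the NS case.  In a finitely generated group of
    PL homeomorphisms, finitely many elements of the derived subgroup have supports that stay away
    from the global fixed points, so that they commute with their conjugates by a single
    suitable element; this yields common fixed points.  The remaining quotient is abelian, hence NS.

    The converse implication is the Burns-Hale theorem and holds for every group. *)

From Stdlib Require Import Reals ZArith List Lra Lia Classical ClassicalEpsilon.
From Stdlib Require Import FunctionalExtensionality PropExtensionality ProofIrrelevance.
From mathcomp Require filter.
Require Import Defs.
Import ListNotations.

Notation "x · y" := (gmul x y) (at level 40, left associativity).
Notation "x ^-1" := (ginv x) (at level 3, left associativity, format "x ^-1").

(** * Groups *)

Section GroupLaws.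
Context {H : Grp}.
Implicit Types x y z : H.

Lemma gmulKV x y : x^-1 · (x · y) = y.
Proof. now rewrite gmulA, gmulV, gmul1. Qed.

Lemma gmul_cancel_l x y z : x · y = x · z -> y = z.
Proof. intros E; rewrite <- (gmulKV x y), E; apply gmulKV. Qed.

Lemma gmulr1 x : x · gone = x.
Proof. apply (gmul_cancel_l (x^-1)); now rewrite gmulA, gmulV, gmul1. Qed.

Lemma gmulrV x : x · x^-1 = gone.
Proof. apply (gmul_cancel_l (x^-1)); now rewrite gmulKV, gmulr1. Qed.

Lemma gmulVK x y : x · (x^-1 · y) = y.
Proof. now rewrite gmulA, gmulrV, gmul1. Qed.

Lemma ginv1 : @ginv H gone = gone.
Proof. apply (gmul_cancel_l gone); now rewrite gmulrV, gmul1. Qed.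

Lemma ginvK x : x^-1^-1 = x.
Proof. apply (gmul_cancel_l (x^-1)); now rewrite gmulrV, gmulV. Qed.

Lemma ginvM x y : (x · y)^-1 = y^-1 · x^-1.
Proof.
apply (gmul_cancel_l (x · y)); rewrite gmulrV, <- gmulA, gmulVK.
now rewrite gmulrV.
Qed.

Lemma gmulAr x y z : x · y · z = x · (y · z).
Proof. now rewrite gmulA. Qed.
End GroupLaws.

#[global] Hint Rewrite @gmulAr @gmul1 @gmulr1 @gmulV @gmulrV @gmulKV @gmulVK
  @ginv1 @ginvK @ginvM : grp.
Ltac grp := autorewrite with grp; try reflexivity.
Tactic Notation "grp" "in" hyp(h) := autorewrite with grp in h.

Lemma hom1 {G H : Grp} (f : G -> H) : is_hom G H f -> f gone = gone.
Proof.
intros hf; apply (gmul_cancel_l (f gone)); rewrite <- hf; grp.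
Qed.

Lemma homV {G H : Grp} (f : G -> H) x : is_hom G H f -> f (x^-1) = (f x)^-1.
Proof.
intros hf; apply (gmul_cancel_l (f x)); rewrite <- hf; grp.
now apply hom1.
Qed.

(** * Subgroups, normality and finite generation *)

Definition is_subgroup (H : Grp) (B : H -> Prop) : Prop :=
  B gone /\ (forall x y, B x -> B y -> B (x · y)) /\ (forall x, B x -> B (x^-1)).

Definition is_normal (H : Grp) (B : H -> Prop) : Prop :=
  forall h x, B x -> B (h · x · h^-1).

Lemma sub1 {H : Grp} {B : H -> Prop} : is_subgroup H B -> B gone.
Proof. now intros [? _]. Qed.

Lemma subM {H : Grp} {B : H -> Prop} : is_subgroup H B ->
  forall x y, B x -> B y -> B (x · y).
Proof. now intros [_ [? _]]. Qed.

Lemma subV {H : Grp} {B : H -> Prop} : is_subgroup H B ->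
  forall x, B x -> B (x^-1).
Proof. now intros [_ [_ ?]]. Qed.

Lemma gen_subgroup (H : Grp) (s : list H) : is_subgroup H (gen_by H s).
Proof.
split; [apply gen_one | split]; [intros; now apply gen_mul | intros; now apply gen_inv].
Qed.

Lemma full_subgroup (H : Grp) : is_subgroup H (fun _ => True).
Proof. now repeat split. Qed.

Lemma gen_min (H : Grp) (s : list H) (B : H -> Prop) :
  is_subgroup H B -> (forall x, In x s -> B x) -> forall x, gen_by H s x -> B x.
Proof.
intros hB hs x hx; induction hx as [x hx| |x y _ IHx _ IHy|x _ IHx].
- now apply hs.
- now apply sub1.
- now apply subM.
- now apply subV.
Qed.

Section SubGroup.
Variables (H : Grp) (B : H -> Prop) (hB : is_subgroup H B).

Lemma sig_val_inj (x y : {x | B x}) : proj1_sig x = proj1_sig y -> x = y.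
Proof.
destruct x as [x hx], y as [y hy]; simpl; intros ->.
now rewrite (proof_irrelevance _ hx hy).
Qed.

Definition subgrp : Grp.
Proof.
refine {| carrier := {x | B x};
  gmul := fun x y => exist _ (proj1_sig x · proj1_sig y)
     (subM hB _ _ (proj2_sig x) (proj2_sig y));
  gone := exist _ gone (sub1 hB);
  ginv := fun x => exist _ ((proj1_sig x)^-1) (subV hB _ (proj2_sig x)) |};
  intros; apply sig_val_inj; simpl; grp.
Defined.

Definition subval (x : subgrp) : H := proj1_sig x.

Lemma subval_hom : is_hom subgrp H subval.
Proof. now intros x y. Qed.

Lemma subval_inj : injective subval.
Proof. intros x y; apply sig_val_inj. Qed.

Lemma subvalP (x : subgrp) : B (subval x).
Proof. exact (proj2_sig x). Qed.
End SubGroup.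

Definition fg (H : Grp) : Prop := exists s, forall x, gen_by H s x.

Lemma fg_gen (H : Grp) (s : list H) : fg (subgrp H _ (gen_subgroup H s)).
Proof.
set (L := subgrp H _ (gen_subgroup H s)).
assert (lift : forall l : list H, (forall x, In x l -> gen_by H s x) ->
   exists l' : list L, map (subval H _ _) l' = l).
{ induction l as [|a l IH]; intros hl; [now exists [] |].
  destruct IH as [l' <-]; [intros; apply hl; now right |].
  now exists (exist _ a (hl a (or_introl eq_refl)) :: l'). }
destruct (lift s) as [s' hs']; [apply gen_in |].
exists s'; intros [x hx].
assert (P : gen_by H s x -> exists y : L, gen_by L s' y /\ subval H _ _ y = x).
{ clear hx; intros hx; induction hx as [x hx| |x y _ [x' [? <-]] _ [y' [? <-]]|x _ [x' [? <-]]].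
  - rewrite <- hs' in hx; apply in_map_iff in hx as [y [<- hy]].
    exists y; split; auto; now apply gen_in.
  - exists gone; split; auto; apply gen_one.
  - exists (x' · y'); split; auto; now apply gen_mul.
  - exists (x'^-1); split; auto; now apply gen_inv. }
destruct (P hx) as [y [hy E]].
assert (E2 : y = exist _ x hx) by now apply (sig_val_inj H).
now rewrite <- E2.
Qed.

(** * Ultrafilters *)

Record ultrafilter {T : Type} (U : (T -> Prop) -> Prop) : Prop := {
  ultraI : forall P Q, U P -> U Q -> U (fun x => P x /\ Q x);
  ultraS : forall P Q : T -> Prop, (forall x, P x -> Q x) -> U P -> U Q;
  ultra_ex : forall P, U P -> exists x, P x;
  ultraC : forall P, U P \/ U (fun x => ~ P x) }.

(** The sets that contain a finite intersection of members of [B] form a proper filter, which the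
    ultrafilter lemma extends. *)
Lemma ultrafilter_exists (T : Type) (B : (T -> Prop) -> Prop) :
  (forall l, (forall P, In P l -> B P) -> exists x, forall P, In P l -> P x) ->
  exists U, ultrafilter U /\ forall P, B P -> U P.
Proof.
intros hB.
set (F := fun P : T -> Prop => exists l, (forall Q, In Q l -> B Q) /\
  forall x, (forall Q, In Q l -> Q x) -> P x).
destruct (@filter.ultraFilterLemma T F) as [U [UU sU]].
- constructor.
  + intros [l [hl h]]; destruct (hB l hl) as [x hx]; exact (h x hx).
  + constructor.
    * exists []; split; [intros ? [] | now intros].
    * intros P Q [l [hl h]] [l' [hl' h']]; exists (l ++ l'); split.
      -- intros R hR; apply in_app_iff in hR as [hR|hR]; auto.
      -- intros x hx; split; [apply h | apply h']; intros; apply hx, in_app_iff; auto.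
    * intros P Q PQ [l [hl h]]; exists l; split; auto; intros x hx; exact (PQ x (h x hx)).
- pose proof (@filter.filter_filter _ _ (@filter.ultra_proper _ _ UU)) as FU.
  pose proof (@filter.filter_not_empty _ _ (@filter.ultra_proper _ _ UU)) as U0.
  exists U; split; [split |].
  + intros P Q hP hQ; exact (@filter.filterI _ _ FU P Q hP hQ).
  + intros P Q PQ hP; exact (@filter.filterS _ _ FU P Q PQ hP).
  + intros P hP; apply NNPP; intros nP; apply U0.
    apply (@filter.filterS _ _ FU P); auto; intros x hx; exfalso; apply nP; now exists x.
  + intros P; exact (@filter.in_ultra_setVsetC _ U P UU).
  + intros P hP; apply sU; exists [P]; split.
    * now intros Q [<-|[]].
    * intros x hx; apply hx; now left.
Qed.

Section Ultra.
Context {T : Type} {U : (T -> Prop) -> Prop} (hU : ultrafilter U).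

Lemma ultra_not P : ~ U P -> U (fun x => ~ P x).
Proof. intros h; now destruct (ultraC U hU P). Qed.

Lemma ultra_all {A} (l : list A) (P : A -> T -> Prop) :
  U (fun _ => True) -> (forall a, In a l -> U (P a)) ->
  U (fun x => forall a, In a l -> P a x).
Proof.
intros hT; induction l as [|a l IH]; intros h.
- apply (ultraS U hU _ _) with (2 := hT); now intros x _ b [].
- assert (h1 := ultraI U hU _ _ (h a (or_introl eq_refl))
    (IH (fun b hb => h b (or_intror hb)))).
  apply (ultraS U hU _ _) with (2 := h1); intros x [h2 h3] b [<-|hb]; auto.
Qed.

Lemma ultraT : U (fun _ => True).
Proof.
destruct (ultraC U hU (fun _ => True)) as [h|h]; auto.
apply (ultraS U hU _ _) with (2 := h); tauto.
Qed.

Lemma ultra_ex_in {A} (l : list A) (P : A -> T -> Prop) :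
  U (fun x => exists a, In a l /\ P a x) -> exists a, In a l /\ U (P a).
Proof.
intros h; apply NNPP; intros n.
assert (h1 : U (fun x => forall a, In a l -> ~ P a x)).
{ apply ultra_all; [apply ultraT |]; intros a ha; apply ultra_not; intros h1; apply n.
  now exists a. }
destruct (ultra_ex U hU _ (ultraI U hU _ _ h h1)) as [x [[a [ha h2]] h3]].
exact (h3 a ha h2).
Qed.
End Ultra.

(** * Choice, maxima of finite lists and an archimedean bound *)

Lemma choice {A B : Type} (R : A -> B -> Prop) :
  (forall x, exists y, R x y) -> exists f, forall x, R x (f x).
Proof.
intros h; exists (fun x => proj1_sig (constructive_indefinite_description _ (h x))).
intros x; now destruct (constructive_indefinite_description _ (h x)).
Qed.

(** Functions on a subgroup are handled as functions on all of [H]; outside [B] they take the dummy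
    value [a0]. *)
Lemma sub_extend (H : Grp) (B : H -> Prop) (hB : is_subgroup H B) {A : Type}
  (f : subgrp H B hB -> A) (a0 : A) :
  exists F : H -> A, forall x (h : B x), F x = f (exist _ x h).
Proof.
apply (choice (fun x a => forall h : B x, a = f (exist _ x h))); intros x.
destruct (classic (B x)) as [h|h]; [| now exists a0].
exists (f (exist _ x h)); intros h'; now rewrite (proof_irrelevance _ h h').
Qed.

Lemma list_maximum {A} (pr : A -> A -> Prop) (l : list A) :
  (forall x y z, In x l -> In y l -> In z l -> pr x y -> pr y z -> pr x z) ->
  (forall x y, pr x y \/ pr y x) ->
  l <> [] -> exists m, In m l /\ forall x, In x l -> pr x m.
Proof.
intros tr tot; induction l as [|a l IH]; intros hl; [easy |].
destruct l as [|b l].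
{ exists a; split; [now left |]; intros x [<-|[]]; now destruct (tot a a). }
destruct IH as [m [hm h]]; [intros x y z hx hy hz; apply tr; now right | easy |].
destruct (tot a m) as [h1|h1].
- exists m; split; [now right |]; intros x [<-|hx]; auto.
- exists a; split; [now left |]; intros x [<-|hx]; [now destruct (tot a a) |].
  apply (tr x m a); auto; solve [now left | now right].
Qed.

Lemma Rle_of_nat_bound (a b : R) : (forall n, INR n * a <= b) -> a <= 0.
Proof.
intros h; apply Rnot_lt_le; intros ha.
destruct (archimed (b / a)) as [h1 _].
set (k := up (b / a)) in *.
assert (h2 : IZR k <= INR (Z.to_nat k)).
{ rewrite INR_IZR_INZ; apply IZR_le; lia. }
assert (h3 := h (Z.to_nat k)).
assert (h4 : b / a * a < INR (Z.to_nat k) * a) by (apply Rmult_lt_compat_r; lra).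
unfold Rdiv in h4; rewrite Rmult_assoc, Rinv_l in h4; lra.
Qed.

(** * Integer powers *)

Definition zp {H : Grp} (x : H) (k : Z) : H :=
  match k with
  | Z0 => gone
  | Zpos p => Pos.iter (gmul x) gone p
  | Zneg p => Pos.iter (gmul (x^-1)) gone p
  end.

Section Powers.
Context {H : Grp}.
Implicit Types (x y : H) (j k : Z).

Lemma zp_succ x k : zp x (Z.succ k) = x · zp x k.
Proof.
destruct k as [|p|p]; [reflexivity | |].
- change (Z.succ (Zpos p)) with (Zpos (p + 1)); rewrite Pos.add_1_r; simpl.
  now rewrite Pos.iter_succ.
- destruct (Pos.eq_dec p 1) as [->|hp]; [simpl; grp |].
  replace (Z.succ (Zneg p)) with (Zneg (Pos.pred p)) by lia.
  rewrite <- (Pos.succ_pred p hp) at 2; simpl; rewrite Pos.iter_succ; grp.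
Qed.

Lemma zp_pred x k : zp x (Z.pred k) = x^-1 · zp x k.
Proof. rewrite <- (Z.succ_pred k) at 2; rewrite zp_succ; grp. Qed.

Lemma zp_add x j k : zp x (j + k) = zp x j · zp x k.
Proof.
induction j as [|j IH|j IH] using Z.peano_ind.
- simpl; grp.
- rewrite Z.add_succ_l, !zp_succ, IH; grp.
- rewrite Z.add_pred_l, !zp_pred, IH; grp.
Qed.

Lemma zp1 x : zp x 1 = x.
Proof. simpl; grp. Qed.

Lemma zp_opp x k : zp x (- k) = (zp x k)^-1.
Proof.
apply (gmul_cancel_l (zp x k)); rewrite <- zp_add, Z.add_opp_diag_r; simpl; grp.
Qed.

Lemma zp_sub (B : H -> Prop) x k : is_subgroup H B -> B x -> B (zp x k).
Proof.
intros hB hx; induction k as [|k IH|k IH] using Z.peano_ind.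
- now apply sub1.
- rewrite zp_succ; now apply (subM hB).
- rewrite zp_pred; apply (subM hB); auto; now apply subV.
Qed.
End Powers.

Ltac subg hB := repeat first [assumption | apply (sub1 hB) | apply (subM hB)
  | apply (subV hB) | apply (zp_sub _ _ _ hB)].

Definition additive_on {H : Grp} (B : H -> Prop) (tau : H -> R) : Prop :=
  forall x y, B x -> B y -> tau (x · y) = tau x + tau y.

Section Additive.
Context {H : Grp} {B : H -> Prop} {tau : H -> R}.
Context (hB : is_subgroup H B) (ht : additive_on B tau).

Lemma add1 : tau gone = 0.
Proof.
assert (h := ht gone gone (sub1 hB) (sub1 hB)); rewrite gmul1 in h; lra.
Qed.

Lemma addV x : B x -> tau (x^-1) = - tau x.
Proof.
intros hx; assert (h := ht x (x^-1) hx (subV hB _ hx)).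
rewrite gmulrV, add1 in h; lra.
Qed.

Lemma add_zp x k : B x -> tau (zp x k) = IZR k * tau x.
Proof.
intros hx; induction k as [|k IH|k IH] using Z.peano_ind.
- simpl; rewrite add1; lra.
- assert (hk := zp_sub B x k hB hx); rewrite zp_succ, ht, IH, succ_IZR; auto; lra.
- assert (hk := zp_sub B x k hB hx).
  rewrite zp_pred, ht, addV, IH; auto; subg hB.
  unfold Z.pred; rewrite plus_IZR; lra.
Qed.
End Additive.

(** * Left preorders and their limits *)

(** Without antisymmetry such a relation encodes an action on a chain with a base point: [le x y]
    compares the images of the base point under [x] and [y]. *)
Record lpre (H : Grp) (le : H -> H -> Prop) : Prop := {
  lpre_trans : forall x y z, le x y -> le y z -> le x z;
  lpre_total : forall x y, le x y \/ le y x;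
  lpre_left : forall g x y, le x y -> le (g · x) (g · y) }.

Arguments lpre_trans {H le}.
Arguments lpre_total {H le}.
Arguments lpre_left {H le}.

(** The element [x] stands for a point of the chain, and the negated inequality says that [a] moves
    it strictly upwards. *)
Definition realized {H : Grp} (le : H -> H -> Prop) (A : list H) : Prop :=
  exists x, forall a, In a A -> ~ le (a · x) x.

Definition drifts_on {H : Grp} (le : H -> H -> Prop) (B : H -> Prop) (tau : H -> R) :=
  additive_on B tau /\ (exists x, B x /\ tau x <> 0) /\
  forall A, (forall a, In a A -> B a /\ 0 < tau a) -> realized le A.

Definition has_drift {H : Grp} (le : H -> H -> Prop) : Prop :=
  exists tau, drifts_on le (fun _ => True) tau.

(* [le'] lies in the closure of the conjugation orbit of [le] in the space of left preorders. *)
Definition limit {H : Grp} (le' le : H -> H -> Prop) : Prop :=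
  forall A, (forall a, In a A -> ~ le' a gone) -> realized le A.

(** A bound that is uniform in the point [x], so that it passes to limits; the element [w] may
    depend on [x]. *)
Definition covers {H : Grp} (le : H -> H -> Prop) (W : list H) (g : H) : Prop :=
  forall x, exists w, In w W /\ le (g · x) (w · x).

Definition dominates {H : Grp} (le : H -> H -> Prop) (B : H -> Prop) : Prop :=
  forall g, exists W, (forall w, In w W -> B w) /\ covers le W g.

Definition trivial_on {H : Grp} (le : H -> H -> Prop) (M : H -> Prop) : Prop :=
  forall m x, M m -> le (m · x) x.

Definition positive_on {H : Grp} (le : H -> H -> Prop) (N : H -> Prop) (tau : H -> R) :=
  forall g, N g -> 0 < tau g -> forall x, ~ le (g · x) x.

Section Preorder.
Context {H : Grp} {le : H -> H -> Prop} (hle : lpre H le).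

Lemma lpre_refl x : le x x.
Proof. now destruct (lpre_total hle x x). Qed.

Lemma lpre_cancel g x y : le (g · x) (g · y) -> le x y.
Proof. intros h; apply (lpre_left hle (g^-1)) in h; now grp in h. Qed.

Lemma lpre_nle x y : ~ le x y -> le y x.
Proof. intros h; now destruct (lpre_total hle x y). Qed.

Lemma lpre_inv g x : le (g · x) x <-> le x (g^-1 · x).
Proof.
split; intros h.
- apply (lpre_left hle (g^-1)) in h; now grp in h.
- apply (lpre_left hle g) in h; now grp in h.
Qed.

Lemma lpre_zp_le g x k : (0 <= k)%Z -> le (g · x) x -> le (zp g k · x) x.
Proof.
intros hk h; pattern k; apply natlike_ind; auto; [simpl; rewrite gmul1; apply lpre_refl |].
clear hk; intros j hj IH; rewrite zp_succ, gmulAr.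
exact (lpre_trans hle _ _ _ (lpre_left hle g _ _ IH) h).
Qed.

Lemma lpre_nomax : (exists g, ~ le g gone) -> forall x, exists y, ~ le y x.
Proof.
intros [g hg] x; exists (x · g); intros h; apply hg, (lpre_cancel x); now grp.
Qed.

(** Compactness: the limit compares [g · x] with [h · x] along an ultrafilter of points [x] that
    contains, for each [a] in [Phi], the set of points moved upwards by [a]. *)
Lemma limit_exists (Phi : H -> Prop) :
  (forall A, (forall a, In a A -> Phi a) -> realized le A) ->
  exists le', lpre H le' /\ limit le' le /\ forall a, Phi a -> ~ le' a gone.
Proof.
intros hPhi.
destruct (ultrafilter_exists H (fun P => exists a, Phi a /\ P = fun x => ~ le (a · x) x))
  as [U [hU hB]].
{ intros l hl.
  assert (E : exists A, (forall a, In a A -> Phi a) /\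
            forall P, In P l -> exists a, In a A /\ P = fun x => ~ le (a · x) x).
  { induction l as [|P l IH]; [exists []; split; intros ? [] |].
    destruct IH as [A [hA h]]; [intros; apply hl; now right |].
    destruct (hl P (or_introl eq_refl)) as [a [ha ->]].
    exists (a :: A); split.
    - intros b [<-|hb]; auto.
    - intros Q [<-|hQ]; [exists a; split; auto; now left |].
      destruct (h Q hQ) as [b [hb ->]]; exists b; split; auto; now right. }
  destruct E as [A [hA h]]; destruct (hPhi A hA) as [x hx]; exists x.
  intros P hP; destruct (h P hP) as [a [ha ->]]; now apply hx. }
exists (fun g h => U (fun x => le (g · x) (h · x))); split; [split |split].
- intros g h k h1 h2; apply (ultraS U hU _ _) with (2 := ultraI U hU _ _ h1 h2).
  intros x [h3 h4]; exact (lpre_trans hle _ _ _ h3 h4).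
- intros g h; destruct (ultraC U hU (fun x => le (g · x) (h · x))) as [h1|h1]; auto.
  right; apply (ultraS U hU _ _) with (2 := h1); intros x; apply lpre_nle.
- intros f g h h1; apply (ultraS U hU _ _) with (2 := h1); intros x h2.
  rewrite !gmulAr; now apply (lpre_left hle).
- intros A hA; apply (ultra_ex U hU), (ultra_all hU A (fun a x => ~ le (a · x) x));
   [exact (ultraT hU) |].
  intros a ha; apply (ultraS U hU _ _) with (2 := ultra_not hU _ (hA a ha)).
  intros x; now rewrite gmul1.
- intros a ha h1; assert (h2 := hB _ (ex_intro _ a (conj ha eq_refl))).
  destruct (ultra_ex U hU _ (ultraI U hU _ _ h1 h2)) as [x [h3 h4]].
  apply h4; now rewrite gmul1 in h3.
Qed.

(** Positivity at [gone] spreads to every point. If [g] does not move [x] upwards, neither do its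
    powers; domination encloses [x] between elements [n^-1] and [m] of [N], which bounds all
    multiples of [tau g] by [tau m + tau n]. *)
Lemma positive_of_dominates (N : H -> Prop) (tau : H -> R) :
  is_subgroup H N -> additive_on N tau -> dominates le N ->
  (forall g, N g -> 0 < tau g -> ~ le g gone) -> positive_on le N tau.
Proof.
intros hN ht hd hp g hg tg x hx.
destruct (hd x) as [W [hW cW]]; destruct (cW gone) as [m [hm xm]].
destruct (hd (x^-1)) as [V [hV cV]]; destruct (cV x) as [n [hn xn]].
rewrite !gmulr1 in xm; rewrite gmulV in xn.
apply hW in hm; apply hV in hn.
assert (nx : le (n^-1) x).
{ apply (lpre_left hle (n^-1)) in xn; now grp in xn. }
apply (Rlt_not_le _ _ tg), (Rle_of_nat_bound _ (tau m + tau n)); intros k.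
assert (h : le (m^-1 · (zp g (Z.of_nat k) · n^-1)) gone).
{ apply (lpre_cancel m); grp; apply (lpre_trans hle _ x); auto.
  apply (lpre_trans hle _ (zp g (Z.of_nat k) · x)); [now apply (lpre_left hle) |].
  apply lpre_zp_le; auto; lia. }
assert (nk : N (zp g (Z.of_nat k))) by now apply zp_sub.
assert (h1 : tau (m^-1 · (zp g (Z.of_nat k) · n^-1)) <= 0).
{ apply Rnot_lt_le; intros h2; revert h; apply hp; auto.
  subg hN. }
rewrite !ht, !(addV hN ht), (add_zp hN ht), <- INR_IZR_INZ in h1;
  subg hN; lra.
Qed.

(** Where [tau] is positive, [tau'] is nonnegative. Applied to a power of [g] times a power of [z],
    this compares the two homomorphisms up to an error that becomes negligible for large powers. *)
Lemma positive_unique (N : H -> Prop) (tau tau' : H -> R) (z : H) :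
  is_subgroup H N -> additive_on N tau -> additive_on N tau' ->
  (forall g, N g -> 0 < tau g -> ~ le g gone) ->
  (forall g, N g -> 0 < tau' g -> ~ le g gone) -> N z -> 0 < tau z ->
  0 <= tau' z /\ forall g, N g -> tau' g = tau' z / tau z * tau g.
Proof.
intros hN ht ht' hp hp' hz tz.
assert (key : forall g, N g -> 0 < tau g -> 0 <= tau' g).
{ intros g hg h; apply Rnot_lt_le; intros h1.
  assert (h2 : ~ le (g^-1) gone).
  { apply hp'; [now apply (subV hN) | rewrite (addV hN ht'); auto; lra]. }
  apply h2, (lpre_cancel g); grp; apply lpre_nle; now apply hp. }
split; [now apply key |].
assert (half : forall g, N g -> tau' z / tau z * tau g <= tau' g).
{ intros g hg; apply Rminus_le, (Rle_of_nat_bound _ (2 * tau' z)); intros n.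
  destruct (archimed (INR n * tau g / tau z)) as [h1 h2].
  (* [up] exceeds its argument by at most 1, so that [q - 2 < k < q]; the second inequality makes
     [tau] positive on the product below. *)
  set (k := (up (INR n * tau g / tau z) - 2)%Z).
  assert (hk : IZR k = IZR (up (INR n * tau g / tau z)) - 2)
    by (unfold k; now rewrite minus_IZR).
  set (q := INR n * tau g / tau z) in *.
  assert (hq : q * tau z = INR n * tau g) by (unfold q; field; lra).
  assert (h3 : 0 <= tau' (zp g (Z.of_nat n) · zp z (- k))).
  { apply key.
    - apply (subM hN); now apply zp_sub.
    - rewrite ht, !(add_zp hN ht), <- INR_IZR_INZ, opp_IZR; subg hN.
      assert (IZR k * tau z < q * tau z) by (apply Rmult_lt_compat_r; lra); lra. }
  rewrite ht', !(add_zp hN ht'), <- INR_IZR_INZ, opp_IZR in h3; subg hN.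
  assert (h4 := key z hz tz).
  assert (h5 : (q - 2) * tau' z <= IZR k * tau' z)
    by (apply Rmult_le_compat_r; lra).
  replace (INR n * (tau' z / tau z * tau g - tau' g))
    with (q * tau' z - INR n * tau' g) by (unfold q; field; lra).
  lra. }
intros g hg; apply Rle_antisym; [| now apply half].
assert (h := half (g^-1) (subV hN _ hg)).
rewrite (addV hN ht), (addV hN ht') in h; auto; lra.
Qed.
End Preorder.

Section Limit.
Context {H : Grp} {le le' : H -> H -> Prop}.
Context (hle : lpre H le) (hle' : lpre H le') (hl : limit le' le).

Lemma has_drift_limit : has_drift le' -> has_drift le.
Proof.
intros [tau [ht [h0 hr]]]; exists tau; split; [auto | split; auto].
intros A hA; destruct (hr A hA) as [x hx].
(* Conjugation by [x] carries the condition from the point [x] to [gone], where [limit] applies. *)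
destruct (hl (map (fun a => x^-1 · a · x) A)) as [y hy].
- intros b hb; apply in_map_iff in hb as [a [<- ha]]; intros h; apply (hx a ha).
  apply (lpre_cancel hle' (x^-1)); now grp; grp in h.
- exists (x · y); intros a ha h; apply (hy (x^-1 · a · x)).
  + now apply (in_map (fun a => x^-1 · a · x)).
  + apply (lpre_cancel hle x); now grp; grp in h.
Qed.

(** A failure at one point consists of finitely many strict inequalities in [le'], which [limit]
    transfers to a point of [le]. *)
Lemma limit_covers W g : covers le W g -> covers le' W g.
Proof.
intros hc x; apply NNPP; intros hn.
destruct (hl (map (fun w => (w · x)^-1 · (g · x)) W)) as [y hy].
- intros a ha; apply in_map_iff in ha as [w [<- hw]]; intros h; apply hn.
  exists w; split; auto; apply (lpre_cancel hle' ((w · x)^-1)); now grp; grp in h.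
- destruct (hc (x · y)) as [w [hw h]]; apply (hy ((w · x)^-1 · (g · x))).
  + now apply (in_map (fun w => (w · x)^-1 · (g · x))).
  + apply (lpre_cancel hle (w · x)); now grp; grp in h.
Qed.

Lemma limit_trivial M : trivial_on le M -> trivial_on le' M.
Proof.
intros h m x hm; destruct (limit_covers [gone] m) with (x := x) as [w [[<-|[]] hw]].
- intros y; exists gone; split; [now left |]; rewrite gmul1; now apply h.
- now rewrite gmul1 in hw.
Qed.
End Limit.

(** The order on the convex hulls of the [N]-orbits: [x] and [y] become equivalent exactly when each
    lies between two points of the [N]-orbit of the other. *)
Definition hull {H : Grp} (le : H -> H -> Prop) (N : H -> Prop) (x y : H) : Prop :=
  exists n, N n /\ le x (n · y).

Section Hull.
Context {H : Grp} {le : H -> H -> Prop} {N : H -> Prop}.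
Context (hle : lpre H le) (hN : is_subgroup H N) (nN : is_normal H N).

Lemma hull_le x y : le x y -> hull le N x y.
Proof. intros h; exists gone; split; [now apply sub1 | now rewrite gmul1]. Qed.

Lemma hull_lpre : lpre H (hull le N).
Proof.
split.
- intros x y z [m [hm h]] [n [hn h']]; exists (m · n); split; [subg hN |].
  apply (lpre_trans hle _ _ _ h); rewrite gmulAr; now apply (lpre_left hle).
- intros x y; destruct (lpre_total hle x y); [left | right]; now apply hull_le.
- intros g x y [n [hn h]]; exists (g · n · g^-1); split; [now apply nN |].
  grp; now apply (lpre_left hle).
Qed.

Lemma hull_trivial : trivial_on (hull le N) N.
Proof. intros m x hm; exists m; split; auto; now apply lpre_refl. Qed.

Lemma hull_drift : has_drift (hull le N) -> has_drift le.
Proof.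
intros [tau [ht [h0 hr]]]; exists tau; split; [auto | split; auto].
intros A hA; destruct (hr A hA) as [x hx]; exists x; intros a ha h.
now apply (hx a ha), hull_le.
Qed.

Lemma hull_covers W g : covers le W g -> covers (hull le N) W g.
Proof.
intros h x; destruct (h x) as [w [hw h']]; exists w; split; auto; now apply hull_le.
Qed.
End Hull.

(** * Drift on a dominating normal subgroup *)

Section DriftUnion.
Context {H : Grp} {le : H -> H -> Prop} {N : H -> Prop} {F : list H}.
Context (hle : lpre H le) (hN : is_subgroup H N) (hF : forall f, In f F -> N f).
Context (hd : dominates le (gen_by H F)).

Let good (T : list H) := incl F T /\ forall t, In t T -> N t.
Let F' := F ++ map ginv F.
(** Scaling so that the largest value on the generators in [F] and their inverses is 1 makes the
    values at a fixed element bounded independently of [T], as the ultralimit requires. *)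
Let normalized T tau := drifts_on le (gen_by H T) tau /\
  (exists f, In f F' /\ tau f = 1) /\ forall f, In f F' -> tau f <= 1.

Lemma gen_incl (S T : list H) x : incl S T -> gen_by H S x -> gen_by H T x.
Proof. intros hi; apply gen_min; [apply gen_subgroup | intros; now apply gen_in, hi]. Qed.

(** Otherwise all [w^-1 · g] have positive [tau], and a point that they all move upwards violates
    the covering. *)
Lemma drift_covered T tau W g : incl F T -> drifts_on le (gen_by H T) tau ->
  gen_by H T g -> (forall w, In w W -> gen_by H F w) -> covers le W g ->
  exists w, In w W /\ tau g <= tau w.
Proof.
intros hi [ht [_ hr]] hg hW hc; apply NNPP; intros hn.
assert (gT := gen_subgroup H T).
destruct (hr (map (fun w => w^-1 · g) W)) as [x hx].
- intros a ha; apply in_map_iff in ha as [w [<- hw]].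
  assert (gw : gen_by H T w) by now apply (gen_incl F), hW.
  split; [subg gT |].
  rewrite ht, (addV gT ht); subg gT.
  assert (~ tau g <= tau w) by (intros h; apply hn; now exists w); lra.
- destruct (hc x) as [w [hw h]]; apply (hx (w^-1 · g)).
  + now apply (in_map (fun w => w^-1 · g)).
  + apply (lpre_cancel hle w); now grp.
Qed.

Lemma in_F'_gen f : In f F' -> gen_by H F f.
Proof.
intros hf; apply in_app_iff in hf as [hf|hf]; [now apply gen_in |].
apply in_map_iff in hf as [g [<- hg]]; now apply gen_inv, gen_in.
Qed.

(** [tau] cannot vanish on [F]: it would vanish on the dominating subgroup generated by [F], and
    [drift_covered] would make it nonpositive everywhere. So one may divide by its maximum over
    [F']. *)
Lemma drift_normalize T tau : incl F T -> drifts_on le (gen_by H T) tau ->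
  exists tau', normalized T tau'.
Proof.
intros hi hdr; pose proof hdr as [ht [[g0 [hg0 tg0]] hr]].
assert (gT := gen_subgroup H T).
assert (hg : exists g, gen_by H T g /\ 0 < tau g).
{ destruct (Rlt_le_dec 0 (tau g0)); [now exists g0 |].
  exists (g0^-1); split; [subg gT | rewrite (addV gT ht); auto; lra]. }
destruct hg as [g [hg tg]].
assert (aF : additive_on (gen_by H F) tau)
  by (intros x y hx hy; apply ht; now apply (gen_incl F)).
assert (gF := gen_subgroup H F).
assert (hf : exists f, In f F /\ tau f <> 0).
{ apply NNPP; intros hn.
  assert (hz : forall w, gen_by H F w -> tau w = 0).
  { intros w hw; induction hw as [x hx| |x y hx IHx hy IHy|x hx IHx].
    - apply NNPP; intros h; apply hn; now exists x.
    - exact (add1 gF aF).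
    - rewrite aF; auto; lra.
    - rewrite (addV gF aF); auto; lra. }
  destruct (hd g) as [W [hW hc]].
  destruct (drift_covered T tau W g hi hdr hg hW hc) as [w [hw h]].
  rewrite (hz w (hW w hw)) in h; lra. }
destruct hf as [f [hf tf]].
assert (hf' : exists f, In f F' /\ 0 < tau f).
{ unfold F'; destruct (Rlt_le_dec 0 (tau f)).
  - exists f; split; auto; apply in_app_iff; auto.
  - exists (f^-1); split; [apply in_app_iff; right; now apply in_map |].
    rewrite (addV gF aF); [lra | now apply gen_in]. }
destruct hf' as [f1 [hf1 tf1]].
destruct (list_maximum (fun x y => tau x <= tau y) F') as [m [hm hmax]].
- intros x y w _ _ _; lra.
- intros x y; destruct (Rle_lt_dec (tau x) (tau y)); [left | right]; lra.
- intros E; now rewrite E in hf1.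
- assert (tm : 0 < tau m) by (apply Rlt_le_trans with (tau f1); auto).
  exists (fun x => tau x / tau m); split; [split; [|split] |split].
  + intros x y hx hy; rewrite ht; auto; field; lra.
  + exists g; split; auto; apply Rgt_not_eq, Rdiv_lt_0_compat; auto.
  + intros A hA; apply hr; intros a ha; destruct (hA a ha) as [h1 h2]; split; auto.
    replace (tau a) with (tau a / tau m * tau m) by (field; lra); now apply Rmult_lt_0_compat.
  + exists m; split; auto; field; lra.
  + intros x hx; apply (Rmult_le_reg_r (tau m)); auto.
    replace (tau x / tau m * tau m) with (tau x) by (field; lra); rewrite Rmult_1_l; auto.
Qed.

(** The number of letters in an expression of [w] serves as a bound, whatever [T] is. *)
Lemma normalized_word w : gen_by H F w ->
  exists n : R, forall T tau, incl F T -> normalized T tau -> Rabs (tau w) <= n.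
Proof.
intros hw; induction hw as [x hx| |x y hx [a ha] hy [b hb]|x hx [a ha]].
- exists 1; intros T tau hi [[ht _] [_ h]]; assert (gT := gen_subgroup H T).
  assert (h1 : tau x <= 1) by (apply h, in_app_iff; auto).
  assert (h2 : tau (x^-1) <= 1) by (apply h, in_app_iff; right; now apply in_map).
  rewrite (addV gT ht) in h2; [| apply gen_in; auto]; apply Rabs_le; lra.
- exists 0; intros T tau hi [[ht _] _]; rewrite (add1 (gen_subgroup H T) ht), Rabs_R0; lra.
- exists (a + b); intros T tau hi hn; pose proof hn as [[ht _] _].
  rewrite ht; try now apply (gen_incl F).
  assert (h1 := ha T tau hi hn); assert (h2 := hb T tau hi hn).
  assert (h3 := Rabs_triang (tau x) (tau y)); lra.
- exists a; intros T tau hi hn; pose proof hn as [[ht _] _].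
  rewrite (addV (gen_subgroup H T) ht), Rabs_Ropp;
    [now apply (ha T) | now apply (gen_incl F)].
Qed.

Lemma normalized_bound g : exists n : R, forall T tau, incl F T -> gen_by H T g ->
  normalized T tau -> Rabs (tau g) <= n.
Proof.
assert (up : forall g, exists n : R, forall T tau, incl F T -> gen_by H T g ->
  normalized T tau -> tau g <= n).
{ clear g; intros g; destruct (hd g) as [W [hW hc]].
  assert (hb : exists n, forall w, In w W -> forall T tau, incl F T -> normalized T tau ->
     tau w <= n).
  { clear hc; induction W as [|w W IH]; [exists 0; intros ? [] |].
    destruct IH as [n hn]; [intros; apply hW; now right |].
    destruct (normalized_word w) as [m hm]; [apply hW; now left |].
    exists (Rmax n m); intros v [<-|hv] T tau hi hnm.
    - assert (h1 := hm T tau hi hnm); assert (h2 := Rmax_r n m).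
      assert (h3 := Rle_abs (tau w)); lra.
    - assert (h1 := hn v hv T tau hi hnm); assert (h2 := Rmax_l n m); lra. }
  destruct hb as [n hn]; exists n; intros T tau hi hg hnm.
  destruct (drift_covered T tau W g hi (proj1 hnm) hg hW hc) as [w [hw h]].
  assert (h1 := hn w hw T tau hi hnm); lra. }
destruct (up g) as [n hn], (up (g^-1)) as [m hm].
exists (Rmax n m); intros T tau hi hg hnm; pose proof hnm as [[ht _] _].
assert (h1 := hn T tau hi hg hnm); assert (h2 := hm T tau hi (gen_inv _ _ _ hg) hnm).
rewrite (addV (gen_subgroup H T) ht) in h2; auto.
assert (h3 := Rmax_l n m); assert (h4 := Rmax_r n m); apply Rabs_le; lra.
Qed.

(** [L] is the supremum of the numbers [r] that are lower bounds of [u] on some set of [U]. *)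
Lemma ultralimit {T} (U : (T -> Prop) -> Prop) (hU : ultrafilter U) (u : T -> R) :
  (exists B, U (fun t => Rabs (u t) <= B)) ->
  exists L, forall eps, 0 < eps -> U (fun t => Rabs (u t - L) < eps).
Proof.
intros [B hB].
destruct (completeness (fun r => U (fun t => r <= u t))) as [L [hub hlub]].
- exists B; intros r hr; destruct (ultra_ex U hU _ (ultraI U hU _ _ hB hr)) as [t [h1 h2]].
  assert (h3 := Rle_abs (u t)); lra.
- exists (- B); apply (ultraS U hU _ _) with (2 := hB); intros t ht.
  assert (h3 := Rle_abs (- u t)); rewrite Rabs_Ropp in h3; lra.
- exists L; intros eps he.
  assert (h1 : U (fun t => ~ L + eps / 2 <= u t)).
  { apply ultra_not; auto; intros h; apply hub in h; lra. }
  assert (h2 : exists r, U (fun t => r <= u t) /\ L - eps < r).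
  { apply NNPP; intros hn; assert (h : L <= L - eps); [| lra].
    apply hlub; intros r hr; apply Rnot_lt_le; intros h; apply hn; now exists r. }
  destruct h2 as [r [h2 h3]].
  apply (ultraS U hU _ _) with (2 := ultraI U hU _ _ h1 h2); intros t [h4 h5].
  apply Rabs_def1; lra.
Qed.

(** The homomorphism is an ultralimit of normalized homomorphisms over the finite sets [T] between
    [F] and [N]. It does not vanish, because one and the same element of [F'] has value 1 for almost
    all [T]. *)
Lemma drift_union :
  (forall T, incl F T -> (forall t, In t T -> N t) ->
     exists tau, drifts_on le (gen_by H T) tau) ->
  exists tau, drifts_on le N tau.
Proof.
intros hT.
assert (hs : exists sigma, forall T, good T -> normalized T (sigma T)).
{ apply (choice (fun T tau => good T -> normalized T tau)); intros T.
  destruct (classic (good T)) as [[h1 h2]|h]; [| now exists (fun _ => 0)].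
  destruct (hT T h1 h2) as [tau ht]; destruct (drift_normalize T tau h1 ht) as [tau' h'].
  now exists tau'. }
destruct hs as [sigma hs].
(* Every element of [N] lies in almost all [T], so that a condition on finitely many elements can be
   tested in a single [T]. *)
destruct (ultrafilter_exists (list H)
   (fun P => exists g, N g /\ P = fun T => good T /\ In g T)) as [U [hU hB]].
{ intros l hl.
  assert (E : exists gs, (forall g, In g gs -> N g) /\ forall P, In P l -> exists g,
     In g gs /\ P = fun T => good T /\ In g T).
  { induction l as [|P l IH]; [exists []; split; intros ? [] |].
    destruct IH as [gs [h1 h2]]; [intros; apply hl; now right |].
    destruct (hl P (or_introl eq_refl)) as [g [hg ->]]; exists (g :: gs); split.
    - intros x [<-|hx]; auto.
    - intros Q [<-|hQ]; [exists g; split; auto; now left |].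
      destruct (h2 Q hQ) as [x [hx ->]]; exists x; split; auto; now right. }
  destruct E as [gs [h1 h2]]; exists (F ++ gs); intros P hP.
  destruct (h2 P hP) as [g [hg ->]]; split; [split |].
  - intros x hx; apply in_app_iff; auto.
  - intros t ht; apply in_app_iff in ht as [ht|ht]; auto.
  - apply in_app_iff; auto. }
assert (ev : forall g, N g -> U (fun T => good T /\ gen_by H T g)).
{ intros g hg; apply (ultraS U hU _ _) with (2 := hB _ (ex_intro _ g (conj hg eq_refl))).
  intros T [h1 h2]; split; auto; now apply gen_in. }
assert (hL : exists tau, forall g, N g -> forall eps, 0 < eps ->
   U (fun T => Rabs (sigma T g - tau g) < eps)).
{ apply (choice (fun g r => N g -> forall eps, 0 < eps ->
     U (fun T => Rabs (sigma T g - r) < eps))); intros g.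
  destruct (classic (N g)) as [hg|hg]; [| now exists 0].
  destruct (ultralimit U hU (fun T => sigma T g)) as [L hL]; [| now exists L].
  destruct (normalized_bound g) as [n hn]; exists n.
  apply (ultraS U hU _ _) with (2 := ev g hg); intros T [h1 h2].
  apply (hn T); auto; now apply h1. }
destruct hL as [tau hL]; exists tau; split; [|split].
- intros x y hx hy; apply NNPP; intros hne.
  set (d := Rabs (tau (x · y) - (tau x + tau y))).
  assert (hd0 : 0 < d) by (apply Rabs_pos_lt; lra).
  assert (h1 := hL _ (subM hN _ _ hx hy) (d / 3) ltac:(lra)).
  assert (h2 := hL _ hx (d / 3) ltac:(lra)); assert (h3 := hL _ hy (d / 3) ltac:(lra)).
  assert (h4 := ultraI U hU _ _ (ev x hx) (ev y hy)).
  destruct (ultra_ex U hU _ (ultraI U hU _ _ h1 (ultraI U hU _ _ h2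
     (ultraI U hU _ _ h3 h4)))) as [T [k1 [k2 [k3 [[gT k4] [_ k5]]]]]].
  destruct (hs T gT) as [[ht _] _]; rewrite (ht x y k4 k5) in k1.
  unfold d in *; revert hd0 k1 k2 k3; unfold Rabs; repeat destruct Rcase_abs; lra.
- assert (h1 : U (fun T => exists f, In f F' /\ sigma T f = 1)).
  { apply (ultraS U hU _ _) with (2 := ev gone (sub1 hN)); intros T [gT _].
    now destruct (hs T gT) as [_ [h _]]. }
  destruct (ultra_ex_in hU F' (fun f T => sigma T f = 1) h1) as [f [hf h2]].
  assert (Nf : N f) by (apply (gen_min H F); auto; now apply in_F'_gen).
  exists f; split; auto; intros h0.
  destruct (ultra_ex U hU _ (ultraI U hU _ _ h2 (hL f Nf 1 Rlt_0_1))) as [T [k1 k2]].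
  rewrite k1, h0, Rabs_right in k2; lra.
- intros A hA.
  assert (h1 : U (fun T => forall a, In a A -> 0 < sigma T a /\ good T /\ gen_by H T a)).
  { apply (ultra_all hU A (fun a T => 0 < sigma T a /\ good T /\ gen_by H T a));
      [exact (ultraT hU) |]; intros a ha; destruct (hA a ha) as [Na ta].
    apply (ultraS U hU _ _) with (2 := ultraI U hU _ _ (hL a Na (tau a) ta) (ev a Na)).
    intros T [k1 k2]; split; auto; apply Rabs_def2 in k1; lra. }
  destruct (ultra_ex U hU _ (ultraI U hU _ _ (ev gone (sub1 hN)) h1)) as [T [[gT _] h]].
  destruct (hs T gT) as [[_ [_ hr]] _]; apply hr; intros a ha.
  now destruct (h a ha) as [? [_ ?]].
Qed.
End DriftUnion.

(** * Extending a homomorphism from a dominating normal subgroup *)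

Record dominating_hom (H : Grp) (le : H -> H -> Prop) (N : H -> Prop) (tau : H -> R) : Prop := {
  dh_sub : is_subgroup H N;
  dh_normal : is_normal H N;
  dh_add : additive_on N tau;
  dh_pos : exists z, N z /\ 0 < tau z;
  dh_positive : positive_on le N tau;
  dh_dom : dominates le N }.

Definition invariant {H : Grp} (N : H -> Prop) (tau : H -> R) : Prop :=
  forall h x, N x -> tau (h · x · h^-1) = tau x.

(* [z] acts as a fundamental translation and [N] acts through its powers, so that [H / N] acts on a circle. *)
Record circular (H : Grp) (le : H -> H -> Prop) (N : H -> Prop) (tau : H -> R) (z : H) : Prop := {
  ci_pre : lpre H le;
  ci_dom : dominating_hom H le N tau;
  ci_inv : invariant N tau;
  ci_z : N z;
  ci_z1 : tau z = 1;
  ci_int : forall g, N g -> exists k, tau g = IZR k;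
  ci_ker : trivial_on le (fun g => N g /\ tau g = 0) }.

Section DominatingHom.
Context {H : Grp} {le : H -> H -> Prop} {N : H -> Prop} {tau : H -> R}.
Context (hle : lpre H le) (hd : dominating_hom H le N tau).

Let hN := dh_sub _ _ _ _ hd.
Let nN := dh_normal _ _ _ _ hd.
Let ht := dh_add _ _ _ _ hd.

Lemma dh_pos1 g : N g -> 0 < tau g -> ~ le g gone.
Proof.
intros hg tg h; apply (dh_positive _ _ _ _ hd g hg tg gone); now rewrite gmulr1.
Qed.

Lemma dh_mono v w : N v -> N w -> le v w -> tau v <= tau w.
Proof.
intros hv hw h; apply Rnot_lt_le; intros h1.
apply (dh_pos1 (w^-1 · v)).
- subg hN.
- rewrite ht, (addV hN ht); subg hN; lra.
- apply (lpre_cancel hle w); now grp.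
Qed.

Lemma dh_upper h : exists w, N w /\ le h w.
Proof.
destruct (dh_dom _ _ _ _ hd h) as [W [hW hc]]; destruct (hc gone) as [w [hw h1]].
rewrite !gmulr1 in h1; exists w; auto.
Qed.

Lemma dh_lower h : exists w, N w /\ le w h.
Proof.
destruct (dh_dom _ _ _ _ hd (h^-1)) as [W [hW hc]]; destruct (hc h) as [w [hw h1]].
exists (w^-1); split; [apply (subV hN); auto |].
apply (lpre_cancel hle w); now grp; rewrite gmulV in h1.
Qed.

(** Conjugation by [h] turns [tau] into another homomorphism compatible with the order, which by
    uniqueness is a multiple of [tau]. *)
Lemma dh_multiplier : exists lam : H -> R, (forall h, 0 < lam h) /\
  (forall h x, N x -> tau (h · x · h^-1) = lam h * tau x) /\
  forall h k, lam (h · k) = lam h * lam k.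
Proof.
destruct (dh_pos _ _ _ _ hd) as [z [hz tz]].
set (lam := fun h => tau (h · z · h^-1) / tau z).
assert (hl : forall h, 0 <= lam h /\ forall x, N x -> tau (h · x · h^-1) = lam h * tau x).
{ intros h.
  destruct (positive_unique hle N tau (fun x => tau (h · x · h^-1)) z) as [h1 h2]; auto.
  - intros x y hx hy; rewrite <- ht; [| now apply nN ..]; f_equal; grp.
  - exact dh_pos1.
  - intros g hg h0 h1; apply (dh_positive _ _ _ _ hd _ (nN h g hg) h0 h); grp.
    apply (lpre_left hle h) in h1; now rewrite gmulr1 in h1.
  - split; auto; apply Rmult_le_pos; auto; apply Rlt_le; now apply Rinv_0_lt_compat. }
assert (hm : forall h k, lam (h · k) = lam h * lam k).
{ intros h k; apply (Rmult_eq_reg_r (tau z)); [| lra].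
  rewrite <- (proj2 (hl (h · k)) z hz), Rmult_assoc, <- (proj2 (hl k) z hz).
  rewrite <- (proj2 (hl h)); [| now apply nN]; f_equal; grp. }
exists lam; split; [| split; auto; intros h; apply hl].
intros h; assert (h1 := proj1 (hl h)).
(* Uniqueness only gives [0 <= lam h]; invertibility excludes 0. *)
assert (h2 : lam h * lam (h^-1) = 1).
{ rewrite <- hm, gmulrV; unfold lam; grp; field; lra. }
destruct h1 as [h1|h1]; auto; rewrite <- h1 in h2; lra.
Qed.

(** The drift is [ln lam]. If [1 < lam a], then in [a · y = (a · y · a^-1) · a], for [y] a power of
    [z], the first factor has [lam a] times the value of [y]; for large powers this outweighs the
    bounded contribution of [a], so [a] moves [y] upwards. *)
Lemma drift_of_multiplier (lam : H -> R) : (forall h, 0 < lam h) ->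
  (forall h x, N x -> tau (h · x · h^-1) = lam h * tau x) ->
  (forall h k, lam (h · k) = lam h * lam k) -> (exists h, lam h <> 1) -> has_drift le.
Proof.
intros lpos lconj lM [h0 hh0].
destruct (dh_pos _ _ _ _ hd) as [z [hz tz]].
assert (large : forall a, 1 < lam a -> exists K : nat, forall k : nat, (K <= k)%nat ->
   ~ le (a · zp z (Z.of_nat k)) (zp z (Z.of_nat k))).
{ intros a ha; destruct (dh_lower a) as [w [hw wa]].
  destruct (INR_unbounded (- tau w / ((lam a - 1) * tau z))) as [K hK]; exists K; intros k hk h.
  set (y := zp z (Z.of_nat k)) in *.
  assert (hy : N y) by now apply zp_sub.
  assert (ty : tau y = INR k * tau z)
    by (unfold y; now rewrite (add_zp hN ht), <- INR_IZR_INZ).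
  assert (h1 : le (a · y · a^-1 · w) y).
  { apply (lpre_trans hle _ _ _ (lpre_left hle (a · y · a^-1) _ _ wa)); now grp; grp in h. }
  apply dh_mono in h1; auto; [| apply (subM hN); auto].
  rewrite ht, lconj, ty in h1; auto.
  assert (h2 : 0 < (lam a - 1) * tau z) by (apply Rmult_lt_0_compat; lra).
  assert (h3 : INR K <= INR k) by now apply le_INR.
  assert (h4 : - tau w / ((lam a - 1) * tau z) * ((lam a - 1) * tau z)
     < INR k * ((lam a - 1) * tau z)) by (apply Rmult_lt_compat_r; lra).
  replace (- tau w / ((lam a - 1) * tau z) * ((lam a - 1) * tau z)) with (- tau w) in h4
    by (field; split; lra).
  lra. }
exists (fun h => ln (lam h)); split; [| split].
- intros x y _ _; rewrite lM; now apply ln_mult.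
- exists h0; split; auto; intros h; apply hh0, ln_inv; auto; [lra | now rewrite ln_1].
- intros A hA.
  assert (hK : exists K : nat, forall k : nat, (K <= k)%nat -> forall a, In a A ->
     ~ le (a · zp z (Z.of_nat k)) (zp z (Z.of_nat k))).
  { induction A as [|a A IH]; [exists 0%nat; intros k _ a [] |].
    destruct IH as [K hK]; [intros; apply hA; now right |].
    destruct (hA a (or_introl eq_refl)) as [_ la].
    destruct (large a) as [K' hK'].
    { apply ln_lt_inv; [lra | auto | now rewrite ln_1]. }
    exists (max K K'); intros k hk b [<-|hb]; [apply hK' | apply hK; auto]; lia. }
  destruct hK as [K hK]; exists (zp z (Z.of_nat K)); intros a ha; now apply (hK K).
Qed.

(** [rho h] is the position of [h] on the line into which [tau] maps [N]. By density it is
    approximated from both sides by elements of [N], and [h · w = (h · w · h^-1) · h] together with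
    invariance makes it additive. *)
Lemma drift_of_dense : invariant N tau ->
  (forall eps, 0 < eps -> exists g, N g /\ 0 < tau g < eps) -> has_drift le.
Proof.
intros hi hdense.
assert (between : forall a b, a < b -> exists w, N w /\ a < tau w < b).
{ intros a b hab; destruct (hdense (b - a)) as [g [hg tg]]; [lra |].
  destruct (archimed (a / tau g)) as [h1 h2]; set (k := up (a / tau g)) in *.
  exists (zp g k); split; [now apply zp_sub | rewrite (add_zp hN ht); auto].
  assert (h3 : a / tau g * tau g = a) by (field; lra).
  assert (h4 : a / tau g * tau g < IZR k * tau g) by (apply Rmult_lt_compat_r; lra).
  assert (h5 : (IZR k - a / tau g) * tau g <= 1 * tau g) by (apply Rmult_le_compat_r; lra).
  lra. }
assert (hrho : exists rho, forall h,
   is_lub (fun r => exists w, N w /\ le w h /\ r = tau w) (rho h)).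
{ apply (choice (fun h r => is_lub (fun r => exists w, N w /\ le w h /\ r = tau w) r)).
  intros h; destruct (dh_upper h) as [v [hv hv']], (dh_lower h) as [w [hw hw']].
  destruct (completeness (fun r => exists w, N w /\ le w h /\ r = tau w)) as [r hr].
  - exists (tau v); intros r [u [hu [h1 ->]]]; apply dh_mono; auto.
    exact (lpre_trans hle _ _ _ h1 hv').
  - now exists (tau w), w.
  - now exists r. }
destruct hrho as [rho hrho].
assert (lb : forall w h, N w -> le w h -> tau w <= rho h).
{ intros w h hw h1; apply (proj1 (hrho h)); now exists w. }
assert (ub : forall w h, N w -> le h w -> rho h <= tau w).
{ intros w h hw h1; apply (proj2 (hrho h)); intros r [u [hu [h2 ->]]].
  apply dh_mono; auto; exact (lpre_trans hle _ _ _ h2 h1). }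
assert (above : forall h r, rho h < r -> exists w, N w /\ le h w /\ tau w < r).
{ intros h r hr; destruct (between _ _ hr) as [w [hw [h1 h2]]]; exists w; repeat split; auto.
  apply (lpre_nle hle); intros h3; apply lb in h3; auto; lra. }
assert (below : forall h r, r < rho h -> exists w, N w /\ le w h /\ r < tau w).
{ intros h r hr; destruct (between _ _ hr) as [w [hw [h1 h2]]]; exists w; repeat split; auto.
  apply (lpre_nle hle); intros h3; apply ub in h3; auto; lra. }
exists rho; split; [| split].
- intros h k _ _; apply Rle_antisym; apply Rnot_lt_le; intros hlt.
  + set (d := rho (h · k) - (rho h + rho k)).
    destruct (above h (rho h + d / 2)) as [v [hv [v1 v2]]]; [unfold d; lra |].
    destruct (above k (rho k + d / 2)) as [w [hw [w1 w2]]]; [unfold d; lra |].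
    assert (h1 : rho (h · k) <= tau (h · w · h^-1 · v)).
    { apply ub; [apply (subM hN); auto |].
      apply (lpre_trans hle _ (h · w)); [now apply (lpre_left hle) |].
      replace (h · w) with (h · w · h^-1 · h) at 1 by grp; now apply (lpre_left hle). }
    rewrite ht, hi in h1; auto; unfold d in *; lra.
  + set (d := (rho h + rho k) - rho (h · k)).
    destruct (below h (rho h - d / 2)) as [v [hv [v1 v2]]]; [unfold d; lra |].
    destruct (below k (rho k - d / 2)) as [w [hw [w1 w2]]]; [unfold d; lra |].
    assert (h1 : tau (h · w · h^-1 · v) <= rho (h · k)).
    { apply lb; [apply (subM hN); auto |].
      apply (lpre_trans hle _ (h · w)); [| now apply (lpre_left hle)].
      replace (h · w) with (h · w · h^-1 · h) at 2 by grp; now apply (lpre_left hle). }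
    rewrite ht, hi in h1; auto; unfold d in *; lra.
- destruct (dh_pos _ _ _ _ hd) as [z [hz tz]]; exists z; split; auto.
  assert (h1 := lb z z hz (lpre_refl hle z)); lra.
- intros A hA; exists gone; intros a ha h; rewrite gmulr1 in h.
  destruct (hA a ha) as [_ ra]; destruct (below a 0 ra) as [w [hw [w1 w2]]].
  apply (dh_pos1 w hw w2); exact (lpre_trans hle _ _ _ w1 h).
Qed.

Lemma discrete_of_not_dense :
  ~ (forall eps, 0 < eps -> exists g, N g /\ 0 < tau g < eps) ->
  exists z, N z /\ 0 < tau z /\ forall g, N g -> exists k, tau g = IZR k * tau z.
Proof.
intros hn.
assert (he : exists eps, 0 < eps /\ forall g, N g -> 0 < tau g -> eps <= tau g).
{ apply NNPP; intros h; apply hn; intros eps he; apply NNPP; intros h1; apply h.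
  exists eps; split; auto; intros g hg tg; apply Rnot_lt_le; intros h2; apply h1.
  now exists g. }
destruct he as [eps [e0 he]].
destruct (dh_pos _ _ _ _ hd) as [z0 [hz0 tz0]].
(* [- m] is the infimum of the positive values of [tau]. *)
destruct (completeness (fun r => exists g, N g /\ 0 < tau g /\ r = - tau g)) as [m [ub lub]].
{ exists (- eps); intros r [g [hg [tg ->]]]; specialize (he g hg tg); lra. }
{ now exists (- tau z0), z0. }
assert (hm : m <= - eps).
{ apply lub; intros r [g [hg [tg ->]]]; specialize (he g hg tg); lra. }
assert (hz : exists z, N z /\ 0 < tau z < - 2 * m).
{ apply NNPP; intros h; assert (h1 : m <= 2 * m); [| lra].
  apply lub; intros r [g [hg [tg ->]]]; apply Rnot_lt_le; intros h1; apply h; exists g.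
  repeat split; auto; lra. }
destruct hz as [z [hz [tz tz2]]].
assert (hmin : forall g, N g -> 0 < tau g -> - m <= tau g).
{ intros g hg tg; assert (- tau g <= m); [apply ub; now exists g | lra]. }
(* For a smaller positive value [tau g], either [tau g] or [tau z - tau g] would be below the
   infimum, since [tau z < - 2 * m]. *)
assert (zmin : forall g, N g -> 0 < tau g -> tau z <= tau g).
{ intros g hg tg; apply Rnot_lt_le; intros h1; assert (h2 := hmin g hg tg).
  assert (h3 : - m <= tau (z · g^-1)); [apply hmin; [subg hN |] |];
  rewrite ht, (addV hN ht) in *; subg hN; lra. }
exists z; repeat split; auto; intros g hg.
destruct (archimed (tau g / tau z)) as [h1 h2]; set (k := up (tau g / tau z)) in *.
exists (k - 1)%Z.
assert (h3 : tau (g · zp z (- (k - 1))) = tau g - IZR (k - 1) * tau z).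
{ rewrite ht, (add_zp hN ht), opp_IZR; subg hN; lra. }
assert (h4 : tau g / tau z * tau z = tau g) by (field; lra).
assert (h5 : tau g / tau z * tau z < IZR k * tau z) by (apply Rmult_lt_compat_r; lra).
assert (h6 : (IZR k - tau g / tau z) * tau z <= 1 * tau z) by (apply Rmult_le_compat_r; lra).
assert (h7 : IZR (k - 1) = IZR k - 1) by now rewrite minus_IZR.
rewrite h7 in *; apply NNPP; intros h8.
assert (h9 := zmin (g · zp z (- (k - 1)))); rewrite h3 in h9.
assert (tau z <= tau g - (IZR k - 1) * tau z); [apply h9; [subg hN | lra] | lra].
Qed.

(** The dense case is settled by [drift_of_dense]. In the discrete case, passing to hulls of orbits
    of the kernel of [tau] and dividing by [tau z] yields a circular action. *)
Lemma invariant_drift : invariant N tau ->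
  (forall le' tau' z, circular H le' N tau' z -> (forall x y, le x y -> le' x y) ->
     has_drift le') -> has_drift le.
Proof.
intros hi hc.
destruct (classic (forall eps, 0 < eps -> exists g, N g /\ 0 < tau g < eps)) as [h|h].
{ now apply drift_of_dense. }
destruct (discrete_of_not_dense h) as [z [hz [tz hint]]].
set (K := fun g => N g /\ tau g = 0).
assert (hK : is_subgroup H K).
{ split; [| split].
  - split; [exact (sub1 hN) | exact (add1 hN ht)].
  - intros x y [hx tx] [hy ty]; split; [subg hN | rewrite ht; auto; lra].
  - intros x [hx tx]; split; [subg hN | rewrite (addV hN ht); auto; lra]. }
assert (nK : is_normal H K).
{ intros k x [hx tx]; split; [now apply nN | now rewrite hi]. }
apply (hull_drift (N := K) hK).
assert (hp : positive_on (hull le K) N tau).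
{ intros g hg tg x [k [[hk tk] h1]].
  apply (dh_positive _ _ _ _ hd (k^-1 · g)) with (x := x).
  - subg hN.
  - rewrite ht, (addV hN ht); subg hN; lra.
  - apply (lpre_cancel hle k); now grp. }
apply (hc _ (fun g => tau g / tau z) z); [| intros x y; exact (hull_le hK x y)].
assert (hp' : forall g, N g -> 0 < tau g / tau z -> 0 < tau g).
{ intros g hg h1; replace (tau g) with (tau g / tau z * tau z) by (field; lra).
  now apply Rmult_lt_0_compat. }
split; auto.
- now apply hull_lpre.
- split; auto.
  + intros x y hx hy; rewrite ht; auto; field; lra.
  + exists z; split; auto; unfold Rdiv; rewrite Rinv_r; lra.
  + intros g hg tg; apply hp; auto.
  + intros g; destruct (dh_dom _ _ _ _ hd g) as [W [hW hc']]; exists W; split; auto.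
    exact (hull_covers hK W g hc').
- intros k x hx; now rewrite hi.
- unfold Rdiv; rewrite Rinv_r; lra.
- intros g hg; destruct (hint g hg) as [k hk]; exists k; rewrite hk; field; lra.
- intros g x [hg tg]; apply (hull_trivial hle); split; auto.
  replace (tau g) with (tau g / tau z * tau z) by (field; lra); rewrite tg; lra.
Qed.
End DominatingHom.

(** * Hölder's theorem *)

Section Holder.
Context {H : Grp} {B : H -> Prop} (hB : is_subgroup H B).

(** Transitivity is restricted to [B], since for comparison at infinity it is obtained only
    there. *)
Record bi_preorder (pr : H -> H -> Prop) : Prop := {
  bp_trans : forall x y z, B x -> B y -> B z -> pr x y -> pr y z -> pr x z;
  bp_total : forall x y, pr x y \/ pr y x;
  bp_left : forall g x y, pr x y -> pr (g · x) (g · y);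
  bp_right : forall g x y, pr x y -> pr (x · g) (y · g) }.

Lemma bi_preorder_flip pr : bi_preorder pr -> bi_preorder (fun x y => pr y x).
Proof.
intros [tr tot l r]; split; auto; intros x y z hx hy hz h1 h2; exact (tr z y x hz hy hx h2 h1).
Qed.

Lemma zp_succr (x : H) k : zp x (Z.succ k) = zp x k · x.
Proof. unfold Z.succ; now rewrite zp_add, zp1. Qed.

Lemma zp_mul (x : H) j k : zp (zp x j) k = zp x (j * k).
Proof.
induction k as [|k IH|k IH] using Z.peano_ind.
- now rewrite Z.mul_0_r.
- rewrite zp_succr, IH, Z.mul_succ_r; now rewrite zp_add.
- rewrite zp_pred, IH, Z.mul_pred_r, <- zp_opp, <- zp_add; f_equal; lia.
Qed.

Lemma zp_gone k : zp (@gone H) k = gone.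
Proof.
induction k as [|k IH|k IH] using Z.peano_ind; auto.
- now rewrite zp_succ, IH, gmul1.
- rewrite zp_pred, IH; grp.
Qed.

Section Sandwich.
Context {pr : H -> H -> Prop} (hp : bi_preorder pr).

Let tr y {x z} := bp_trans pr hp x y z.

Lemma bp_mul x y x' y' : B x -> B y -> B x' -> B y' ->
  pr x y -> pr x' y' -> pr (x · x') (y · y').
Proof.
intros bx bY bx' by' h h'; apply (tr (x · y')); subg hB.
- now apply (bp_left pr hp).
- now apply (bp_right pr hp).
Qed.

Lemma bp_refl x : pr x x.
Proof. now destruct (bp_total pr hp x x). Qed.

Lemma bp_zp x y n : (0 <= n)%Z -> B x -> B y -> pr x y -> pr (zp x n) (zp y n).
Proof.
intros hn bx bY h; revert n hn; apply natlike_ind; [apply bp_refl |].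
intros n hn IH; rewrite !zp_succ; apply bp_mul; auto; subg hB.
Qed.

(** Replacing a factor [g · h] by [h · g] enlarges a product. Among the words with [n] letters [g]
    and [n] letters [h], the two sorted ones are therefore extreme. *)
Lemma bp_sandwich g h n : (0 <= n)%Z -> B g -> B h -> pr (g · h) (h · g) ->
  pr (zp g n · zp h n) (zp (g · h) n) /\ pr (zp (g · h) n) (zp h n · zp g n).
Proof.
intros hn bg bh hc.
assert (c1 : forall n, (0 <= n)%Z -> pr (zp g n · h) (h · zp g n)).
{ clear n hn; apply natlike_ind; [simpl; grp; apply bp_refl |]; intros n hn IH.
  rewrite zp_succ; apply (tr (g · (h · zp g n))); subg hB.
  - rewrite gmulAr; now apply (bp_left pr hp).
  - rewrite !gmulA; now apply (bp_right pr hp). }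
assert (c2 : forall n, (0 <= n)%Z -> pr (g · zp h n) (zp h n · g)).
{ clear n hn; apply natlike_ind; [simpl; grp; apply bp_refl |]; intros n hn IH.
  rewrite zp_succ; apply (tr (h · (g · zp h n))); subg hB.
  - rewrite !gmulA; now apply (bp_right pr hp).
  - rewrite (gmulAr h); now apply (bp_left pr hp). }
revert n hn; apply natlike_ind; [simpl; grp; split; apply bp_refl |].
intros n hn [IH1 IH2]; split.
- rewrite (zp_succ (g · h)); apply (tr (g · h · (zp g n · zp h n))); subg hB.
  + rewrite !zp_succ.
    replace (g · zp g n · (h · zp h n)) with (g · (zp g n · h · zp h n)) by grp.
    replace (g · h · (zp g n · zp h n)) with (g · (h · zp g n · zp h n)) by grp.
    apply (bp_left pr hp), (bp_right pr hp); auto.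
  + now apply (bp_left pr hp).
- rewrite (zp_succ (g · h)); apply (tr (g · h · (zp h n · zp g n))); subg hB.
  + now apply (bp_left pr hp).
  + replace (g · h · (zp h n · zp g n)) with (g · zp h (Z.succ n) · zp g n)
      by (rewrite zp_succ; grp).
    rewrite (zp_succ g), gmulA; apply (bp_right pr hp), c2; lia.
Qed.
End Sandwich.

(** [tau g] measures [g] in units of [s]: it is the supremum of the fractions [k / n] for which the
    [k]-th power of [s] is at most the [n]-th power of [g]. Additivity holds for all powers up to
    one constant, hence exactly. *)
Theorem holder (pr : H -> H -> Prop) (s : H) : bi_preorder pr -> B s -> ~ pr s gone ->
  (forall g, B g -> exists n, pr g (zp s n)) ->
  exists tau, additive_on B tau /\ tau s = 1 /\ forall g, B g -> 0 < tau g -> ~ pr g gone.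
Proof.
intros hp bs hs harch.
assert (s1 : pr gone s) by now destruct (bp_total pr hp gone s).
assert (sle : forall i j, (i <= j)%Z -> pr (zp s i) (zp s j)).
{ intros i j hij; replace j with (i + (j - i))%Z by lia; rewrite zp_add.
  rewrite <- (gmulr1 (zp s i)) at 1; apply (bp_left pr hp).
  assert (h := bp_zp hp gone s (j - i) ltac:(lia) (sub1 hB) bs s1).
  now rewrite zp_gone in h. }
assert (slt : forall i j, pr (zp s i) (zp s j) -> (i <= j)%Z).
{ intros i j h; apply Z.nlt_ge; intros hij; apply hs.
  apply (bp_trans pr hp _ (zp s (i - j))); subg hB.
  - rewrite <- (zp1 s) at 1; apply sle; lia.
  - apply (bp_left pr hp (zp s (- j))) in h; rewrite <- !zp_add in h.
    now replace (- j + i)%Z with (i - j)%Z in h by lia; rewrite Z.add_opp_diag_l in h. }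
set (E g r := exists k n, (0 < n)%Z /\ pr (zp s k) (zp g n) /\ r = IZR k / IZR n).
assert (upper : forall g k n, B g -> (0 < n)%Z -> pr (zp g n) (zp s k) ->
   forall r, E g r -> r <= IZR k / IZR n).
{ intros g k n bg hn h r [k' [n' [hn' [h' ->]]]].
  assert (h1 : pr (zp s (k' * n)) (zp s (k * n'))).
  { apply (bp_trans pr hp _ (zp g (n * n'))); subg hB.
    - rewrite (Z.mul_comm n n'), <- (zp_mul s k' n), <- (zp_mul g n' n).
      apply bp_zp; auto; subg hB; lia.
    - rewrite <- (zp_mul s k n'), <- (zp_mul g n n'); apply bp_zp; auto; subg hB; lia. }
  apply slt, IZR_le in h1; rewrite !mult_IZR in h1; apply IZR_lt in hn, hn'.
  apply (Rmult_le_reg_r (IZR n * IZR n')); [now apply Rmult_lt_0_compat |].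
  replace (IZR k' / IZR n' * (IZR n * IZR n')) with (IZR k' * IZR n) by (field; lra).
  replace (IZR k / IZR n * (IZR n * IZR n')) with (IZR k * IZR n') by (field; lra); auto. }
assert (hlub : exists tau, forall g, B g -> is_lub (E g) (tau g)).
{ apply (choice (fun g r => B g -> is_lub (E g) r)); intros g.
  destruct (classic (B g)) as [bg|bg]; [| now exists 0].
  destruct (harch g bg) as [c hc], (harch (g^-1) (subV hB _ bg)) as [c' hc'].
  destruct (completeness (E g)) as [m hm].
  - exists (IZR c / IZR 1); intros r hr; apply (upper g c 1%Z); [auto | lia | now rewrite zp1 | auto].
  - exists (IZR (- c') / IZR 1), (- c')%Z, 1%Z; repeat split.
    apply (bp_left pr hp g), (bp_right pr hp (zp s (- c'))) in hc'.
    rewrite gmulrV, gmul1, gmulAr, <- zp_add, Z.add_opp_diag_r in hc'.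
    now rewrite zp1; simpl in hc'; rewrite gmulr1 in hc'.
  - now exists m. }
destruct hlub as [tau hlub]; exists tau.
assert (lo : forall g k n, B g -> (0 < n)%Z -> pr (zp s k) (zp g n) -> IZR k <= IZR n * tau g).
{ intros g k n bg hn h; assert (h1 : IZR k / IZR n <= tau g).
  - apply (proj1 (hlub g bg)); now exists k, n.
  - apply IZR_lt in hn; apply (Rmult_le_compat_l (IZR n)) in h1; [| lra].
    now replace (IZR n * (IZR k / IZR n)) with (IZR k) in h1 by (field; lra). }
assert (hi : forall g k n, B g -> (0 < n)%Z -> pr (zp g n) (zp s k) -> IZR n * tau g <= IZR k).
{ intros g k n bg hn h; assert (h1 : tau g <= IZR k / IZR n).
  - apply (proj2 (hlub g bg)); intros r; now apply upper.
  - apply IZR_lt in hn; apply (Rmult_le_compat_l (IZR n)) in h1; [| lra].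
    now replace (IZR n * (IZR k / IZR n)) with (IZR k) in h1 by (field; lra). }
(* [up] lies above its argument by at most 1, so [k - 2] is strictly below [n * tau g] and [k + 1]
   strictly above; strictness lets totality decide both comparisons. *)
assert (floor : forall g n, B g -> (0 < n)%Z -> exists k,
   pr (zp s k) (zp g n) /\ pr (zp g n) (zp s (k + 3))).
{ intros g n bg hn; destruct (archimed (IZR n * tau g)) as [h1 h2].
  set (k := up (IZR n * tau g)) in *; exists (k - 2)%Z; split.
  - destruct (bp_total pr hp (zp s (k - 2)) (zp g n)) as [h|h]; auto.
    apply hi in h; auto; rewrite minus_IZR in h; lra.
  - destruct (bp_total pr hp (zp g n) (zp s (k - 2 + 3))) as [h|h]; auto.
    apply lo in h; auto; rewrite plus_IZR, minus_IZR in h; lra. }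
split; [| split].
- intros g h bg bh.
  assert (bgh : B (g · h)) by subg hB.
  (* Both sorted products of the [n]-th powers lie between the powers [k + l] and [k + l + 6] of
     [s], and by [bp_sandwich] so does the [n]-th power of [g · h]. *)
  assert (est : forall n, (0 < n)%Z ->
     Rabs (IZR n * (tau (g · h) - (tau g + tau h))) <= 6).
  { intros n hn; destruct (floor g n bg hn) as [k [k1 k2]], (floor h n bh hn) as [l [l1 l2]].
    assert (d1 : pr (zp s (k + l)) (zp g n · zp h n))
      by (rewrite zp_add; apply bp_mul; auto; subg hB).
    assert (d2 : pr (zp s (k + l)) (zp h n · zp g n))
      by (rewrite Z.add_comm, zp_add; apply bp_mul; auto; subg hB).
    assert (u1 : pr (zp g n · zp h n) (zp s (k + l + 6)))
      by (replace (k + l + 6)%Z with (k + 3 + (l + 3))%Z by lia; rewrite zp_add;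
          apply bp_mul; auto; subg hB).
    assert (u2 : pr (zp h n · zp g n) (zp s (k + l + 6)))
      by (replace (k + l + 6)%Z with (l + 3 + (k + 3))%Z by lia; rewrite zp_add;
          apply bp_mul; auto; subg hB).
    assert (hb : pr (zp s (k + l)) (zp (g · h) n) /\ pr (zp (g · h) n) (zp s (k + l + 6))).
    { destruct (bp_total pr hp (g · h) (h · g)) as [hc|hc].
      - destruct (bp_sandwich hp g h n ltac:(lia) bg bh hc) as [s3 s4]; split.
        + apply (bp_trans pr hp _ (zp g n · zp h n)); auto; subg hB.
        + apply (bp_trans pr hp _ (zp h n · zp g n)); auto; subg hB.
      - destruct (bp_sandwich (bi_preorder_flip pr hp) g h n ltac:(lia) bg bh hc) as [s3 s4].
        split.
        + apply (bp_trans pr hp _ (zp h n · zp g n)); auto; subg hB.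
        + apply (bp_trans pr hp _ (zp g n · zp h n)); auto; subg hB. }
    destruct hb as [b1 b2].
    apply lo in b1; auto; apply hi in b2; auto.
    apply lo in k1; auto; apply hi in k2; auto; apply lo in l1; auto; apply hi in l2; auto.
    rewrite !plus_IZR in *; apply Rabs_le; lra. }
  assert (est' : forall n : nat, Rabs (INR n * (tau (g · h) - (tau g + tau h))) <= 6).
  { intros [|n]; [simpl; rewrite Rmult_0_l, Rabs_R0; lra |].
    rewrite INR_IZR_INZ; apply est; lia. }
  apply Rle_antisym; apply Rminus_le, (Rle_of_nat_bound _ 6); intros n; specialize (est' n).
  + assert (h1 := Rle_abs (INR n * (tau (g · h) - (tau g + tau h)))); lra.
  + assert (h1 := Rle_abs (- (INR n * (tau (g · h) - (tau g + tau h)))));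
    rewrite Rabs_Ropp in h1; lra.
- assert (h1 := lo s 1%Z 1%Z bs ltac:(lia) (bp_refl hp _)).
  assert (h2 := hi s 1%Z 1%Z bs ltac:(lia) (bp_refl hp _)); lra.
- intros g bg tg h; assert (h1 := hi g 0%Z 1%Z bg ltac:(lia)); simpl in h1.
  rewrite gmulr1 in h1; specialize (h1 h); lra.
Qed.
End Holder.

(** * Actions on complete chains *)

(** Conditional completeness is included because fixed points are obtained as suprema and infima. *)
Record cspace (H : Grp) : Type := {
  pt :> Type;
  ple : pt -> pt -> Prop;
  ple_refl : forall p, ple p p;
  ple_trans : forall p q r, ple p q -> ple q r -> ple p r;
  ple_anti : forall p q, ple p q -> ple q p -> p = q;
  ple_total : forall p q, ple p q \/ ple q p;
  psup : forall E : pt -> Prop, (exists p, E p) -> (exists b, forall p, E p -> ple p b) ->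
    exists m, (forall p, E p -> ple p m) /\ forall b, (forall p, E p -> ple p b) -> ple m b;
  act : H -> pt -> pt;
  act1 : forall p, act gone p = p;
  actM : forall g h p, act (g · h) p = act g (act h p);
  act_mono : forall g p q, ple p q -> ple (act g p) (act g q) }.

Arguments ple {H c}.
Arguments ple_refl {H c}.
Arguments ple_trans {H c}.
Arguments ple_anti {H c}.
Arguments ple_total {H c}.
Arguments act {H c}.
Arguments act1 {H c}.
Arguments actM {H c}.
Arguments act_mono {H c}.

Definition cofinally_fixed {H : Grp} (O : cspace H) (U : list H) : Prop :=
  forall p : O, exists q, ple p q /\ forall u, In u U -> act u q = q.

(** Elements are added one at a time; by induction, finitely many elements of [B] with cofinal fixed
    points then have cofinal common ones. *)
Definition fixes_jointly {H : Grp} (O : cspace H) (B : H -> Prop) : Prop :=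
  forall U a, (forall u, In u U -> B u) -> B a ->
    cofinally_fixed O U -> cofinally_fixed O [a] -> cofinally_fixed O (a :: U).

Section Space.
Context {H : Grp} (O : cspace H).
Implicit Types p q v w : O.

Lemma actV g p : act (g^-1) (act g p) = p.
Proof. rewrite <- actM, gmulV; apply act1. Qed.

Lemma actVr g p : act g (act (g^-1) p) = p.
Proof. rewrite <- actM, gmulrV; apply act1. Qed.

Lemma act_cancel g p q : ple (act g p) (act g q) -> ple p q.
Proof. intros h; apply (act_mono (g^-1)) in h; now rewrite !actV in h. Qed.

Lemma act_move g p q : ple (act (g^-1) p) q <-> ple p (act g q).
Proof.
split; intros h.
- apply (act_mono g) in h; now rewrite actVr in h.
- apply (act_cancel g); now rewrite actVr.
Qed.

Lemma act_fixV g p : act g p = p -> act (g^-1) p = p.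
Proof. intros h; rewrite <- h at 1; apply actV. Qed.

Lemma ple_not p q : ~ ple p q -> ple q p.
Proof. intros h; now destruct (ple_total p q). Qed.

Lemma pinf (E : O -> Prop) : (exists p, E p) -> (exists b, forall p, E p -> ple b p) ->
  exists m, (forall p, E p -> ple m p) /\ forall b, (forall p, E p -> ple b p) -> ple b m.
Proof.
intros [e he] [b hb].
destruct (psup H O (fun b => forall p, E p -> ple b p)) as [m [h1 h2]].
- now exists b.
- exists e; auto.
- exists m; split; auto.
Qed.

(** The fixed point is the supremum of the points up to [q] that [g] does not move down, as in the
    Knaster-Tarski theorem. *)
Lemma fixed_between g p q : ple p q -> ple p (act g p) -> ple (act g q) q ->
  exists m, act g m = m /\ ple p m /\ ple m q.
Proof.
intros pq hp hq.
destruct (psup H O (fun x => ple x q /\ ple x (act g x))) as [m [h1 h2]].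
- now exists p.
- exists q; now intros x [h _].
- assert (mq : ple m q) by (apply h2; now intros x [h _]).
  assert (mg : ple m (act g m)).
  { apply h2; intros x hx; apply (ple_trans _ (act g x)); [now destruct hx |].
    now apply act_mono, h1. }
  exists m; split; [| split; auto].
  apply ple_anti; auto; apply h1; split; [| now apply act_mono].
  exact (ple_trans _ _ _ (act_mono g _ _ mq) hq).
Qed.

Definition least_fixed (U : list H) p v : Prop :=
  ple p v /\ (forall u, In u U -> act u v = v) /\
  forall q, ple p q -> (forall u, In u U -> act u q = q) -> ple v q.

Lemma least_fixed_exists U p : cofinally_fixed O U -> exists v, least_fixed U p v.
Proof.
intros hU; destruct (hU p) as [q0 hq0].
destruct (pinf (fun q => ple p q /\ forall u, In u U -> act u q = q)) as [v [h1 h2]].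
- now exists q0.
- exists p; now intros q [h _].
- exists v; split; [apply h2; now intros q [h _] |]; split; [| intros q h3 h4; now apply h1].
  intros u hu; apply ple_anti.
  + apply h2; intros q [hq fq]; rewrite <- (fq u hu); now apply act_mono, h1.
  + apply act_move, h2; intros q [hq fq]; rewrite <- (act_fixV u q (fq u hu)).
    now apply act_mono, h1.
Qed.

Lemma least_fixed_unique U p v v' : least_fixed U p v -> least_fixed U p v' -> v = v'.
Proof. intros [h1 [h2 h3]] [k1 [k2 k3]]; apply ple_anti; auto. Qed.

Lemma least_fixed_commute U b p v :
  (forall u q, In u U -> act u (act b q) = act b (act u q)) ->
  least_fixed U p v -> least_fixed U (act b p) (act b v).
Proof.
intros hc [h1 [h2 h3]]; split; [now apply act_mono | split].
- intros u hu; rewrite hc, h2; auto.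
- intros q hq fq; rewrite <- (actVr b q); apply act_mono, h3.
  + apply (act_cancel b); now rewrite actVr.
  + intros u hu; rewrite <- (actV b (act u _)), <- hc, actVr, fq; auto.
Qed.

(* A ping-pong pair: on the interval from [w] to [v], [F] pushes everything below [act G w] and [G]
   pushes everything above it. *)
Lemma crossing f g (u v : O) : act f u = u -> least_fixed [g] u v -> act f v <> v ->
  exists F G w, ple u w /\ ple w v /\
   (forall l, ple w (act (eval_word H F G l) w) /\ ple (act (eval_word H F G l) v) v) /\
   forall l l', ~ ple (act (eval_word H F G (false :: l')) w)
                      (act (eval_word H F G (true :: l)) v).
Proof.
intros fu [uv [fix_v least]] fv.
assert (gv : act g v = v) by (apply fix_v; now left).
(* After replacing [f] by its inverse if necessary, [f] moves [v] down. *)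
assert (hf : exists f', act f' u = u /\ ple (act f' v) v /\ act f' v <> v).
{ destruct (ple_total (act f v) v) as [h|h]; [now exists f |].
  exists (f^-1); split; [now apply act_fixV | split; [now apply act_move |]].
  intros h1; apply fv; rewrite <- h1 at 1; apply actVr. }
clear f fu fv; destruct hf as [f [fu [fv fv']]].
set (it := fun n => zp f (Z.of_nat n)).
assert (itS : forall n p, act (it (S n)) p = act f (act (it n) p)).
{ intros n p; unfold it; now rewrite Nat2Z.inj_succ, zp_succ, actM. }
assert (itu : forall n, ple u (act (it n) v)).
{ induction n as [|n IH]; [unfold it; simpl; now rewrite act1 |].
  rewrite itS, <- fu; now apply act_mono. }
(* [w] is the limit of the descending orbit of [v] under [f]. *)
destruct (pinf (fun p => exists n, p = act (it n) v)) as [w [lbw glbw]].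
{ exists (act (it 0%nat) v); now exists 0%nat. }
{ exists u; now intros p [n ->]. }
assert (wv : ple w v).
{ replace v with (act (it 0%nat) v); [apply lbw; now exists 0%nat |]; apply act1. }
assert (uw : ple u w) by (apply glbw; now intros p [n ->]).
assert (fw : act f w = w).
{ apply ple_anti.
  - apply glbw; intros p [[|n] ->].
    + unfold it; simpl; rewrite act1; exact (ple_trans _ _ _ (act_mono f _ _ wv) fv).
    + rewrite itS; apply act_mono, lbw; now exists n.
  - apply act_move, glbw; intros p [n ->]; apply act_move; rewrite <- itS; apply lbw.
    now exists (S n). }
(* [w] lies strictly below [v], the least fixed point of [g] above [u]. *)
assert (gw : act g w <> w).
{ intros h; assert (h1 : ple v w) by (apply least; auto; now intros x [<-|[]]).
  now apply fv'; rewrite <- (ple_anti _ _ wv h1). }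
assert (hg : exists G, act G v = v /\ ple w (act G w) /\ act G w <> w).
{ destruct (ple_total w (act g w)) as [h|h]; [now exists g |].
  exists (g^-1); split; [now apply act_fixV | split; [apply (act_cancel g); now rewrite actVr |]].
  intros h1; apply gw; rewrite <- h1 at 1; apply actVr. }
clear g least fix_v gv gw; destruct hg as [G [Gv [wG wG']]].
(* The orbit descends to [w], which lies strictly below [act G w], so some power of [f] takes [v]
   below [act G w]. *)
assert (hn : exists n, ~ ple (act G w) (act (it n) v)).
{ apply NNPP; intros h; apply wG', ple_anti; auto; apply glbw; intros p [n ->].
  apply NNPP; intros h1; apply h; now exists n. }
destruct hn as [n hn]; exists (it n), G, w.
assert (fwn : act (it n) w = w).
{ clear hn; induction n as [|n IH]; [apply act1 | now rewrite itS, IH]. }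
assert (fvn : ple (act (it n) v) v).
{ clear hn fwn; induction n as [|n IH]; [unfold it; simpl; rewrite act1; apply ple_refl |].
  rewrite itS; exact (ple_trans _ _ _ (act_mono f _ _ IH) fv). }
assert (words : forall l, ple w (act (eval_word H (it n) G l) w) /\
    ple (act (eval_word H (it n) G l) v) v).
{ induction l as [|[|] l [IH1 IH2]]; cbn [eval_word].
  - rewrite !act1; split; apply ple_refl.
  - rewrite !actM; split; [rewrite <- fwn at 1; now apply act_mono |].
    exact (ple_trans _ _ _ (act_mono _ _ _ IH2) fvn).
  - rewrite !actM; split.
    + exact (ple_trans _ _ _ wG (act_mono _ _ _ IH1)).
    + rewrite <- Gv at 2; now apply act_mono. }
repeat split; auto; try apply words.
intros l l' h; apply hn; cbn [eval_word] in h; rewrite !actM in h.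
apply (ple_trans _ (act G (act (eval_word H (it n) G l') w))); [apply act_mono, words |].
apply (ple_trans _ _ _ h), act_mono, words.
Qed.

Lemma fixes_jointly_of_least (B : H -> Prop) :
  (forall f g u v, B f -> B g -> act f u = u -> cofinally_fixed O [g] ->
     least_fixed [g] u v -> act f v = v) ->
  fixes_jointly O B.
Proof.
intros hl U a hU ha cU ca p; destruct (cU p) as [u [pu fu]].
destruct (least_fixed_exists [a] u ca) as [v hv]; pose proof hv as [uv [fv _]].
exists v; split; [exact (ple_trans _ _ _ pu uv) |].
intros x [<-|hx]; [apply fv; now left | apply (hl x a u); auto].
Qed.

(* For commuting U and V = m U m^-1 the least fixed point operators commute, so that if the least
   fixed point of [a] lies below that of [m a m^-1], then [a] fixes the latter as well. *)
Lemma fixes_jointly_of_displacement (B : H -> Prop) :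
  (forall T, (forall t, In t T -> B t /\ cofinally_fixed O [t]) -> exists m, forall t t' p,
     In t T -> In t' T ->
     act t (act (m · t' · m^-1) p) = act (m · t' · m^-1) (act t p)) ->
  fixes_jointly O B.
Proof.
intros hdis U a hU ha cU ca p.
destruct (hdis (a :: U)) as [m hm].
{ intros t [<-|ht]; [now split |]; split; auto; intros q; destruct (cU q) as [r [h1 h2]].
  exists r; split; auto; now intros u [<-|[]]; apply h2. }
assert (conj : forall A, cofinally_fixed O A ->
    cofinally_fixed O (map (fun t => m · t · m^-1) A)).
{ intros A cA q; destruct (cA (act (m^-1) q)) as [r [h1 h2]].
  exists (act m r); split; [now apply act_move |].
  intros x hx; apply in_map_iff in hx as [t [<- ht]].
  now rewrite !actM, actV, h2. }
(* One of the two cases below ends with a point translated by [m^-1], so both [p] and [act m p] have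
   to be exceeded. *)
assert (hp : exists p', ple p p' /\ ple (act m p) p').
{ destruct (ple_total p (act m p)); [exists (act m p) | exists p]; auto using ple_refl. }
destruct hp as [p' [pp' mpp']].
destruct (cU p') as [u [hu fu]].
(* [x] is fixed by [U] as well as by its conjugates: [U] fixes [u] and commutes with the conjugates,
   hence preserves their least fixed point above [u]. *)
destruct (least_fixed_exists _ u (conj U cU)) as [x [ux [fx lx]]].
assert (fxU : forall t, In t U -> act t x = x).
{ intros t ht; apply (least_fixed_unique (map (fun t => m · t · m^-1) U) u);
    [| now split].
  rewrite <- (fu t ht) at 1; apply least_fixed_commute; [| now split].
  intros s q hs; apply in_map_iff in hs as [s' [<- hs']]; symmetry; apply hm; simpl; auto. }
set (b := m · a · m^-1).
assert (cb : cofinally_fixed O [b]) by exact (conj [a] ca).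
destruct (least_fixed_exists [a] x ca) as [y hy].
destruct (least_fixed_exists [b] x cb) as [v hv].
pose proof hy as [xy [fy ly]]; pose proof hv as [xv [fv lv]].
assert (fyV : forall t, In t U -> act (m · t · m^-1) y = y).
{ intros t ht; apply (least_fixed_unique [a] x); auto.
  rewrite <- (fx (m · t · m^-1)) at 1; [| now apply (in_map (fun t => m · t · m^-1))].
  apply least_fixed_commute; auto; intros s q [<-|[]]; apply hm; simpl; auto. }
assert (fvU : forall t, In t U -> act t v = v).
{ intros t ht; apply (least_fixed_unique [b] x); auto.
  rewrite <- (fxU t ht) at 1.
  apply least_fixed_commute; auto; intros s q [<-|[]]; symmetry; apply hm; simpl; auto. }
assert (hab : forall q, act a (act b q) = act b (act a q))
  by (intros q; apply hm; simpl; auto).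
(* If [y] is below [v], then [v] is also the least fixed point of [b] above [y], and [a], which
   fixes [y] and commutes with [b], fixes it. Otherwise [y] is fixed by [b] and the conjugates of
   [U], so that [act (m^-1) y] is fixed by [a] and [U]. *)
destruct (ple_total y v) as [yv|vy].
- assert (hyv : least_fixed [b] y v).
  { split; auto; split; auto; intros q yq; apply lv; exact (ple_trans _ _ _ xy yq). }
  exists v; split; [exact (ple_trans _ _ _ (ple_trans _ _ _ pp' hu) (ple_trans _ _ _ ux xv)) |].
  intros t [<-|ht]; auto; apply (least_fixed_unique [b] y); auto.
  rewrite <- (fy a) at 1; [| now left]; apply least_fixed_commute; auto.
  intros s q [<-|[]]; symmetry; apply hab.
- assert (hvy : least_fixed [a] v y).
  { split; auto; split; auto; intros q vq; apply ly; exact (ple_trans _ _ _ xv vq). }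
  assert (byy : act b y = y).
  { apply (least_fixed_unique [a] v); auto.
    rewrite <- (fv b) at 1; [| now left]; apply least_fixed_commute; auto.
    intros s q [<-|[]]; apply hab. }
  exists (act (m^-1) y); split.
  { apply (act_cancel m); rewrite actVr; apply (ple_trans _ _ _ mpp').
    exact (ple_trans _ _ _ hu (ple_trans _ _ _ ux xy)). }
  assert (back : forall t, act (m · t · m^-1) y = y -> act t (act (m^-1) y) = act (m^-1) y).
  { intros t h; rewrite !actM in h; rewrite <- h at 2; now rewrite actV. }
  intros t [<-|ht]; apply back; auto.
Qed.

(** * Comparison at infinity *)

(** The comparison is only required cofinally often. Its failure then says that [h] is strictly
    below [g] at all large points, which is the form that gives drift. *)
Definition eventually_above (g h : H) : Prop :=
  forall p : O, exists q, ple p q /\ ple (act g q) (act h q).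

(** If [g] does not eventually move all points up, a large point that it does not lower is followed
    by one that it does not raise, with a fixed point between them. *)
Lemma above_or_fixed g : eventually_above gone g ->
  cofinally_fixed O [g] \/ exists p, forall q, ple p q -> ~ ple (act g q) q.
Proof.
intros hg; destruct (classic (exists p, forall q, ple p q -> ~ ple (act g q) q)) as [h|h];
  [now right | left].
intros p; destruct (hg p) as [q [pq hq]]; rewrite act1 in hq.
assert (h1 : exists r, ple q r /\ ple (act g r) r).
{ apply NNPP; intros h1; apply h; exists q; intros r qr h2; apply h1; now exists r. }
destruct h1 as [r [qr hr]]; destruct (fixed_between g q r qr hq hr) as [m [fm [qm _]]].
exists m; split; [exact (ple_trans _ _ _ pq qm) | now intros u [<-|[]]].
Qed.

(** If both factors have cofinal fixed points, a common one is used. If only one has them, the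
    product is evaluated where that factor acts at a fixed point, so that the other alone moves the
    point, upwards. *)
Lemma above_mul (B : H -> Prop) a b : fixes_jointly O B -> B a -> B b ->
  eventually_above gone a -> eventually_above gone b -> eventually_above gone (a · b).
Proof.
intros hB ba bb ha hb.
assert (up : forall g p q, ~ ple (act g q) q -> ple p q -> ple p (act g q)).
{ intros g p q h1 h2; exact (ple_trans _ _ _ h2 (ple_not _ _ h1)). }
intros p; destruct (above_or_fixed a ha) as [ca|[pa ea]], (above_or_fixed b hb) as [cb|[pb eb]].
- destruct (hB [b] a) with (p := p) as [q [pq fq]]; auto; [now intros u [<-|[]] |].
  exists q; split; auto; rewrite act1, actM, (fq b), (fq a); simpl; auto; apply ple_refl.
- destruct (ple_total (act b p) (act b pb)) as [h|h].
  + destruct (ca (act b pb)) as [q [pq fq]]; exists (act (b^-1) q).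
    assert (k : ple pb (act (b^-1) q)) by (apply (act_cancel b); now rewrite actVr).
    split; [apply (ple_trans _ pb); [now apply (act_cancel b) | auto] |].
    rewrite act1, actM, actVr, (fq a (or_introl eq_refl)).
    rewrite <- (actVr b q) at 2; apply ple_not; now apply eb.
  + destruct (ca (act b p)) as [q [pq fq]]; exists (act (b^-1) q).
    assert (k : ple p (act (b^-1) q)) by (apply (act_cancel b); now rewrite actVr).
    split; auto; rewrite act1, actM, actVr, (fq a (or_introl eq_refl)).
    rewrite <- (actVr b q) at 2; apply ple_not, eb; apply (ple_trans _ p); auto.
    now apply (act_cancel b).
- destruct (ple_total p pa) as [h|h]; [destruct (cb pa) as [q [pq fq]] |
    destruct (cb p) as [q [pq fq]]]; exists q;
    (split; [eauto using ple_trans |]); rewrite act1, actM, (fq b (or_introl eq_refl));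
    apply ple_not, ea; eauto using ple_trans.
- assert (hm : exists q, ple p q /\ ple pa q /\ ple pb q).
  { destruct (ple_total pa pb), (ple_total p pa), (ple_total p pb);
      [exists pb | exists pb | exists pb | exists p | exists pa | exists pa | exists p
        | exists p]; eauto using ple_refl, ple_trans. }
  destruct hm as [q [h1 [h2 h3]]]; exists q; split; auto.
  rewrite act1, actM; assert (h4 := ple_not _ _ (eb q h3)).
  apply (ple_trans _ _ _ h4), ple_not, ea; exact (ple_trans _ _ _ h2 h4).
Qed.

Lemma above_bi_preorder (B : H -> Prop) : is_subgroup H B -> fixes_jointly O B ->
  bi_preorder (B := B) eventually_above.
Proof.
intros hB hj.
assert (left : forall g x y, eventually_above x y -> eventually_above (g · x) (g · y)).
{ intros g x y h p; destruct (h p) as [q [pq hq]]; exists q; split; auto.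
  rewrite !actM; now apply act_mono. }
assert (right : forall g x y, eventually_above x y -> eventually_above (x · g) (y · g)).
{ intros g x y h p; destruct (h (act g p)) as [q [pq hq]]; exists (act (g^-1) q).
  split; [now apply (act_cancel g); rewrite actVr |]; now rewrite !actM, !actVr. }
split; auto.
- intros x y z bx bY bz hxy hyz.
  assert (h : eventually_above gone (x^-1 · y · (y^-1 · z))).
  { apply (above_mul B); auto; try subg hB.
    - apply (left (x^-1)) in hxy; now rewrite gmulV in hxy.
    - apply (left (y^-1)) in hyz; now rewrite gmulV in hyz. }
  apply (left x) in h; now grp in h.
- intros x y; destruct (classic (eventually_above x y)) as [h|h]; [now left | right].
  apply not_all_ex_not in h as [p h]; intros q.
  assert (hm : exists r, ple p r /\ ple q r)
    by (destruct (ple_total p q); [exists q | exists p]; auto using ple_refl).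
  destruct hm as [r [pr qr]]; exists r; split; auto.
  apply ple_not; intros h1; apply h; now exists r.
Qed.

Lemma not_above_eventually g : ~ eventually_above g gone ->
  exists p, forall q, ple p q -> ~ ple (act g q) q.
Proof.
intros h; apply not_all_ex_not in h as [p h]; exists p; intros q pq h1; apply h.
exists q; now rewrite act1.
Qed.

Lemma fixes_list (B : H -> Prop) U : fixes_jointly O B ->
  (forall u, In u U -> B u /\ cofinally_fixed O [u]) -> cofinally_fixed O U.
Proof.
intros hB; induction U as [|a U IH]; intros hU.
- intros p; exists p; split; [apply ple_refl | now intros u []].
- apply hB; try (apply IH); intros; try apply hU; simpl; auto.
Qed.
End Space.

(** * Completion of the chain of a preorder by cuts *)

Section Cuts.
Context {H : Grp} {le : H -> H -> Prop} (hle : lpre H le).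

(** Excluding the empty and the full set removes the end points, which the whole group would fix. *)
Definition is_cut (D : H -> Prop) : Prop :=
  (forall x y, le x y -> D y -> D x) /\ (exists x, D x) /\ exists x, ~ D x.

Lemma cut_eq (D E : {D | is_cut D}) :
  (forall x, proj1_sig D x <-> proj1_sig E x) -> D = E.
Proof.
destruct D as [D hD], E as [E hE]; simpl; intros h.
assert (D = E) as -> by (extensionality x; now apply propositional_extensionality).
now rewrite (proof_irrelevance _ hD hE).
Qed.

Definition cuts : cspace H.
Proof.
refine {| pt := {D | is_cut D};
  ple := fun D E => forall x, proj1_sig D x -> proj1_sig E x;
  act := fun g D => exist is_cut (fun x => proj1_sig D (g^-1 · x)) _ |}.
- auto.
- auto.
- intros D E h1 h2; apply cut_eq; split; auto.
- intros [D [hD hD']] [E [hE hE']]; simpl.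
  destruct (classic (forall x, D x -> E x)) as [h|h]; [now left | right].
  apply not_all_ex_not in h as [x h]; apply imply_to_and in h as [Dx Ex]; intros y Ey.
  destruct (lpre_total hle x y) as [xy|yx]; [| now apply (hD y x)].
  exfalso; exact (Ex (hE _ _ xy Ey)).
- intros S [D0 h0] [B hB].
  assert (hc : is_cut (fun x => exists D, S D /\ proj1_sig D x)).
  { split; [| split].
    - intros x y xy [D [hD Dy]]; exists D; split; auto.
      exact (proj1 (proj2_sig D) x y xy Dy).
    - destruct (proj1 (proj2 (proj2_sig D0))) as [x hx]; now exists x, D0.
    - destruct (proj2 (proj2 (proj2_sig B))) as [x hx]; exists x; intros [D [hD Dx]].
      exact (hx (hB D hD x Dx)). }
  exists (exist _ _ hc); split; simpl.
  + intros D hD x Dx; now exists D.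
  + intros E hE x [D [hD Dx]]; exact (hE D hD x Dx).
- intros D; apply cut_eq; intros x; simpl; now grp.
- intros g h D; apply cut_eq; intros x; simpl; now grp.
- simpl; auto.
Unshelve.
destruct D as [D [h1 [[x h2] [y h3]]]]; simpl; split; [| split].
+ intros a b ab; apply h1; now apply (lpre_left hle).
+ exists (g · x); now grp.
+ exists (g · y); now grp.
Defined.

Context (nomax : forall x, exists y, ~ le y x).

Lemma principal_cut x : is_cut (fun y => le y x).
Proof.
split; [| split].
- intros a b ab bx; exact (lpre_trans hle _ _ _ ab bx).
- exists x; now apply lpre_refl.
- apply nomax.
Qed.

Definition principal (x : H) : cuts := exist _ _ (principal_cut x).

Lemma principal_act g x : principal (g · x) = act g (principal x).
Proof.
apply cut_eq; intros y; simpl; split; intros h.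
- apply (lpre_cancel hle g); now grp.
- apply (lpre_cancel hle (g^-1)); now grp.
Qed.

Lemma principal_le x y : ple (principal x) (principal y) <-> le x y.
Proof.
simpl; split; intros h; [apply h, (lpre_refl hle) |].
intros z hz; exact (lpre_trans hle _ _ _ hz h).
Qed.

Lemma principal_cofinal (p : cuts) : exists x, ple p (principal x).
Proof.
destruct p as [D [h1 [h2 [y h3]]]]; exists y; intros x Dx; simpl in *.
apply (lpre_nle hle); intros h; exact (h3 (h1 _ _ h Dx)).
Qed.

Lemma principal_dense (p q : cuts) :
  (forall x, ple (principal x) p -> ple (principal x) q) -> ple p q.
Proof.
intros h x px; apply (h x); [| exact (lpre_refl hle x)].
intros y yx; exact (proj1 (proj2_sig p) _ _ yx px).
Qed.

Lemma principal_below (p : cuts) : exists x, ple (principal x) p.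
Proof.
destruct p as [D [h1 [[x h2] h3]]]; exists x; intros y; simpl; intros h; exact (h1 _ _ h h2).
Qed.

Lemma cuts_extensive g : (forall x, le x (g · x)) -> forall p : cuts, ple p (act g p).
Proof.
intros hg p; apply principal_dense; intros x hx.
apply (ple_trans _ (principal (g · x))); [now apply principal_le |].
rewrite principal_act; now apply act_mono.
Qed.

Lemma cuts_trivial g : (forall x, le (g · x) x) -> (forall x, le x (g · x)) ->
  forall p : cuts, act g p = p.
Proof.
intros h1 h2 p; apply ple_anti; [| now apply cuts_extensive].
assert (h : ple p (act (g^-1) p)) by (apply cuts_extensive; intros x; now apply lpre_inv).
apply (act_mono g) in h; now rewrite actVr in h.
Qed.
End Cuts.

(** The powers of a generator that is largest at infinity bound all words, so Hölder's theorem
    yields [tau]. Elements with positive [tau] move all large points upwards, hence finitely many of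
    them move a common one. *)
Lemma drift_at_infinity {H : Grp} {le : H -> H -> Prop} (hle : lpre H le) (T : list H) :
  (exists g, ~ le g gone) -> dominates le (gen_by H T) ->
  fixes_jointly (cuts hle) (gen_by H T) -> exists tau, drifts_on le (gen_by H T) tau.
Proof.
intros hnt hd hj; set (O := cuts hle) in *.
assert (nomax := lpre_nomax hle hnt); set (pr := principal hle nomax : H -> O).
assert (pr_act : forall g x, pr (g · x) = act g (pr x)) by apply principal_act.
assert (pr_le : forall x y, ple (pr x) (pr y) <-> le x y) by apply principal_le.
assert (gT := gen_subgroup H T); assert (bp := above_bi_preorder O _ gT hj).
assert (refl := bp_refl (B := gen_by H T) bp).
set (T' := T ++ map ginv T).
assert (hT' : forall t, In t T' -> gen_by H T t).
{ intros t ht; apply in_app_iff in ht as [ht|ht]; [now apply gen_in |].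
  apply in_map_iff in ht as [s [<- hs]]; now apply gen_inv, gen_in. }
(* If all generators had cofinal fixed points, the group they generate would fix a cut; as this
   group dominates, that cut would bound the whole chain. *)
assert (ht : exists t, In t T /\ ~ cofinally_fixed O [t]).
{ apply NNPP; intros hn.
  destruct (fixes_list O (gen_by H T) T hj) with (p := pr gone) as [q [h1 fq]].
  { intros u hu; split; [now apply gen_in |]; apply NNPP; intros h; apply hn; now exists u. }
  assert (fix_all : forall w, gen_by H T w -> act w q = q).
  { intros w hw; induction hw as [x hx| |x y _ IHx _ IHy|x _ IHx]; auto.
    - apply act1.
    - now rewrite actM, IHy.
    - now apply act_fixV. }
  destruct (principal_cofinal hle nomax q) as [y hy]; destruct (nomax y) as [y' hy'].
  destruct (hd y') as [W [hW hc]]; destruct (hc gone) as [w [hw h2]]; apply hy'.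
  apply pr_le; apply (ple_trans (c := O) _ q); auto.
  apply (ple_trans (c := O) _ (pr (w · gone))).
  - apply pr_le; now rewrite gmulr1 in h2.
  - rewrite pr_act, <- (fix_all w (hW w hw)); now apply act_mono. }
destruct ht as [t [ht nct]].
assert (hs0 : exists s0, In s0 T' /\ ~ eventually_above O s0 gone).
{ assert (pos : forall s, ~ cofinally_fixed O [s] -> eventually_above O gone s ->
     ~ eventually_above O s gone).
  { intros s ns hs; destruct (above_or_fixed O s hs) as [h|[p hp]]; [easy |].
    intros h; destruct (h p) as [q [pq hq]]; rewrite act1 in hq; exact (hp q pq hq). }
  destruct (bp_total _ bp gone t) as [h|h].
  - exists t; split; [apply in_app_iff; auto | now apply pos].
  - exists (t^-1); split; [apply in_app_iff; right; now apply in_map |].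
    apply pos; [| apply (bp_left _ bp (t^-1)) in h; now grp in h].
    intros h1; apply nct; intros p; destruct (h1 p) as [q [pq fq]]; exists q; split; auto.
    intros u [<-|[]]; rewrite <- (ginvK t) at 1; apply act_fixV, fq; now left. }
destruct hs0 as [s0 [hs0 ps0]].
destruct (list_maximum (eventually_above O) T') as [s [hs smax]].
{ intros x y z hx hy hz; apply (bp_trans _ bp); auto. }
{ exact (bp_total _ bp). }
{ intros E; now rewrite E in hs0. }
assert (gs := hT' s hs).
assert (s1 : ~ eventually_above O s gone).
{ intros h; apply ps0, (bp_trans _ bp _ s); auto; apply gen_one. }
destruct (holder gT (eventually_above O) s bp gs s1) as [tau [ht1 [ts hpos]]].
(* Bounding the inverse at the same time makes the induction go through. *)
{ assert (arch : forall g, gen_by H T g -> exists n,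
    eventually_above O g (zp s n) /\ eventually_above O (g^-1) (zp s n)).
  { intros g hg; induction hg as [x hx| |x y hx [a [a1 a2]] hy [b [b1 b2]]|x hx [a [a1 a2]]].
    - exists 1%Z; rewrite zp1; split; apply smax, in_app_iff; auto.
      right; now apply in_map.
    - exists 0%Z; rewrite ginv1; split; apply refl.
    - exists (a + b)%Z; split; [rewrite zp_add | rewrite Z.add_comm, zp_add, ginvM];
        apply (bp_mul gT bp); auto; subg gT.
    - exists a; now rewrite ginvK. }
  intros g hg; destruct (arch g hg) as [n [h _]]; now exists n. }
exists tau; split; [auto | split; [exists s; split; auto; lra |]].
intros A hA.
assert (hp : exists p : O, forall a, In a A -> forall q, ple p q -> ~ ple (act a q) q).
{ induction A as [|a A IH]; [exists (pr gone); intros a [] |].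
  destruct IH as [p hp]; [intros; apply hA; now right |].
  destruct (hA a (or_introl eq_refl)) as [ga ta].
  destruct (not_above_eventually O a (hpos a ga ta)) as [p' hp'].
  destruct (ple_total p p') as [h|h]; [exists p' | exists p]; intros b [<-|hb] q hq; auto.
  - apply hp; auto; exact (ple_trans _ _ _ h hq).
  - apply hp'; exact (ple_trans _ _ _ h hq). }
destruct hp as [p hp]; destruct (principal_cofinal hle nomax p) as [x hx]; exists x.
intros a ha h; apply (hp a ha _ hx); rewrite <- pr_act; now apply pr_le.
Qed.

(** Failure of freeness in the form that contradicts [crossing]: in [H / N] two positive words with
    different first letters agree. *)
Definition ns_modulo (H : Grp) (N : H -> Prop) : Prop :=
  forall F G, exists l l', N ((eval_word H F G (true :: l))^-1 · eval_word H F G (false :: l')).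

(** * Actions on a circle *)

Section Circle.
Context {H : Grp} {le : H -> H -> Prop} {N : H -> Prop} {tau : H -> R} {z : H}.
Context (hc : circular H le N tau z).

Let hle := ci_pre _ _ _ _ _ hc.
Let hd := ci_dom _ _ _ _ _ hc.
Let hN := dh_sub _ _ _ _ hd.
Let ht := dh_add _ _ _ _ hd.
Let O := cuts hle.

Lemma circle_nontrivial : exists g, ~ le g gone.
Proof.
exists z; apply (dh_pos1 hd); [apply (ci_z _ _ _ _ _ hc) |].
rewrite (ci_z1 _ _ _ _ _ hc); lra.
Qed.

Let nomax := lpre_nomax hle circle_nontrivial.
Let pr := principal hle nomax : H -> O.
Let pr_act : forall g x, pr (g · x) = act g (pr x) := principal_act hle nomax.
Let pr_le : forall x y, ple (pr x) (pr y) <-> le x y := principal_le hle nomax.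
Let zN : N z := ci_z _ _ _ _ _ hc.

Lemma circle_tau_zp n : tau (zp z n) = IZR n.
Proof. rewrite (add_zp hN ht), (ci_z1 _ _ _ _ _ hc); auto; lra. Qed.

Lemma circle_le g : N g -> 0 <= tau g -> forall x, le x (g · x).
Proof.
intros hg [tg|tg] x.
- apply (lpre_nle hle); exact (dh_positive _ _ _ _ hd g hg tg x).
- rewrite <- (ginvK g); apply (proj1 (lpre_inv hle (g^-1) x)), (ci_ker _ _ _ _ _ hc).
  split; [subg hN | rewrite (addV hN ht); auto; lra].
Qed.

Lemma circle_act_le g : N g -> 0 <= tau g -> forall p : O, ple p (act g p).
Proof. intros hg tg; apply (cuts_extensive hle nomax); now apply circle_le. Qed.

Lemma circle_act0 g : N g -> tau g = 0 -> forall p : O, act g p = p.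
Proof.
intros hg tg; apply (cuts_trivial hle nomax); [| apply circle_le; auto; lra].
intros x; now apply (ci_ker _ _ _ _ _ hc).
Qed.

(** Invariance of [tau] puts the commutator of [g] and [n] into the kernel of [tau], which acts
    trivially. *)
Lemma circle_commute g n : N n -> forall p : O, act g (act n p) = act n (act g p).
Proof.
intros hn p; assert (nn := dh_normal _ _ _ _ hd g n hn).
assert (h : act (n^-1 · (g · n · g^-1)) (act g p) = act g p).
{ apply circle_act0; [subg hN |].
  rewrite ht, (addV hN ht), (ci_inv _ _ _ _ _ hc); subg hN; lra. }
rewrite <- h, <- !actM; f_equal; grp.
Qed.

Lemma circle_cofinal x y : exists n, (0 <= n)%Z /\ le y (zp z n · x).
Proof.
destruct (dh_dom _ _ _ _ hd (y · x^-1)) as [W [hW hcov]]; destruct (hcov x) as [w [hw h]].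
apply hW in hw; destruct (ci_int _ _ _ _ _ hc w hw) as [k hk].
exists (Z.max 0 k); split; [lia |].
replace y with (y · x^-1 · x) by grp; apply (lpre_trans hle _ _ _ h).
apply (lpre_cancel hle (w^-1)); rewrite gmulKV, gmulA.
apply circle_le; [subg hN |].
rewrite ht, (addV hN ht), circle_tau_zp, hk; subg hN.
assert (IZR k <= IZR (Z.max 0 k)) by (apply IZR_le; lia); lra.
Qed.

(** Otherwise no power of [z] would take a point below [p] beyond [p], although the powers of [z]
    are cofinal. *)
Lemma circle_strict (p : O) : ~ ple (act z p) p.
Proof.
intros h; destruct (principal_below hle nomax p) as [x hx].
destruct (principal_cofinal hle nomax p) as [y hy]; destruct (nomax y) as [y' hy'].
destruct (circle_cofinal x y') as [n [hn h1]]; apply hy', pr_le.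
apply (ple_trans (c := O) _ p); auto.
apply (ple_trans (c := O) _ (act (zp z n) (pr x))).
{ rewrite <- pr_act; now apply pr_le. }
apply (ple_trans (c := O) _ (act (zp z n) p)); [now apply act_mono |].
clear h1; revert n hn; apply natlike_ind; [simpl zp; rewrite act1; apply (ple_refl (c := O)) |].
intros n hn IH; rewrite zp_succ, actM; apply (ple_trans (c := O) _ (act z p)); auto.
now apply act_mono.
Qed.

(** [rho] is the translation number in units of [z], given by Hölder's theorem. As [g] commutes with
    [z] in its action, a comparison at one point recurs at its translates by powers of [z], so
    positivity holds everywhere and not only at infinity. *)
Lemma circle_rotation (B : H -> Prop) : is_subgroup H B -> (forall g, N g -> B g) ->
  fixes_jointly O B ->
  exists rho, additive_on B rho /\ rho z = 1 /\ positive_on le B rho.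
Proof.
intros hB NB hj; assert (bp := above_bi_preorder O _ hB hj).
destruct (holder hB (eventually_above O) z bp) as [rho [h1 [h2 h3]]]; auto.
- intros h; destruct (h (pr gone)) as [q [_ hq]]; rewrite act1 in hq.
  exact (circle_strict q hq).
- intros g _; destruct (dh_dom _ _ _ _ hd g) as [W [hW hcov]].
  assert (hn : exists n, forall w, In w W -> tau w <= IZR n).
  { clear hcov; induction W as [|w W IH]; [exists 0%Z; intros ? [] |].
    destruct IH as [n hn]; [intros; apply hW; now right |].
    destruct (ci_int _ _ _ _ _ hc w (hW w (or_introl eq_refl))) as [k hk].
    exists (Z.max n k); intros v [<-|hv].
    - rewrite hk; apply IZR_le; lia.
    - apply Rle_trans with (IZR n); auto; apply IZR_le; lia. }
  destruct hn as [n hn]; exists n; intros p; exists p; split; [apply (ple_refl (c := O)) |].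
  assert (h : ple p (act (g^-1 · zp z n) p)).
  { apply (cuts_extensive hle nomax); intros x; destruct (hcov x) as [w [hw h]].
    apply (lpre_cancel hle g); grp; apply (lpre_trans hle _ _ _ h).
    apply (lpre_cancel hle (w^-1)); rewrite gmulKV, gmulA; assert (Nw := hW w hw).
    apply circle_le; [subg hN |].
    rewrite ht, (addV hN ht), circle_tau_zp; subg hN; specialize (hn w hw); lra. }
  apply (act_mono g) in h; now rewrite <- actM, gmulVK in h.
- exists rho; split; auto; split; auto; intros g hg tg x hx; apply (h3 g hg tg).
  intros p; destruct (principal_cofinal hle nomax p) as [y hy].
  destruct (circle_cofinal x y) as [n [hn h]].
  exists (act (zp z n) (pr x)); split.
  + apply (ple_trans (c := O) _ _ _ hy); rewrite <- pr_act.
    now apply pr_le.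
  + rewrite act1, circle_commute; [| subg hN]; apply act_mono.
    rewrite <- pr_act; now apply pr_le.
Qed.

(** Crossing elements give words [W1] and [W2] that differ by an element [mu] of [N]. If [tau mu] is
    0, the words act equally, against the separation. Otherwise [mu] moves [w] by at least a full
    turn, although both words map the interval from [w] to [v] into itself. *)
Lemma circle_ns_fixes : ns_modulo H N -> fixes_jointly O (fun _ => True).
Proof.
intros hns; apply fixes_jointly_of_least; intros f g u v _ _ fu _ hv.
apply NNPP; intros fv.
destruct (crossing O f g u v fu hv fv) as [F [G [w [uw [wv [words sep]]]]]].
(* A full turn inside the interval would make [act (z^-1) v] a smaller fixed point of [g] above
   [u]. *)
assert (zw : ~ ple (act z w) v).
{ intros h; apply (circle_strict v), (act_cancel O (z^-1)); rewrite actV.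
  destruct hv as [uv [gv lv]]; apply lv.
  - apply (act_cancel O z); rewrite actVr; apply (ple_trans (c := O) _ (act z w)); auto.
    now apply act_mono.
  - intros x hx; rewrite circle_commute; [now rewrite gv | subg hN]. }
destruct (hns F G) as [l [l' hmu]]; specialize (sep l l').
set (W1 := eval_word H F G (true :: l)) in *; set (W2 := eval_word H F G (false :: l')) in *.
set (mu := W1^-1 · W2) in *.
assert (words1 : ple w (act W1 w) /\ ple (act W1 v) v) by apply words.
assert (words2 : ple w (act W2 w) /\ ple (act W2 v) v) by apply words.
assert (E : act W2 w = act W1 (act mu w)).
{ unfold mu; now rewrite <- actM, gmulVK. }
destruct (ci_int _ _ _ _ _ hc mu hmu) as [k hk].
assert (far : forall m, N m -> 1 <= tau m -> ple (act z w) (act m w)).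
{ intros m hm tm; apply (act_cancel O (z^-1)); rewrite actV, <- actM.
  apply circle_act_le; [subg hN |].
  rewrite ht, (addV hN ht), (ci_z1 _ _ _ _ _ hc); subg hN; lra. }
destruct (Z.lt_trichotomy k 0) as [h|[h|h]].
- apply zw; apply (ple_trans (c := O) _ (act (mu^-1) w)).
  { apply far; [subg hN |]; rewrite (addV hN ht), hk; auto.
    assert (IZR k <= -1) by (apply IZR_le; lia); lra. }
  apply (ple_trans (c := O) _ (act W1 v)); [| apply words1].
  apply (ple_trans (c := O) _ (act W1 w)); [| now apply act_mono].
  replace (act W1 w) with (act (mu^-1) (act W2 w)).
  + now apply act_mono, words2.
  + rewrite E, <- circle_commute, actV; auto; subg hN.
- apply sep; rewrite E, (circle_act0 mu); auto; [now apply act_mono |].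
  now rewrite hk, h.
- apply zw; apply (ple_trans (c := O) _ (act mu w)).
  { apply far; auto; rewrite hk; apply IZR_le; lia. }
  apply (ple_trans (c := O) _ (act W2 v)); [| apply words2].
  apply (ple_trans (c := O) _ (act W2 w)); [| now apply act_mono].
  rewrite E, circle_commute; auto; now apply act_mono.
Qed.

Lemma circle_ns_drift : ns_modulo H N -> has_drift le.
Proof.
intros hns; destruct (circle_rotation (fun _ => True)) as [rho [h1 [h2 h3]]];
  auto using full_subgroup, circle_ns_fixes.
exists rho; split; auto; split; [exists z; split; auto; lra |].
intros A hA; exists gone; intros a ha; apply h3; auto; now apply hA.
Qed.
End Circle.

(** As [N] acts trivially, a relation modulo [N] contradicts the ping-pong pair of [crossing], and
    comparison at infinity applies to all of [H]. *)
Lemma ns_drift {H : Grp} {le : H -> H -> Prop} {N : H -> Prop} :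
  fg H -> lpre H le -> (exists g, ~ le g gone) -> is_subgroup H N -> trivial_on le N ->
  ns_modulo H N -> has_drift le.
Proof.
intros [S hS] hle hnt hN tN hns.
destruct (drift_at_infinity hle S hnt) as [tau [h1 [[x [_ h2]] h3]]].
- intros g; exists [g]; split; [intros; apply hS |]; intros x; exists g.
  split; [now left | apply (lpre_refl hle)].
- apply fixes_jointly_of_least; intros f g u v _ _ fu _ hv; apply NNPP; intros fv.
  destruct (crossing _ f g u v fu hv fv) as [F [G [w [uw [wv [words sep]]]]]].
  destruct (hns F G) as [l [l' hmu]]; apply (sep l l').
  set (W1 := eval_word H F G (true :: l)) in *; set (W2 := eval_word H F G (false :: l')) in *.
  replace (act W2 w) with (act W1 w); [now apply act_mono |].
  replace W2 with (W1 · (W1^-1 · W2)) by grp; rewrite actM; f_equal; symmetry.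
  apply (cuts_trivial hle (lpre_nomax hle hnt)); intros y; [now apply tN |].
  rewrite <- (ginvK (W1^-1 · W2)); apply (lpre_inv hle), tN; now apply (subV hN).
- exists tau; split; [| split].
  + intros a b _ _; apply h1; apply hS.
  + now exists x.
  + intros A hA; apply h3; intros a ha; split; [apply hS | now apply hA].
Qed.

(** * Extensions *)

(** Triviality on [M] is carried along, so that the theorem also serves for [H / M] without forming
    quotient groups. The three hypotheses treat the preorders trivial on [N], those dominated by
    finitely many elements, and the circular ones. *)
Theorem extension_drift (H : Grp) (N M : H -> Prop) :
  fg H -> is_subgroup H N -> is_normal H N -> (forall x, M x -> N x) ->
  (forall le, lpre H le -> (exists g, ~ le g gone) -> trivial_on le N -> has_drift le) ->
  (forall le F T, lpre H le -> (exists g, ~ le g gone) -> trivial_on le M ->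
     dominates le (gen_by H F) -> incl F T -> (forall t, In t T -> N t) ->
     exists tau, drifts_on le (gen_by H T) tau) ->
  (forall le tau z, circular H le N tau z -> trivial_on le M -> has_drift le) ->
  forall le, lpre H le -> (exists g, ~ le g gone) -> trivial_on le M -> has_drift le.
Proof.
intros [S hS] hN nN MN Ha Hb Hc le hle hnt tM.
set (S' := S ++ map ginv S).
destruct (classic (forall s, In s S' -> exists W, (forall w, In w W -> N w) /\ covers le W s))
  as [hdom|hn].
- assert (hF : exists F, (forall f, In f F -> N f) /\ forall s, In s S' -> covers le F s).
  { clearbody S'; clear hS; induction S' as [|s S' IH]; [exists []; split; intros ? [] |].
    destruct IH as [F [h1 h2]]; [intros; apply hdom; now right |].
    destruct (hdom s (or_introl eq_refl)) as [W [hW hc]]; exists (F ++ W); split.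
    - intros f hf; apply in_app_iff in hf as [hf|hf]; auto.
    - intros t [<-|ht] x; [destruct (hc x) as [w [hw h]] | destruct (h2 t ht x) as [w [hw h]]];
        exists w; split; auto; apply in_app_iff; auto. }
  destruct hF as [F [FN hF]].
  assert (hd : dominates le (gen_by H F)).
  { assert (both : forall g, gen_by H S g ->
      (exists W, (forall w, In w W -> gen_by H F w) /\ covers le W g) /\
      (exists W, (forall w, In w W -> gen_by H F w) /\ covers le W (g^-1))).
    { assert (mul : forall g h,
        (exists W, (forall w, In w W -> gen_by H F w) /\ covers le W g) ->
        (exists W, (forall w, In w W -> gen_by H F w) /\ covers le W h) ->
        exists W, (forall w, In w W -> gen_by H F w) /\ covers le W (g · h)).
      { intros g h [V [hV cV]] [W [hW cW]].
        exists (flat_map (fun v => map (fun w => v · w) W) V); split.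
        - intros x hx; apply in_flat_map in hx as [v [hv hx]].
          apply in_map_iff in hx as [w [<- hw]]; apply gen_mul; auto.
        - intros x; destruct (cW x) as [w [hw h1]], (cV (w · x)) as [v [hv h2]].
          exists (v · w); split.
          + apply in_flat_map; exists v; split; auto; now apply (in_map (fun w => v · w)).
          + rewrite !gmulAr; apply (lpre_trans hle _ (g · (w · x))); auto.
            now apply (lpre_left hle). }
      assert (base : forall s, In s S' ->
        exists W, (forall w, In w W -> gen_by H F w) /\ covers le W s).
      { intros s hs; exists F; split; [apply gen_in | now apply hF]. }
      intros g hg; induction hg as [x hx| |x y _ [x1 x2] _ [y1 y2]|x _ [x1 x2]].
      - split; apply base, in_app_iff; auto; right; now apply in_map.
      - rewrite ginv1; split; exists [gone]; (split; [intros w [<-|[]]; apply gen_one |]);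
          intros x; exists gone; (split; [now left | apply (lpre_refl hle)]).
      - rewrite ginvM; auto.
      - rewrite ginvK; auto. }
    intros g; apply (both g), hS. }
  destruct (drift_union hle hN FN hd) as [tau [ht [[g0 [hg0 tg0]] hr]]].
  { intros T hFT hT; now apply (Hb le F T). }
  (* In this limit every element of [N] with positive [tau] moves [gone] upwards. *)
  destruct (limit_exists hle (fun g => N g /\ 0 < tau g)) as [le' [hle' [hl hpos]]].
  { intros A hA; now apply hr. }
  apply (has_drift_limit hle hle' hl).
  assert (hz : exists z, N z /\ 0 < tau z).
  { destruct (Rlt_le_dec 0 (tau g0)); [now exists g0 |].
    exists (g0^-1); split; [subg hN | rewrite (addV hN ht); auto; lra]. }
  assert (hdN : dominates le' N).
  { intros g; destruct (hd g) as [W [hW hc]]; exists W; split.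
    - intros w hw; apply (gen_min H F); auto.
    - exact (limit_covers hle hle' hl W g hc). }
  assert (hp : positive_on le' N tau).
  { apply (positive_of_dominates hle'); auto. }
  assert (hdh : dominating_hom H le' N tau) by now split.
  destruct (dh_multiplier hle' hdh) as [lam [l1 [l2 l3]]].
  destruct (classic (exists h, lam h <> 1)) as [h|h].
  { now apply (drift_of_multiplier hle' hdh lam). }
  apply (invariant_drift hle' hdh).
  + intros g x hx; rewrite l2; auto; replace (lam g) with 1; [lra |].
    apply NNPP; intros h1; apply h; exists g; auto.
  + intros le'' tau' z hcirc hinc; apply (Hc le'' tau' z hcirc).
    intros m x hm; apply hinc; now apply (limit_trivial hle hle' hl M tM).
(* No finite subset of [N] bounds some generator [s], so any finitely many elements [n^-1 · s] raise
   a common point. In a suitable limit [s] then lies above the whole [N]-orbit of [gone], and the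
   chain of hulls is not trivial. *)
- assert (hs : exists s, forall A, (forall a, In a A -> exists n, N n /\ a = n^-1 · s) ->
     realized le A).
  { apply not_all_ex_not in hn as [s hn]; apply imply_to_and in hn as [_ hn]; exists s.
    intros A hA; apply NNPP; intros hr; apply hn.
    assert (hW : exists W, (forall w, In w W -> N w) /\
       forall a, In a A -> exists n, In n W /\ a = n^-1 · s).
    { clear hr; induction A as [|a A IH]; [exists []; split; intros ? [] |].
      destruct IH as [W [h1 h2]]; [intros; apply hA; now right |].
      destruct (hA a (or_introl eq_refl)) as [n [Nn ->]]; exists (n :: W); split.
      - intros w [<-|hw]; auto.
      - intros b [<-|hb]; [exists n; split; auto; now left |].
        destruct (h2 b hb) as [m [hm ->]]; exists m; split; auto; now right. }
    destruct hW as [W [h1 h2]]; exists W; split; auto; intros x; apply NNPP; intros hx.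
    apply hr; exists x; intros a ha h; destruct (h2 a ha) as [n [hn' ->]]; apply hx.
    exists n; split; auto; apply (lpre_cancel hle (n^-1)); now grp; grp in h. }
  destruct hs as [s hs].
  destruct (limit_exists hle _ hs) as [le' [hle' [hl hpos]]].
  apply (has_drift_limit hle hle' hl), (hull_drift hN), Ha.
  + now apply hull_lpre.
  + exists s; intros [n [hn' h]]; apply (hpos (n^-1 · s)); [now exists n |].
    apply (lpre_cancel hle' n); now grp; grp in h.
  + now apply hull_trivial.
Qed.

Definition drifting (L : Grp) : Prop :=
  forall le, lpre L le -> (exists g, ~ le g gone) -> has_drift le.

Definition locally_drifting (H : Grp) (M : H -> Prop) : Prop :=
  forall (L : Grp) (j : L -> H), is_hom L H j -> injective j -> fg L ->
    (forall x, M (j x)) -> drifting L.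

(** The preorder is restricted to the subgroup generated by [T]. The restriction is not trivial,
    because some word in [F] dominates an element above [gone]. *)
Lemma locally_drifting_drifts_on {H : Grp} {N : H -> Prop} {le : H -> H -> Prop} F T :
  locally_drifting H N -> is_subgroup H N -> lpre H le -> (exists g, ~ le g gone) ->
  dominates le (gen_by H F) -> incl F T -> (forall t, In t T -> N t) ->
  exists tau, drifts_on le (gen_by H T) tau.
Proof.
intros hloc hN hle [g hg] hd hi hT.
set (L := subgrp H _ (gen_subgroup H T)).
set (j := subval H _ (gen_subgroup H T) : L -> H).
destruct (hloc L j) with (le := fun x y => le (j x) (j y)) as [tau [ht [[x0 [_ hx0]] hr]]].
- apply subval_hom.
- apply subval_inj.
- apply fg_gen.
- intros x; apply (gen_min H T); auto; apply subvalP.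
- split.
  + intros x y z; apply (lpre_trans hle).
  + intros x y; apply (lpre_total hle).
  + intros a x y; apply (lpre_left hle (j a)).
- destruct (hd g) as [W [hW hc]]; destruct (hc gone) as [w [hw h]].
  exists (exist _ w (gen_incl F T w hi (hW w hw))); intros h1; apply hg.
  rewrite !gmulr1 in h; exact (lpre_trans hle _ _ _ h h1).
- destruct (sub_extend H _ (gen_subgroup H T) tau 0) as [sigma hs].
  assert (hs' : forall x : L, sigma (j x) = tau x) by (intros [x h]; apply hs).
  exists sigma; split; [| split].
  + intros x y hx hy; rewrite (hs x hx), (hs y hy), <- ht by exact Logic.I.
    apply (hs' (gmul (g := L) (exist _ x hx) (exist _ y hy))).
  + exists (j x0); split; [apply subvalP | now rewrite hs'].
  + intros A hA.
    assert (lift : exists A' : list L, map j A' = A).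
    { clear - hA; induction A as [|a A IH]; [now exists [] |].
      destruct IH as [A' <-]; [intros; apply hA; now right |].
      now exists (exist _ a (proj1 (hA a (or_introl eq_refl))) :: A'). }
    destruct lift as [A' <-]; destruct (hr A') as [x hx].
    * intros a ha; split; auto; rewrite <- hs'; now apply hA, in_map.
    * exists (j x); intros a ha; apply in_map_iff in ha as [a' [<- ha]]; now apply (hx a').
Qed.

Lemma trivial_on_one {H : Grp} {le : H -> H -> Prop} :
  lpre H le -> trivial_on le (fun x => x = gone).
Proof. intros hle m x ->; rewrite gmul1; now apply lpre_refl. Qed.

Lemma drifting_ns_extension (H : Grp) (N : H -> Prop) : fg H -> is_subgroup H N ->
  is_normal H N -> ns_modulo H N -> locally_drifting H N -> drifting H.
Proof.
intros hfg hN nN hns hloc le hle hnt.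
apply (extension_drift H N (fun x => x = gone)); auto.
- intros x ->; now apply sub1.
- intros le' hle' hnt' tN; exact (ns_drift hfg hle' hnt' hN tN hns).
- intros le' F T hle' hnt' _; now apply locally_drifting_drifts_on.
- intros le' tau z hc _; exact (circle_ns_drift hc hns).
- now apply trivial_on_one.
Qed.

(** * Extensions whose quotient has commuting conjugates *)

Section CommutingConjugates.
Context {H : Grp} {M D : H -> Prop}.
Context (hfg : fg H) (hM : is_subgroup H M) (nM : is_normal H M).
Context (hD : is_subgroup H D) (nD : is_normal H D) (MD : forall x, M x -> D x).
Context (comm : forall x y, D (x · y · x^-1 · y^-1)).
Context (disp : forall T, (forall t, In t T -> D t) -> exists m, forall t t', In t T -> In t' T ->
  M (t · (m · t' · m^-1) · t^-1 · (m · t' · m^-1)^-1)).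

(** Modulo [D] any two elements commute, so [F · G] and [G · F] are the required words. *)
Lemma commutator_ns_modulo : ns_modulo H D.
Proof.
intros F G; exists [false], [true]; cbn [eval_word].
assert (h := comm (G^-1) (F^-1)); grp in h; now grp.
Qed.

(** [H / D] is abelian, and where [M] acts trivially the displacement hypothesis provides common
    fixed points, so that comparison at infinity applies to finitely generated subgroups of [D]. *)
Lemma drift_commuting_trivial le : lpre H le -> (exists g, ~ le g gone) ->
  trivial_on le M -> has_drift le.
Proof.
apply (extension_drift H D M); auto.
- intros le' hle' hnt' tD; exact (ns_drift hfg hle' hnt' hD tD commutator_ns_modulo).
- intros le' F T hle' hnt' tM hd hi hT; apply (drift_at_infinity hle'); auto.
  + intros g; destruct (hd g) as [W [hW hc]]; exists W; split; auto.
    intros w hw; apply (gen_incl F); auto.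
  + apply fixes_jointly_of_displacement; intros T' hT'.
    destruct (disp T') as [m hm].
    { intros t ht; apply (gen_min H T); auto; now apply hT'. }
    exists m; intros t t' p ht ht'; specialize (hm t t' ht ht').
    set (s := m · t' · m^-1) in *.
    rewrite <- (cuts_trivial hle' (lpre_nomax hle' hnt') (t · s · t^-1 · s^-1))
      with (p := act s (act t p)).
    * rewrite <- !actM; f_equal; grp.
    * intros x; now apply tM.
    * intros x; rewrite <- (ginvK (t · s · t^-1 · s^-1)).
      apply (proj1 (lpre_inv hle' _ _)), tM; now apply (subV hM).
- intros le' tau z hc _; exact (circle_ns_drift hc commutator_ns_modulo).
Qed.

Section Circle.
Context {le : H -> H -> Prop} {tau : H -> R} {z : H} (hc : circular H le M tau z).
Let hle := ci_pre _ _ _ _ _ hc.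
Let hd := ci_dom _ _ _ _ _ hc.
Let ht := dh_add _ _ _ _ hd.
Let O := cuts hle.
Let commute : forall g n, M n -> forall p : O, act g (act n p) = act n (act g p) :=
  circle_commute hc.

(** Otherwise [z^-1] would take the least fixed point of [t] above [r] to a smaller one that is
    still above [r]. *)
Lemma circle_fixed_bound t (r : O) : cofinally_fixed O [t] -> ~ ple (act z r) (act t r).
Proof.
intros ct h; destruct (least_fixed_exists O [t] r ct) as [v [rv [fv lv]]].
assert (tv : act t v = v) by (apply fv; now left).
apply (circle_strict hc v), (act_cancel O (z^-1)); rewrite actV; apply lv.
- apply (act_cancel O z); rewrite actVr; apply (ple_trans (c := O) _ _ _ h).
  rewrite <- tv; now apply act_mono.
- intros u [<-|[]]; rewrite commute; [now rewrite tv |].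
  apply (subV hM), (ci_z _ _ _ _ _ hc).
Qed.

(** The commutator [c] of [t] and [s] lies in [M]. If [tau c] were not 0, then [t] or its inverse
    would move [act s q], for [q] fixed by [t], by at least a full turn, which [circle_fixed_bound]
    excludes. Hence [t] and [s] commute in their action. *)
Lemma circle_commuting_fixes : fixes_jointly O D.
Proof.
apply fixes_jointly_of_displacement; intros T hT.
destruct (disp T) as [m hm]; [intros; now apply hT |].
exists m; intros t t' p htT htT'; specialize (hm t t' htT htT').
set (s := m · t' · m^-1) in *; set (c := t · s · t^-1 · s^-1) in *.
assert (E : forall q : O, act t (act s q) = act c (act s (act t q))).
{ intros q; rewrite <- !actM; f_equal; unfold c; grp. }
rewrite E; apply (circle_act0 hc); auto.
destruct (hT t htT) as [_ ct].
destruct (ct (act (m) p)) as [q [_ fq]]; specialize (fq t (or_introl eq_refl)).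
assert (far : forall x, M x -> 0 < tau x -> forall r : O, ple (act z r) (act x r)).
{ intros x hx tx r; apply (act_cancel O (z^-1)); rewrite actV, <- actM.
  assert (zM := ci_z _ _ _ _ _ hc).
  apply (circle_act_le hc); [subg hM |].
  rewrite ht, (addV hM ht), (ci_z1 _ _ _ _ _ hc); subg hM.
  destruct (ci_int _ _ _ _ _ hc x hx) as [k hk]; rewrite hk in *; apply lt_IZR in tx.
  assert (1 <= IZR k) by (apply IZR_le; lia); lra. }
assert (Eq := E q); rewrite fq in Eq.
destruct (Rtotal_order (tau c) 0) as [h|[h|h]]; auto; exfalso.
- apply (circle_fixed_bound (t^-1) (act s q)).
  + intros r; destruct (ct r) as [r' [h1 h2]]; exists r'; split; auto.
    intros u [<-|[]]; apply act_fixV, h2; now left.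
  + replace (act (t^-1) (act s q)) with (act (c^-1) (act s q)).
    * apply far; [subg hM |]; rewrite (addV hM ht); auto; lra.
    * rewrite <- (actV O t (act s q)) at 1; rewrite Eq.
      rewrite (commute _ c), actV; auto; subg hM.
- apply (circle_fixed_bound t (act s q)); auto; rewrite Eq; now apply far.
Qed.

(** The rotation number [rho] on [D] extends [tau]. It is invariant under [H], since conjugation
    only rescales it and preserves its value at [z]; the quotient [H / D] is abelian. *)
Lemma circle_commuting_drift : has_drift le.
Proof.
destruct (circle_rotation hc D hD MD circle_commuting_fixes) as [rho [h1 [h2 h3]]].
assert (zM := ci_z _ _ _ _ _ hc); assert (tz := ci_z1 _ _ _ _ _ hc).
assert (hpos1 : forall g, D g -> 0 < rho g -> ~ le g gone).
{ intros g hg rg h; apply (h3 g hg rg gone); now rewrite gmulr1. }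
assert (agree : forall x, M x -> rho x = tau x).
{ intros x hx.
  destruct (positive_unique hle M tau rho z) as [_ E]; auto.
  - intros a b ha hb; apply h1; auto.
  - exact (dh_pos1 hd).
  - lra.
  - rewrite (E x hx), h2, tz; lra. }
assert (hdh : dominating_hom H le D rho).
{ split; auto.
  - exists z; split; auto; lra.
  - intros g; destruct (dh_dom _ _ _ _ hd g) as [W [hW hcov]]; exists W; split; auto. }
apply (invariant_drift hle hdh).
- intros h x hx.
  destruct (positive_unique hle D rho (fun x => rho (h · x · h^-1)) z) as [_ E]; auto.
  + intros a b ha hb; rewrite <- h1; [| now apply nD ..]; f_equal; grp.
  + intros g hg rg h0; apply (h3 _ (nD h g hg) rg h); grp.
    apply (lpre_left hle h) in h0; now rewrite gmulr1 in h0.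
  + lra.
  + rewrite E, h2; auto; rewrite (agree (h · z · h^-1)); [| now apply nM].
    rewrite (ci_inv _ _ _ _ _ hc); auto; rewrite tz; lra.
- intros le' tau' z' hc' _; exact (circle_ns_drift hc' commutator_ns_modulo).
Qed.
End Circle.

Lemma drifting_commuting_extension : locally_drifting H M -> drifting H.
Proof.
intros hloc le hle hnt.
apply (extension_drift H M (fun x => x = gone)); auto.
- intros x ->; now apply sub1.
- exact drift_commuting_trivial.
- intros le' F T hle' hnt' _; now apply locally_drifting_drifts_on.
- intros le' tau z hc _; exact (circle_commuting_drift hc).
- now apply trivial_on_one.
Qed.
End CommutingConjugates.

(** * Closure properties of the class *)

(* A homomorphism from [H] to a quotient of a subgroup of [G]. *)
Record correspondence (H G : Grp) (R : H -> G -> Prop) : Prop := {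
  co_total : forall h, exists g, R h g;
  co_one : R gone gone;
  co_mul : forall h g h' g', R h g -> R h' g' -> R (h · h') (g · g');
  co_inv : forall h g, R h g -> R (h^-1) (g^-1) }.

(** Drift passes from the kernel to the whole of any group mapped to a quotient of a subgroup of
    [G]. In this form the property is stable under all operations that generate the class. *)
Definition extendable (G : Grp) : Prop :=
  forall (H : Grp) (R : H -> G -> Prop), correspondence H G R ->
    locally_drifting H (fun h => R h gone) -> locally_drifting H (fun _ => True).

Lemma locally_drifting_comp (L H : Grp) (j : L -> H) (M : H -> Prop) (M' : L -> Prop) :
  is_hom L H j -> injective j -> (forall x, M' x -> M (j x)) ->
  locally_drifting H M -> locally_drifting L M'.
Proof.
intros hj ij hM hloc K i hi ii hK hMi; apply (hloc K (fun x => j (i x))); auto.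
- intros x y; now rewrite hi, hj.
- intros x y E; now apply ii, ij.
Qed.

Lemma co_kernel_subgroup H G R : correspondence H G R -> is_subgroup H (fun h => R h gone).
Proof.
intros [tot r1 rM rV]; split; [auto | split].
- intros x y hx hy; rewrite <- (@gmul1 G gone); auto.
- intros x hx; rewrite <- (@ginv1 G); auto.
Qed.

Lemma co_kernel_normal H G R : correspondence H G R -> is_normal H (fun h => R h gone).
Proof.
intros [tot r1 rM rV] h x hx; destruct (tot h) as [g hg].
assert (E : (g · gone · g^-1 : G) = gone) by grp; rewrite <- E; auto.
Qed.

Lemma extendable_of_fg (G : Grp) :
  (forall (L : Grp) (R : L -> G -> Prop), fg L -> correspondence L G R ->
     locally_drifting L (fun h => R h gone) -> drifting L) -> extendable G.
Proof.
intros hG H R hR hloc L j hj ij hL _; apply (hG L (fun l g => R (j l) g)); auto.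
- destruct hR as [tot r1 rM rV]; split.
  + intros l; apply tot.
  + now rewrite hom1.
  + intros; rewrite hj; auto.
  + intros; rewrite homV; auto.
- now apply (locally_drifting_comp L H j (fun h => R h gone)).
Qed.

Lemma extendable_fg (G : Grp) : extendable G ->
  forall (L : Grp) (R : L -> G -> Prop), fg L -> correspondence L G R ->
     locally_drifting L (fun h => R h gone) -> drifting L.
Proof.
intros hG L R hL hR hloc; apply (hG L R hR hloc L (fun x => x)); auto; now intros x y.
Qed.

Lemma co_eval H G R a b a' b' w : correspondence H G R -> R a a' -> R b b' ->
  R (eval_word H a b w) (eval_word G a' b' w).
Proof.
intros hR ha hb; induction w as [|[] w IH]; cbn [eval_word]; try apply co_mul; auto.
now apply co_one.
Qed.

Lemma eval_word_app (G : Grp) (a b : G) w w' :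
  eval_word G a b (w ++ w') = eval_word G a b w · eval_word G a b w'.
Proof. induction w as [|c w IH]; cbn [eval_word app]; [| rewrite IH]; grp. Qed.

(** Cancel the common prefix. If one word runs out, the rest of the other equals [gone], and
    appending the letter different from its first one gives the relation. *)
Lemma word_relation_heads (G : Grp) (a b : G) w1 w2 : w1 <> w2 ->
  eval_word G a b w1 = eval_word G a b w2 ->
  exists l l', eval_word G a b (true :: l) = eval_word G a b (false :: l').
Proof.
assert (nil : forall w, w <> [] -> eval_word G a b w = gone ->
  exists l l', eval_word G a b (true :: l) = eval_word G a b (false :: l')).
{ intros [|[] w] hw E; [easy | exists (w ++ [false]), [] | exists [], (w ++ [true])].
  - rewrite app_comm_cons, eval_word_app, E; now grp.
  - rewrite app_comm_cons, eval_word_app, E; now grp. }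
revert w2; induction w1 as [|c w1 IH]; intros w2 hne E.
- apply (nil w2); auto; now intros ->; apply hne.
- destruct w2 as [|d w2]; [apply (nil (c :: w1)); auto; easy |].
  destruct c, d; cbn [eval_word] in E.
  + apply (IH w2); [congruence | exact (gmul_cancel_l _ _ _ E)].
  + now exists w1, w2.
  + now exists w2, w1.
  + apply (IH w2); [congruence | exact (gmul_cancel_l _ _ _ E)].
Qed.

Lemma extendable_NS (G : Grp) : NS G -> extendable G.
Proof.
intros hG; apply extendable_of_fg; intros L R hL hR hloc.
apply (drifting_ns_extension L (fun h => R h gone)); auto.
- now apply (co_kernel_subgroup _ G).
- now apply (co_kernel_normal _ G).
- intros x y; destruct (co_total _ _ _ hR x) as [a ha], (co_total _ _ _ hR y) as [b hb].
  assert (hr : exists w1 w2, w1 <> w2 /\ eval_word G a b w1 = eval_word G a b w2).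
  { apply NNPP; intros h; apply hG; exists a, b; intros w1 w2 _ _ E.
    apply NNPP; intros hne; apply h; now exists w1, w2. }
  destruct hr as [w1 [w2 [hne E]]].
  destruct (word_relation_heads G a b w1 w2 hne E) as [l [l' E']]; exists l, l'.
  replace (@gone G) with ((eval_word G a b (true :: l))^-1 · eval_word G a b (false :: l')).
  + apply co_mul; [exact hR | apply co_inv; [exact hR |] |]; now apply co_eval.
  + now rewrite E', gmulV.
Qed.

Lemma extendable_sub (G H : Grp) (f : H -> G) :
  is_hom H G f -> injective f -> extendable G -> extendable H.
Proof.
intros hf jf hG K R [tot r1 rM rV] hloc.
apply (hG K (fun k g => exists x, R k x /\ f x = g)).
- split.
  + intros k; destruct (tot k) as [x hx]; now exists (f x), x.
  + exists gone; split; auto; now apply hom1.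
  + intros k g k' g' [x [hx <-]] [x' [hx' <-]]; exists (x · x'); split; auto.
  + intros k g [x [hx <-]]; exists (x^-1); split; auto; now apply homV.
- apply (locally_drifting_comp K K (fun x => x) (fun h => R h gone)); auto; try now intros x y.
  intros k [x [hx E]]; replace gone with x; auto; apply jf; now rewrite E, hom1.
Qed.

Lemma extendable_quot (G H : Grp) (f : G -> H) :
  is_hom G H f -> surjective f -> extendable G -> extendable H.
Proof.
intros hf sf hG K R [tot r1 rM rV] hloc; apply (hG K (fun k g => R k (f g))).
- split.
  + intros k; destruct (tot k) as [x hx]; destruct (sf x) as [g <-]; now exists g.
  + now rewrite hom1.
  + intros; rewrite hf; auto.
  + intros; rewrite homV; auto.
- now rewrite hom1.
Qed.

(** The kernel of the map to a quotient of a subgroup of [Q] is locally drifting because [N] is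
    extendable; then extendability of [Q] applies. *)
Lemma extendable_ext (N G Q : Grp) (i : N -> G) (p : G -> Q) :
  is_hom N G i -> injective i -> is_hom G Q p -> surjective p ->
  (forall g, p g = gone <-> exists n, i n = g) ->
  extendable N -> extendable Q -> extendable G.
Proof.
intros hi ii hp sp ker hN hQ H R hR hloc; pose proof hR as [tot r1 rM rV].
set (RQ := fun h q => exists g, R h g /\ p g = q).
assert (hRQ : correspondence H Q RQ).
{ split.
  - intros h; destruct (tot h) as [g hg]; now exists (p g), g.
  - exists gone; split; auto; now apply hom1.
  - intros h q h' q' [g [hg <-]] [g' [hg' <-]]; exists (g · g'); split; auto.
  - intros h q [g [hg <-]]; exists (g^-1); split; auto; now apply homV. }
apply (hQ H RQ hRQ).
assert (hK := co_kernel_subgroup _ _ _ hRQ); set (K := subgrp H _ hK).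
set (val := subval H _ hK : K -> H).
assert (hK' : locally_drifting K (fun _ => True)).
{ apply (hN K (fun k n => R (val k) (i n))).
  - split.
    + intros [h hh]; pose proof hh as [g [hg E]]; apply ker in E as [n <-]; now exists n.
    + now rewrite (hom1 i hi).
    + intros; rewrite hi; now apply rM.
    + intros; rewrite (homV i); auto; now apply rV.
  - rewrite (hom1 i hi).
    apply (locally_drifting_comp K H val (fun h => R h gone)); auto.
    + apply subval_hom.
    + apply subval_inj. }
intros L j hj ij hL hLK.
apply (hK' L (fun x => exist _ (j x) (hLK x))); auto.
- intros x y; apply (sig_val_inj H); simpl; apply hj.
- intros x y E; apply ij; exact (f_equal val E).
Qed.

(** The finitely many generators of [L] are related to elements of a single member of the union. *)
Lemma extendable_dunion (G : Grp) (I : Type) (H : I -> Grp) (f : forall i, H i -> G) :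
  (forall i, is_hom (H i) G (f i)) -> (forall i, injective (f i)) ->
  (forall i j, exists k,
     (forall x, exists y, f k y = f i x) /\ (forall x, exists y, f k y = f j x)) ->
  (forall g, exists i x, f i x = g) ->
  (forall i, extendable (H i)) -> extendable G.
Proof.
intros hf jf dir cov hext; apply extendable_of_fg.
intros L R hL hR hloc; pose proof hR as [tot r1 rM rV]; pose proof hL as [S hS].
assert (hk : exists k, forall s, In s S -> exists x, R s (f k x)).
{ clear hS; induction S as [|s S [k hk]].
  - destruct (cov gone) as [k _]; exists k; intros s [].
  - destruct (tot s) as [g hg]; destruct (cov g) as [i [x <-]].
    destruct (dir i k) as [l [h1 h2]]; exists l; intros t [<-|ht].
    + destruct (h1 x) as [y E]; exists y; now rewrite E.
    + destruct (hk t ht) as [x' hx']; destruct (h2 x') as [y E]; exists y; now rewrite E. }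
destruct hk as [k hk].
apply (extendable_fg (H k) (hext k) L (fun l x => R l (f k x))); auto.
- split.
  + intros l; assert (hl := hS l); induction hl as [s hs| |x y _ [a ha] _ [b hb]|x _ [a ha]].
    * now apply hk.
    * exists gone; now rewrite (hom1 (f k)).
    * exists (a · b); rewrite hf; auto.
    * exists (a^-1); rewrite (homV (f k)); auto.
  + now rewrite (hom1 (f k)).
  + intros; rewrite hf; auto.
  + intros; rewrite (homV (f k)); auto.
- now rewrite (hom1 (f k)).
Qed.

(** The identity correspondence has trivial kernel, and a trivial group has no nontrivial
    preorder. *)
Lemma extendable_drifting (G : Grp) : extendable G -> locally_drifting G (fun _ => True).
Proof.
intros hG; apply (hG G eq).
- split; auto.
  + intros h; now exists h.
  + now intros h g h' g' -> ->.
  + now intros h g ->.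
- intros L j hj ij _ h1 le hle [g hg]; exfalso; apply hg.
  replace g with (@gone L); [now apply lpre_refl |].
  apply ij; now rewrite hom1, h1.
Qed.

(** * The derived subgroup *)

Inductive derived {H : Grp} (B : H -> Prop) : H -> Prop :=
| der_comm : forall x y, B x -> B y -> derived B (x · y · x^-1 · y^-1)
| der_one : derived B gone
| der_mul : forall x y, derived B x -> derived B y -> derived B (x · y)
| der_inv : forall x, derived B x -> derived B (x^-1).

Lemma derived_conj {H : Grp} {B : H -> Prop} h x : is_subgroup H B -> B h ->
  derived B x -> derived B (h · x · h^-1).
Proof.
intros hB hh hx; induction hx as [x y hx hy| |x y _ IHx _ IHy|x _ IHx].
- replace (h · (x · y · x^-1 · y^-1) · h^-1) with
    ((h · x · h^-1) · (h · y · h^-1) · (h · x · h^-1)^-1 · (h · y · h^-1)^-1) by grp.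
  apply der_comm; subg hB.
- replace (h · gone · h^-1) with (@gone H) by grp; apply der_one.
- replace (h · (x · y) · h^-1) with ((h · x · h^-1) · (h · y · h^-1)) by grp.
  now apply der_mul.
- replace (h · x^-1 · h^-1) with ((h · x · h^-1)^-1) by grp; now apply der_inv.
Qed.

(** * Piecewise linear homeomorphisms *)

Section PL.
Context {G : Grp} {phi : G -> R -> R}.
Context (hPL : forall g, PLhomeo01 (phi g)).
Context (phiM : forall g h x, 0 <= x <= 1 -> phi (g · h) x = phi g (phi h x)).
Context (phi_inj : forall g h, (forall x, 0 <= x <= 1 -> phi g x = phi h x) -> g = h).

Lemma phi0 g : phi g 0 = 0.
Proof. apply (hPL g). Qed.

Lemma phi_1 g : phi g 1 = 1.
Proof. apply (hPL g). Qed.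

Lemma phi_lt g x y : 0 <= x -> y <= 1 -> x < y -> phi g x < phi g y.
Proof. intros hx hy xy; destruct (hPL g) as [_ [_ [_ h]]]; auto. Qed.

Lemma phi_le g x y : 0 <= x -> y <= 1 -> x <= y -> phi g x <= phi g y.
Proof.
intros hx hy [xy| ->]; [apply Rlt_le, phi_lt; auto | lra].
Qed.

Lemma phi_range g x : 0 <= x <= 1 -> 0 <= phi g x <= 1.
Proof.
intros hx; split.
- rewrite <- (phi0 g); apply phi_le; lra.
- rewrite <- (phi_1 g); apply phi_le; lra.
Qed.

Lemma phi_eq_inv g x y : 0 <= x <= 1 -> 0 <= y <= 1 -> phi g x = phi g y -> x = y.
Proof.
intros hx hy E; destruct (Rtotal_order x y) as [h|[h|h]]; auto;
  apply (phi_lt g) in h; lra.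
Qed.

Lemma phi_one x : 0 <= x <= 1 -> phi gone x = x.
Proof.
intros hx; apply (phi_eq_inv gone); auto using phi_range.
rewrite <- phiM; auto; now rewrite gmul1.
Qed.

Lemma phiV g x : 0 <= x <= 1 -> phi (g^-1) (phi g x) = x.
Proof. intros hx; rewrite <- phiM, gmulV; auto using phi_one. Qed.

Lemma phiVr g x : 0 <= x <= 1 -> phi g (phi (g^-1) x) = x.
Proof. intros hx; rewrite <- phiM, gmulrV; auto using phi_one. Qed.

Lemma phi_fixV g c : 0 <= c <= 1 -> phi g c = c -> phi (g^-1) c = c.
Proof. intros hc E; rewrite <- E at 1; now apply phiV. Qed.

Lemma locate_right c l x : x <= c -> c < 1 ->
  exists l1 u v l2, x :: l ++ [1] = l1 ++ u :: v :: l2 /\ u <= c < v.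
Proof.
revert x; induction l as [|y l IH]; intros x hx hc.
- exists [], x, 1, []; auto.
- destruct (Rlt_le_dec c y) as [h|h].
  + exists [], x, y, (l ++ [1]); auto.
  + destruct (IH y h hc) as [l1 [u [v [l2 [E h']]]]]; exists (x :: l1), u, v, l2.
    simpl in *; split; auto; now rewrite E.
Qed.

Lemma locate_left c l x : x < c -> c <= 1 ->
  exists l1 u v l2, x :: l ++ [1] = l1 ++ u :: v :: l2 /\ u < c <= v.
Proof.
revert x; induction l as [|y l IH]; intros x hx hc.
- exists [], x, 1, []; auto.
- destruct (Rle_lt_dec c y) as [h|h].
  + exists [], x, y, (l ++ [1]); auto.
  + destruct (IH y h hc) as [l1 [u [v [l2 [E h']]]]]; exists (x :: l1), u, v, l2.
    simpl in *; split; auto; now rewrite E.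
Qed.

Lemma sorted_app l1 l2 : strictly_sorted (l1 ++ l2) -> strictly_sorted l2.
Proof.
induction l1 as [|x l1 IH]; auto; simpl.
destruct (l1 ++ l2) as [|y l] eqn:E; [destruct l1, l2; now simpl in * |].
now intros [_ h]; apply IH.
Qed.

Lemma sorted_lower x l v : strictly_sorted (x :: l) -> In v l -> x < v.
Proof.
revert x; induction l as [|y l IH]; intros x hs hv; [easy |].
destruct hs as [h1 h2]; destruct hv as [<-|hv]; auto.
apply Rlt_trans with y; auto.
Qed.

Lemma sorted_upper l x v : strictly_sorted (l ++ [x]) -> In v (l ++ [x]) -> v <= x.
Proof.
induction l as [|y l IH]; intros hs hv.
- destruct hv as [<-|[]]; lra.
- destruct hv as [<-|hv].
  + apply Rlt_le; apply (sorted_lower y (l ++ [x])); auto; apply in_app_iff; simpl; auto.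
  + apply IH; auto; exact (sorted_app [y] _ hs).
Qed.

(* Near a fixed point [c], on the side given by the sign [s], the map [phi g] is a homothety of
   ratio [a].  If [c] is the end point of the interval on that side, every [a > 0] qualifies. *)
Definition germ (c s : R) (g : G) (a : R) : Prop :=
  0 < a /\ exists d, 0 < d /\ forall y, 0 <= y <= d -> 0 <= c + s * y <= 1 ->
    phi g (c + s * y) = c + s * (a * y).

Lemma germ_exists c s g : s = 1 \/ s = -1 -> 0 <= c <= 1 -> phi g c = c ->
  exists a, germ c s g a.
Proof.
intros hs hc fc; destruct (hPL g) as [[l [hl hlin]] _].
assert (inside : forall l1 u v l2, 0 :: l ++ [1] = l1 ++ u :: v :: l2 -> 0 <= u /\ v <= 1).
{ intros l1 u v l2 E; split.
  - destruct l1 as [|x l1]; [injection E; intros; lra |].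
    injection E as <- E; apply Rlt_le, (sorted_lower 0 (l ++ [1])); auto.
    rewrite E; apply in_app_iff; simpl; auto.
  - apply (sorted_upper (0 :: l)); auto; change ((0 :: l) ++ [1]) with (0 :: l ++ [1]).
    rewrite E; apply in_app_iff; simpl; auto. }
destruct hs as [-> | ->].
- destruct (Rlt_le_dec c 1) as [c1|c1].
  + destruct (locate_right c l 0) as [l1 [u [v [l2 [E h]]]]]; [lra | auto |].
    destruct (hlin u v) as [a [b hab]]; [now exists l1, l2 |].
    destruct (inside l1 u v l2 E) as [u0 v1].
    assert (ec := hab c ltac:(lra)); assert (ev := hab v ltac:(lra)).
    assert (hcv := phi_lt g c v ltac:(lra) v1 ltac:(lra)).
    assert (ha : 0 < a).
    { apply Rnot_le_lt; intros ha; assert (a * (v - c) <= 0); [| lra].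
      rewrite <- (Rmult_0_l (v - c)); apply Rmult_le_compat_r; lra. }
    exists a; split; auto; exists (v - c); split; [lra |]; intros y hy _.
    rewrite hab; lra.
  (* At the end point only [y = 0] stays inside the interval, and 1 is an arbitrary ratio. *)
  + exists 1; split; [lra |]; exists 1; split; [lra |]; intros y hy hy'.
    assert (y = 0) by lra; subst y; rewrite Rmult_0_r, Rplus_0_r; lra.
- destruct (Rlt_le_dec 0 c) as [c0|c0].
  + destruct (locate_left c l 0) as [l1 [u [v [l2 [E h]]]]]; [auto | lra |].
    destruct (hlin u v) as [a [b hab]]; [now exists l1, l2 |].
    destruct (inside l1 u v l2 E) as [u0 v1].
    assert (ec := hab c ltac:(lra)); assert (eu := hab u ltac:(lra)).
    assert (huc := phi_lt g u c u0 ltac:(lra) ltac:(lra)).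
    assert (ha : 0 < a).
    { apply Rnot_le_lt; intros ha; assert (a * (c - u) <= 0); [| lra].
      rewrite <- (Rmult_0_l (c - u)); apply Rmult_le_compat_r; lra. }
    exists a; split; auto; exists (c - u); split; [lra |]; intros y hy _.
    rewrite hab; lra.
  + exists 1; split; [lra |]; exists 1; split; [lra |]; intros y hy hy'.
    assert (y = 0) by lra; subst y; rewrite Rmult_0_r, Rplus_0_r; lra.
Qed.

Lemma germ_one c s : germ c s gone 1.
Proof.
split; [lra |]; exists 1; split; [lra |]; intros y _ h; rewrite phi_one; auto; lra.
Qed.

Lemma germ_mul c s g h a b : germ c s g a -> germ c s h b -> germ c s (g · h) (a * b).
Proof.
intros [ha [d [hd hg]]] [hb [e [he hh]]]; split; [now apply Rmult_lt_0_compat |].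
(* [y <= e] keeps the argument in the linear range of [h], and [b * y <= d] keeps its image in that
   of [g]. *)
exists (Rmin e (d / b)); split.
{ apply Rmin_glb_lt; auto; now apply Rdiv_lt_0_compat. }
intros y [y0 hy] hy'.
assert (h1 := Rmin_l e (d / b)); assert (h2 := Rmin_r e (d / b)).
assert (E : phi h (c + s * y) = c + s * (b * y)) by (apply hh; lra).
assert (h3 := phi_range h _ hy'); rewrite E in h3.
rewrite phiM, E, hg; auto; [lra |]; split; [apply Rmult_le_pos; lra |].
replace d with (b * (d / b)) by (field; lra); apply Rmult_le_compat_l; lra.
Qed.

Lemma germ_inv c s g a : s = 1 \/ s = -1 -> 0 <= c <= 1 -> phi g c = c ->
  germ c s g a -> germ c s (g^-1) (/ a).
Proof.
intros hs hc fc [ha [d [hd hg]]]; split; [now apply Rinv_0_lt_compat |].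
(* [r] is the distance from [c] to the end of the unit interval on the side [s]. *)
assert (hr : exists r, 0 <= r /\ forall y, 0 <= y -> (0 <= c + s * y <= 1 <-> y <= r)).
{ destruct hs as [-> | ->]; [exists (1 - c) | exists c]; split; try lra;
    intros y hy; split; lra. }
destruct hr as [r [r0 hr]].
destruct r0 as [r0|r0].
- exists (Rmin (a * d) (a * r)); split.
  { apply Rmin_glb_lt; now apply Rmult_lt_0_compat. }
  intros y [y0 hy] _; set (x := / a * y).
  assert (h1 := Rmin_l (a * d) (a * r)); assert (h2 := Rmin_r (a * d) (a * r)).
  assert (ia := Rinv_0_lt_compat a ha).
  assert (x0 : 0 <= x) by (apply Rmult_le_pos; lra).
  assert (bound : forall q, y <= a * q -> x <= q).
  { intros q hq; unfold x; replace q with (/ a * (a * q)) by (field; lra).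
    apply Rmult_le_compat_l; lra. }
  assert (hx : 0 <= c + s * x <= 1) by (apply hr; auto; apply bound; lra).
  assert (E : phi g (c + s * x) = c + s * y).
  { rewrite hg; auto; [unfold x; field; lra |]; split; auto; apply bound; lra. }
  rewrite <- E; now apply phiV.
- exists 1; split; [lra |]; intros y [y0 hy] hy'; apply hr in hy'; auto.
  assert (y = 0) by lra; subst y; rewrite !Rmult_0_r, Rplus_0_r; now apply phi_fixV.
Qed.

(** * Global fixed points and displacement of supports *)

Context (S : list G).

Definition fixpt (c : R) : Prop := 0 <= c <= 1 /\ forall g, gen_by G S g -> phi g c = c.

Lemma fixpt_of c : 0 <= c <= 1 -> (forall g, gen_by G S g -> c <= phi g c) -> fixpt c.
Proof.
intros hc h; split; auto; intros g hg; apply Rle_antisym; [| now apply h].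
assert (h1 := h (g^-1) (gen_inv _ _ _ hg)); assert (h2 := phi_range (g^-1) c hc).
rewrite <- (phiVr g c) at 2; auto; apply phi_le; lra.
Qed.

Lemma fixpt0 : fixpt 0.
Proof. split; [lra | intros; apply phi0]. Qed.

Lemma fixpt1 : fixpt 1.
Proof. split; [lra | intros; apply phi_1]. Qed.

(** At a global fixed point the one-sided slopes are multiplicative, so a commutator has slope 1 and
    is the identity nearby on that side. *)
Lemma derived_germ c s t : s = 1 \/ s = -1 -> fixpt c -> derived (gen_by G S) t ->
  phi t c = c /\ germ c s t 1.
Proof.
intros hs [hc fc] ht; assert (gS := gen_subgroup G S).
induction ht as [x y hx hy| |x y _ [fx gx] _ [fy gy]|x _ [fx gx]].
- destruct (germ_exists c s x hs hc (fc x hx)) as [a ga].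
  destruct (germ_exists c s y hs hc (fc y hy)) as [b gb].
  split; [apply fc; subg gS |].
  replace 1 with (a * b * / a * / b) by (destruct ga, gb; field; lra).
  repeat apply germ_mul; auto; apply germ_inv; auto.
- split; [now apply phi_one | apply germ_one].
- split; [rewrite phiM, fy; auto | rewrite <- (Rmult_1_l 1); now apply germ_mul].
- split; [now apply phi_fixV | rewrite <- Rinv_1; now apply germ_inv].
Qed.

Context (T : list G) (hT : forall t, In t T -> derived (gen_by G S) t).

Definition moved (x : R) : Prop := 0 <= x <= 1 /\ exists t, In t T /\ phi t x <> x.

(** Each of the finitely many elements of [T] is the identity near [c] on both sides. *)
Lemma fixpt_isolated c : fixpt c -> exists d, 0 < d /\ forall x, moved x -> d <= Rabs (x - c).
Proof.
intros hc.
assert (side : forall s, s = 1 \/ s = -1 -> exists d, 0 < d /\ forall y, 0 <= y <= d ->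
  0 <= c + s * y <= 1 -> forall t, In t T -> phi t (c + s * y) = c + s * y).
{ intros s hs; clear - hT hc hs hPL phiM; induction T as [|t T' IH].
  - exists 1; split; [lra | now intros y _ _ t []].
  - destruct IH as [d [hd h]]; [intros; apply hT; now right |].
    destruct (derived_germ c s t hs hc) as [_ [_ [e [he h']]]]; [apply hT; now left |].
    exists (Rmin d e); split; [now apply Rmin_glb_lt |]; intros y hy hy'.
    assert (h1 := Rmin_l d e); assert (h2 := Rmin_r d e).
    intros u [<-|hu]; [rewrite h'; lra | apply h; auto; lra]. }
destruct (side 1) as [d [hd h]]; auto; destruct (side (-1)) as [e [he h']]; auto.
exists (Rmin d e); split; [now apply Rmin_glb_lt |].
intros x [hx [t [ht hm]]]; apply Rnot_lt_le; intros hlt; apply hm.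
assert (h1 := Rmin_l d e); assert (h2 := Rmin_r d e).
destruct (Rle_lt_dec c x) as [cx|cx].
- rewrite Rabs_right in hlt; [| lra].
  replace x with (c + 1 * (x - c)) by lra; apply h; auto; lra.
- rewrite Rabs_left in hlt; [| lra].
  replace x with (c + (-1) * (c - x)) by lra; apply h'; auto; lra.
Qed.

Definition component (p : R * R) : Prop :=
  fixpt (fst p) /\ fixpt (snd p) /\ fst p < snd p /\
  forall c, fixpt c -> fst p < c < snd p -> False.

Lemma component_exists x : 0 <= x <= 1 -> ~ fixpt x ->
  exists p, component p /\ fst p < x < snd p.
Proof.
intros hx nx.
destruct (completeness (fun c => fixpt c /\ c <= x)) as [a [ua la]].
{ exists x; now intros c [_ h]. }
{ exists 0; split; [apply fixpt0 | lra]. }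
(* The least fixed point above [x] is obtained as [- b'], with [b'] a supremum of negatives. *)
destruct (completeness (fun c => fixpt (- c) /\ x <= - c)) as [b' [ub lb]].
{ exists (- x); intros c [_ h]; lra. }
{ exists (- (1)); rewrite Ropp_involutive; split; [apply fixpt1 | lra]. }
set (b := - b').
assert (ax : a <= x) by (apply la; now intros c [_ h]).
assert (xb : x <= b) by (unfold b; assert (b' <= - x); [apply lb; intros c [_ h] |]; lra).
assert (a0 : 0 <= a) by (apply ua; split; [apply fixpt0 | lra]).
assert (b1 : b <= 1).
{ unfold b; assert (- (1) <= b'); [| lra].
  apply ub; rewrite Ropp_involutive; split; [apply fixpt1 | lra]. }
assert (fa : fixpt a).
{ apply fixpt_of; [lra |]; intros g hg; apply la; intros c [fc cx].
  assert (ca : c <= a) by now apply ua.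
  rewrite <- (proj2 fc g hg); destruct fc as [fc _]; apply phi_le; lra. }
assert (fb : fixpt b).
{ split; [lra |]; intros g hg.
  assert (le_b : forall h, gen_by G S h -> phi h b <= b).
  { intros h hh; unfold b at 2; assert (b' <= - phi h b); [| lra].
    apply lb; intros c [fc cx]; assert (cb : c <= b') by now apply ub.
    assert (phi h b <= phi h (- c)).
    { destruct fc as [fc _]; apply phi_le; unfold b in *; lra. }
    rewrite (proj2 fc h hh) in *; lra. }
  apply Rle_antisym; auto.
  assert (h1 := le_b (g^-1) (gen_inv _ _ _ hg)); assert (hb : 0 <= b <= 1) by lra.
  rewrite <- (phiVr g b) at 1; auto; apply phi_le; auto; now apply phi_range. }
assert (ne : a <> x /\ x <> b) by (split; intros E; apply nx; [rewrite <- E | rewrite E]; auto).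
exists (a, b); simpl; split; [| lra]; split; auto; split; auto; split; [simpl; lra |]; simpl.
intros c fc hc; destruct (Rle_lt_dec c x) as [h|h].
- assert (c <= a) by (apply ua; split; auto); lra.
- assert (- c <= b'); [apply ub; rewrite Ropp_involutive; split; auto; lra | unfold b in *; lra].
Qed.

Lemma component_inv p g x : component p -> gen_by G S g -> fst p < x < snd p ->
  fst p < phi g x < snd p.
Proof.
intros [[ha fa] [[hb fb] _]] hg hx; split.
- rewrite <- (fa g hg) at 1; apply phi_lt; lra.
- rewrite <- (fb g hg); apply phi_lt; lra.
Qed.

(** The supremum of the orbit of [x] is a global fixed point, so it cannot lie inside the
    component. *)
Lemma component_move p x y : component p -> fst p < x < snd p -> y < snd p ->
  exists g, gen_by G S g /\ y < phi g x.
Proof.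
intros hp hx hy; pose proof hp as [[ha fa] [[hb fb] [_ hno]]]; apply NNPP; intros hn.
assert (x01 : 0 <= x <= 1) by lra.
destruct (completeness (fun r => exists g, gen_by G S g /\ r = phi g x)) as [m [um lm]].
{ exists (snd p); intros r [g [hg ->]]; apply Rlt_le; now apply (component_inv p). }
{ exists (phi gone x), gone; split; auto; apply gen_one. }
assert (xm : x <= m).
{ apply um; exists gone; split; [apply gen_one | now rewrite phi_one]. }
assert (my : m <= y).
{ apply lm; intros r [g [hg ->]]; apply Rnot_lt_le; intros h; apply hn; now exists g. }
apply (hno m); [| lra]; apply fixpt_of; [lra |].
intros g hg; apply lm; intros r [h [hh ->]].
assert (hx' := phi_range h x x01).
replace (phi h x) with (phi g (phi (g^-1 · h) x)).
- assert (h1 : phi (g^-1 · h) x <= m).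
  { apply um; exists (g^-1 · h); split; auto; apply gen_mul; auto; now apply gen_inv. }
  apply phi_le; auto; [apply phi_range; auto | lra].
- rewrite <- phiM; auto; f_equal; grp.
Qed.

(** By induction, an element for the other components is corrected for the new one, either by [k]
    before it or by [h^-1] after it. The direction of displacement may vary with the component,
    hence the alternative. *)
Lemma displace_points (cs : list (R * R)) : (forall p, In p cs -> component p) ->
  forall l r A B : R * R -> R,
  (forall p, In p cs -> fst p < l p < snd p /\ fst p < r p < snd p /\
     fst p < A p < snd p /\ fst p < B p < snd p) ->
  exists m, gen_by G S m /\ forall p, In p cs -> B p < phi m (l p) \/ phi m (r p) < A p.
Proof.
induction cs as [|c cs IH]; intros hcs l r A B hb.
{ exists gone; split; [apply gen_one | now intros p []]. }
assert (hc := hcs c (or_introl eq_refl)); destruct (hb c (or_introl eq_refl)) as [lc [rc [Ac Bc]]].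
destruct (component_move c (l c) (r c) hc lc) as [k [hk kc]]; [lra |].
destruct (component_move c (A c) (B c) hc Ac) as [h [hh kh]]; [lra |].
assert (range : forall p x, In p (c :: cs) -> fst p < x < snd p -> 0 <= x <= 1).
{ intros p x hp hx; destruct (hcs p hp) as [[? _] [[? _] _]]; lra. }
(* The bounds in the remaining components are widened so that either correction leaves the
   conclusion valid there. *)
destruct (IH (fun p hp => hcs p (or_intror hp))
  (fun p => Rmin (l p) (phi k (l p))) (fun p => Rmax (r p) (phi k (r p)))
  (fun p => Rmin (A p) (phi h (A p))) (fun p => Rmax (B p) (phi h (B p)))) as [m [hm hmp]].
{ intros p hp; assert (hp' : In p (c :: cs)) by now right.
  destruct (hb p hp') as [h1 [h2 [h3 h4]]]; assert (cp := hcs p hp').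
  assert (k1 := component_inv p k _ cp hk h1); assert (k2 := component_inv p k _ cp hk h2).
  assert (k3 := component_inv p h _ cp hh h3); assert (k4 := component_inv p h _ cp hh h4).
  unfold Rmin, Rmax; repeat destruct Rle_dec; lra. }
(* If [m] sends [r c] beyond [B c], then [m · k] sends [l c] there, because [k] takes [l c] beyond
   [r c]. Otherwise [m] sends [r c] below [phi h (A c)], and [h^-1 · m] sends it below [A c]. *)
destruct (Rlt_le_dec (B c) (phi m (r c))) as [hcase|hcase].
- exists (m · k); split; [now apply gen_mul |]; intros p hp; destruct (hb p hp) as [h1 [h2 _]].
  assert (k1 := component_inv p k _ (hcs p hp) hk h1).
  assert (k2 := component_inv p k _ (hcs p hp) hk h2).
  assert (r1 := range p _ hp h1); assert (r2 := range p _ hp h2).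
  assert (r3 := range p _ hp k1); assert (r4 := range p _ hp k2).
  rewrite !phiM; auto; destruct hp as [<-|hp].
  + left; apply (Rlt_trans _ _ _ hcase), phi_lt; lra.
  + assert (b1 := Rmax_l (B p) (phi h (B p))); assert (b2 := Rmin_l (A p) (phi h (A p))).
    assert (b3 := Rmin_r (l p) (phi k (l p))); assert (b4 := Rmax_r (r p) (phi k (r p))).
    assert (b5 : 0 <= Rmin (l p) (phi k (l p))) by (apply Rmin_glb; lra).
    assert (b6 : Rmax (r p) (phi k (r p)) <= 1) by (apply Rmax_lub; lra).
    destruct (hmp p hp) as [h3|h3]; [left | right].
    * assert (b7 := phi_le m _ _ b5 (proj2 r3) b3); lra.
    * assert (b7 := phi_le m _ _ (proj1 r4) b6 b4); lra.
- exists (h^-1 · m); split; [apply gen_mul; auto; now apply gen_inv |].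
  intros p hp; destruct (hb p hp) as [h1 [h2 [h3 h4]]].
  assert (r1 := range p _ hp h1); assert (r2 := range p _ hp h2).
  assert (r3 := range p _ hp h3); assert (r4 := range p _ hp h4).
  assert (m1 := phi_range m _ r1); assert (m2 := phi_range m _ r2).
  rewrite !phiM; auto.
  assert (down : forall x y, 0 <= x <= 1 -> 0 <= y <= 1 -> x < phi h y -> phi (h^-1) x < y).
  { intros x y hx hy hxy; rewrite <- (phiV h y hy); apply phi_lt; try lra; now apply phi_range. }
  assert (up : forall x y, 0 <= x <= 1 -> 0 <= y <= 1 -> phi h y < x -> y < phi (h^-1) x).
  { intros x y hx hy hxy; rewrite <- (phiV h y hy) at 1; apply phi_lt; try lra;
      now apply phi_range. }
  destruct hp as [<-|hp].
  + right; apply down; auto; lra.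
  + assert (b1 := Rmax_r (B p) (phi h (B p))); assert (b2 := Rmin_r (A p) (phi h (A p))).
    assert (b3 := Rmin_l (l p) (phi k (l p))); assert (b4 := Rmax_l (r p) (phi k (r p))).
    assert (hp' : In p (c :: cs)) by now right.
    assert (k1 := range p _ hp' (component_inv p k _ (hcs p hp') hk h1)).
    assert (k2 := range p _ hp' (component_inv p k _ (hcs p hp') hk h2)).
    assert (b5 : 0 <= Rmin (l p) (phi k (l p))) by (apply Rmin_glb; lra).
    assert (b6 : Rmax (r p) (phi k (r p)) <= 1) by (apply Rmax_lub; lra).
    destruct (hmp p hp) as [h5|h5]; [left; apply up | right; apply down]; auto.
    * assert (b7 := phi_le m _ _ b5 (proj2 r1) b3); lra.
    * assert (b7 := phi_le m _ _ (proj1 r2) b6 b4); lra.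
Qed.

(** Compactness of the unit interval: let [s] be the supremum of the [e] up to which finitely many
    components suffice. If [s] is fixed, no moved point is close to it; otherwise the component
    around [s] is added. So [s] can be passed unless it is 1. *)
Lemma moved_covered : exists cs, (forall p, In p cs -> component p) /\
  forall x, moved x -> exists p, In p cs /\ fst p < x < snd p.
Proof.
set (P := fun e => exists cs, (forall p, In p cs -> component p) /\
  forall x, moved x -> x <= e -> exists p, In p cs /\ fst p < x < snd p).
assert (P0 : P 0).
{ exists []; split; [intros p [] |]; intros x [hx [t [_ ht]]] x0; exfalso; apply ht.
  replace x with 0 by lra; apply phi0. }
destruct (completeness (fun e => e <= 1 /\ P e)) as [s [us ls]].
{ exists 1; now intros e [h _]. }
{ exists 0; split; auto; lra. }
assert (s0 : 0 <= s) by (apply us; split; auto; lra).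
assert (s1 : s <= 1) by (apply ls; now intros e [h _]).
assert (near : forall d, 0 < d -> exists e, P e /\ s - d < e <= s).
{ intros d hd; apply NNPP; intros hn; assert (h : s <= s - d); [| lra].
  apply ls; intros e [e1 Pe]; apply Rnot_lt_le; intros he; apply hn; exists e; split; auto. }
assert (P1 : P 1).
{ destruct (classic (fixpt s)) as [fs|fs].
  - destruct (fixpt_isolated s fs) as [d [hd hiso]].
    destruct (near d hd) as [e [[cs [hcs cov]] he]].
    assert (Ps : P (Rmin 1 (s + d / 2))).
    { exists cs; split; auto; intros x hx hxe; apply cov; auto.
      assert (h1 := Rmin_r 1 (s + d / 2)); apply Rnot_lt_le; intros h2.
      assert (h3 := hiso x hx); revert h3; unfold Rabs; destruct Rcase_abs; lra. }
    revert Ps; unfold Rmin; destruct Rle_dec as [h|h]; auto; intros Ps.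
    assert (s + d / 2 <= s); [apply us; split; auto |]; lra.
  - destruct (component_exists s) as [p [hp hs]]; [lra | auto |].
    destruct (near (s - fst p)) as [e [[cs [hcs cov]] he]]; [lra |].
    assert (h1 : snd p <= 1) by apply hp.
    assert (Ps : P ((s + snd p) / 2)).
    { exists (p :: cs); split.
      - intros q [<-|hq]; auto.
      - intros x hx hxe; destruct (Rle_lt_dec x e) as [h|h].
        + destruct (cov x hx h) as [q [hq h2]]; exists q; split; auto; now right.
        + exists p; split; [now left | lra]. }
    assert ((s + snd p) / 2 <= s); [apply us; split; auto |]; lra. }
destruct P1 as [cs [hcs cov]]; exists cs; split; auto.
intros x hx; apply cov; auto; apply hx.
Qed.

Lemma component_moved_bounds p : component p -> exists AB : R * R,
  fst p < fst AB < snd p /\ fst p < snd AB < snd p /\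
  forall x, moved x -> fst p < x < snd p -> fst AB <= x <= snd AB.
Proof.
intros [fa [fb [ab _]]].
destruct (fixpt_isolated _ fa) as [d [hd ha]], (fixpt_isolated _ fb) as [e [he hb]].
set (mid := (fst p + snd p) / 2).
(* The midpoint keeps both bounds inside the component. *)
exists (Rmin (fst p + d / 2) mid, Rmax (snd p - e / 2) mid); simpl.
unfold Rmin, Rmax, mid; repeat destruct Rle_dec; repeat split; try lra;
  specialize (ha x H); specialize (hb x H); revert ha hb; unfold Rabs;
  repeat destruct Rcase_abs; lra.
Qed.

(** In each component the moved points lie in a compact interval strictly inside, and [m] shifts
    this interval off itself. *)
Lemma displacement : exists m, gen_by G S m /\ forall x, moved x -> ~ moved (phi m x).
Proof.
destruct moved_covered as [cs [hcs cov]].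
assert (hAB : exists AB : R * R -> R * R, forall p, component p ->
  fst p < fst (AB p) < snd p /\ fst p < snd (AB p) < snd p /\
  forall x, moved x -> fst p < x < snd p -> fst (AB p) <= x <= snd (AB p)).
{ apply (choice (fun p (AB : R * R) => component p ->
    fst p < fst AB < snd p /\ fst p < snd AB < snd p /\
    forall x, moved x -> fst p < x < snd p -> fst AB <= x <= snd AB)); intros p.
  destruct (classic (component p)) as [hp|hp]; [| now exists p].
  destruct (component_moved_bounds p hp) as [AB hAB]; now exists AB. }
destruct hAB as [AB hAB].
destruct (displace_points cs hcs (fun p => fst (AB p)) (fun p => snd (AB p))
  (fun p => fst (AB p)) (fun p => snd (AB p))) as [m [hm hmp]].
{ intros p hp; destruct (hAB p (hcs p hp)) as [h1 [h2 _]]; auto. }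
exists m; split; auto; intros x hx hmx; destruct (cov x hx) as [p [hp xp]].
assert (cp := hcs p hp); destruct (hAB p cp) as [h1 [h2 h3]].
assert (xAB := h3 x hx xp).
assert (mAB := h3 _ hmx (component_inv p m x cp hm xp)).
destruct cp as [[a01 _] [[b01 _] _]].
destruct (hmp p hp) as [h|h].
- assert (phi m (fst (AB p)) <= phi m x) by (apply phi_le; lra); lra.
- assert (phi m x <= phi m (snd (AB p))) by (apply phi_le; lra); lra.
Qed.

(** The support of [m · t' · m^-1] is disjoint from that of [t]. *)
Lemma commuting_displacement : exists m, gen_by G S m /\ forall t t', In t T -> In t' T ->
  t · (m · t' · m^-1) = (m · t' · m^-1) · t.
Proof.
destruct displacement as [m [hm hdis]]; exists m; split; auto; intros t t' ht ht'.
set (s := m · t' · m^-1).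
assert (sE : forall x, 0 <= x <= 1 -> phi s x = phi m (phi t' (phi (m^-1) x))).
{ intros x hx; unfold s; rewrite !phiM; auto using phi_range. }
assert (fix_moved : forall x, 0 <= x <= 1 -> phi s x <> x ->
   phi t x = x /\ phi t (phi s x) = phi s x).
{ intros x hx sx; set (y := phi (m^-1) x); assert (hy := phi_range (m^-1) x hx); fold y in hy.
  assert (Ex : phi m y = x) by now apply phiVr.
  assert (ty : phi t' y <> y).
  { intros E; apply sx; rewrite sE; auto; fold y; now rewrite E. }
  assert (still : forall q, moved q -> phi t (phi m q) = phi m q).
  { intros q hq; apply NNPP; intros h; apply (hdis q hq); split; [apply phi_range, hq |].
    now exists t. }
  split; [rewrite <- Ex; apply still; split; auto; now exists t' |].
  rewrite sE; auto; fold y; apply still; split; [now apply phi_range |].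
  exists t'; split; auto; intros E; apply ty, (phi_eq_inv t'); auto using phi_range. }
apply phi_inj; intros x hx; rewrite !phiM; auto.
destruct (Req_dec (phi s x) x) as [h|h].
- rewrite h; destruct (Req_dec (phi s (phi t x)) (phi t x)) as [h'|h']; auto.
  destruct (fix_moved _ (phi_range t x hx) h') as [E _].
  apply phi_eq_inv in E; auto using phi_range; rewrite E in h'; now rewrite E.
- destruct (fix_moved x hx h) as [E1 E2]; now rewrite E1, E2.
Qed.
End PL.

(** [M] is the kernel, and [D] consists of the elements related to the derived subgroup of the group
    generated by a finite set [S] of elements related to the generators of [L]. Displacement of
    supports makes conjugates commute modulo [M]. *)
Lemma extendable_P (G : Grp) : embeds_in_P G -> extendable G.
Proof.
intros [phi [hPL [phiM phi_inj]]]; apply extendable_of_fg.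
intros L R [SL hSL] hR hloc; pose proof hR as [tot r1 rM rV].
assert (hS : exists S : list G, (forall s, In s SL -> exists g, In g S /\ R s g) /\
   forall g, In g S -> exists l, R l g).
{ clear hSL; induction SL as [|s SL [S [h1 h2]]]; [exists []; split; intros ? [] |].
  destruct (tot s) as [g hg]; exists (g :: S); split.
  - intros t [<-|ht]; [exists g; split; auto; now left |].
    destruct (h1 t ht) as [g' [hg' ?]]; exists g'; split; auto; now right.
  - intros g' [<-|hg']; [now exists s | auto]. }
destruct hS as [S [hS1 hS2]]; assert (gS := gen_subgroup G S).
assert (lift : forall l, exists g, gen_by G S g /\ R l g).
{ intros l; assert (hl := hSL l); induction hl as [s hs| |x y _ [a [ga ha]] _ [b [gb hb]]|x _ [a [ga ha]]].
  - destruct (hS1 s hs) as [g [hg ?]]; exists g; split; auto; now apply gen_in.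
  - exists gone; split; auto; apply gen_one.
  - exists (a · b); split; [subg gS | auto].
  - exists (a^-1); split; [subg gS | auto]. }
assert (drop : forall g, gen_by G S g -> exists l, R l g).
{ intros g hg; induction hg as [s hs| |x y _ [a ha] _ [b hb]|x _ [a ha]].
  - auto.
  - now exists gone.
  - exists (a · b); auto.
  - exists (a^-1); auto. }
set (D := fun l => exists g, derived (gen_by G S) g /\ R l g).
apply (drifting_commuting_extension (M := fun l => R l gone) (D := D)).
- now exists SL.
- now apply (co_kernel_subgroup _ G).
- now apply (co_kernel_normal _ G).
- split; [| split].
  + exists gone; split; auto; apply der_one.
  + intros x y [a [da ha]] [b [db hb]]; exists (a · b); split; auto; now apply der_mul.
  + intros x [a [da ha]]; exists (a^-1); split; auto; now apply der_inv.
- intros h x [a [da ha]]; destruct (lift h) as [b [gb hb]].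
  exists (b · a · b^-1); split; auto; now apply derived_conj.
- intros x hx; exists gone; split; auto; apply der_one.
- intros x y; destruct (lift x) as [a [ga ha]], (lift y) as [b [gb hb]].
  exists (a · b · a^-1 · b^-1); split; [now apply der_comm | auto 6].
- intros T hT.
  assert (hsig : exists sigma, forall t, D t -> derived (gen_by G S) (sigma t) /\ R t (sigma t)).
  { apply (choice (fun t g => D t -> derived (gen_by G S) g /\ R t g)); intros t.
    destruct (classic (D t)) as [[g hg]|h]; [now exists g | now exists gone]. }
  destruct hsig as [sigma hsig].
  destruct (commuting_displacement hPL phiM phi_inj S (map sigma T)) as [m [hm hcomm]].
  { intros g hg; apply in_map_iff in hg as [t [<- ht]]; now apply hsig, hT. }
  destruct (drop m hm) as [l hl]; exists l; intros t t' ht ht'.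
  destruct (hsig t (hT t ht)) as [_ rt], (hsig t' (hT t' ht')) as [_ rt'].
  assert (rs : R (l · t' · l^-1) (m · sigma t' · m^-1)) by auto.
  replace (@gone G) with (sigma t · (m · sigma t' · m^-1) · (sigma t)^-1
    · (m · sigma t' · m^-1)^-1); [auto 6 |].
  rewrite (hcomm (sigma t) (sigma t')); try now apply in_map.
  grp.
- exact hloc.
Qed.

Theorem inC_extendable (G : Grp) : inC G -> extendable G.
Proof.
intros hG; induction hG as [G hG|G hG|G H f hf jf _ IH|G H f hf sf _ IH
  |N G Q i p hi ji hp sp ker _ IHN _ IHQ|G I H f hf jf dir cov _ IH].
- now apply extendable_NS.
- now apply extendable_P.
- exact (extendable_sub G H f hf jf IH).
- exact (extendable_quot G H f hf sf IH).
- exact (extendable_ext N G Q i p hi ji hp sp ker IHN IHQ).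
- exact (extendable_dunion G I H f hf jf dir cov IH).
Qed.

(** * From drift to local indicability *)

Fixpoint zspan (l : list R) (x : R) : Prop :=
  match l with
  | [] => x = 0
  | a :: l' => exists (c : Z) y, zspan l' y /\ x = IZR c * a + y
  end.

Lemma zspan0 l : zspan l 0.
Proof.
induction l as [|a l IH]; simpl; auto; exists 0%Z, 0; split; auto; lra.
Qed.

Lemma zspan_add l x y : zspan l x -> zspan l y -> zspan l (x + y).
Proof.
revert x y; induction l as [|a l IH]; simpl; intros x y.
- intros -> ->; lra.
- intros [c [u [hu ->]]] [d [v [hv ->]]]; exists (c + d)%Z, (u + v); split; auto.
  rewrite plus_IZR; lra.
Qed.

Lemma zspan_scale l x k : zspan l x -> zspan l (IZR k * x).
Proof.
revert x; induction l as [|a l IH]; simpl; intros x.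
- intros ->; lra.
- intros [c [u [hu ->]]]; exists (k * c)%Z, (IZR k * u); split; auto.
  rewrite mult_IZR; lra.
Qed.

Lemma zspan_opp l x : zspan l x -> zspan l (- x).
Proof. intros h; replace (- x) with (IZR (-1) * x) by lra; now apply zspan_scale. Qed.

Lemma zspan_in l x : In x l -> zspan l x.
Proof.
induction l as [|a l IH]; [easy |]; intros [<-|hx]; simpl.
- exists 1%Z, 0; split; [apply zspan0 | lra].
- exists 0%Z, x; split; auto; lra.
Qed.

(** Induction on the spanning list. If a nonzero multiple [d] of [b] lies in the span of the others,
    multiplication by [d] maps everything into that span. Otherwise the coefficient of [b] is well
    defined; either it is nonzero at [a], or [a] lies in the smaller span, onto which one
    projects. *)
Lemma zspan_functional l a : zspan l a -> a <> 0 -> exists f : R -> Z,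
  (forall x y, zspan l x -> zspan l y -> f (x + y) = (f x + f y)%Z) /\ f a <> 0%Z.
Proof.
revert a; induction l as [|b l IH]; intros a ha a0; [easy |].
destruct (classic (exists d, d <> 0%Z /\ zspan l (IZR d * b))) as [[d [d0 hd]]|hn].
- assert (down : forall x, zspan (b :: l) x -> zspan l (IZR d * x)).
  { intros x [c [y [hy ->]]].
    replace (IZR d * (IZR c * b + y)) with (IZR c * (IZR d * b) + IZR d * y) by lra.
    apply zspan_add; now apply zspan_scale. }
  destruct (IH (IZR d * a) (down a ha)) as [f [hf fa]].
  { apply Rmult_integral_contrapositive_currified; auto; now apply not_0_IZR. }
  exists (fun x => f (IZR d * x)); split; auto.
  intros x y hx hy; rewrite Rmult_plus_distr_l; auto.
- assert (uniq : forall c y c' y', zspan l y -> zspan l y' ->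
     IZR c * b + y = IZR c' * b + y' -> c = c').
  { intros c y c' y' hy hy' E; apply NNPP; intros hc; apply hn; exists (c - c')%Z.
    split; [lia |]; rewrite minus_IZR.
    replace ((IZR c - IZR c') * b) with (y' + - y) by lra.
    now apply zspan_add, zspan_opp. }
  assert (hk : exists kappa : R -> Z, forall x, zspan (b :: l) x ->
     zspan l (x - IZR (kappa x) * b)).
  { apply (choice (fun x c => zspan (b :: l) x -> zspan l (x - IZR c * b))); intros x.
    destruct (classic (zspan (b :: l) x)) as [[c [y [hy ->]]]|h]; [| now exists 0%Z].
    exists c; intros _; now replace (IZR c * b + y - IZR c * b) with y by lra. }
  destruct hk as [kappa hk].
  assert (kadd : forall x y, zspan (b :: l) x -> zspan (b :: l) y ->
     kappa (x + y) = (kappa x + kappa y)%Z).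
  { intros x y hx hy; assert (hxy := zspan_add _ _ _ hx hy).
    apply (uniq _ (x + y - IZR (kappa (x + y)) * b) _
      ((x - IZR (kappa x) * b) + (y - IZR (kappa y) * b))).
    - now apply hk.
    - apply zspan_add; now apply hk.
    - rewrite plus_IZR; lra. }
  destruct (Z.eq_dec (kappa a) 0) as [k0|k0]; [| now exists kappa].
  assert (ha' := hk a ha); rewrite k0 in ha'.
  replace (a - 0 * b) with a in ha' by lra.
  destruct (IH a ha' a0) as [f [hf fa]].
  exists (fun x => f (x - IZR (kappa x) * b)); split.
  + intros x y hx hy; rewrite <- hf; [| now apply hk ..]; f_equal.
    rewrite kadd, plus_IZR; auto; lra.
  + rewrite k0; now replace (a - 0 * b) with a by lra.
Qed.

Lemma least_nat (P : nat -> Prop) : (exists n, P n) -> exists n, P n /\ forall m, P m -> (n <= m)%nat.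
Proof.
intros [n hn]; revert hn; induction n as [n IH] using lt_wf_ind; intros hn.
destruct (classic (exists m, (m < n)%nat /\ P m)) as [[m [h1 h2]]|h]; [exact (IH m h1 h2) |].
exists n; split; auto; intros m hm; apply Nat.nlt_ge; intros h1; apply h; now exists m.
Qed.

(** The image is generated by its least positive element [d], and dividing by [d] makes the map
    surjective. *)
Lemma surjection_to_Z (L : Grp) (f : L -> Z) :
  (forall x y, f (x · y) = (f x + f y)%Z) -> (exists x, f x <> 0%Z) ->
  exists f' : L -> Z, (forall x y, f' (x · y) = (f' x + f' y)%Z) /\
    forall n, exists x, f' x = n.
Proof.
intros hf [x0 hx0].
assert (f1 : f gone = 0%Z) by (assert (h := hf gone gone); rewrite gmul1 in h; lia).
assert (fV : forall x, f (x^-1) = (- f x)%Z).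
{ intros x; assert (h := hf x (x^-1)); rewrite gmulrV, f1 in h; lia. }
assert (fz : forall x k, f (zp x k) = (k * f x)%Z).
{ intros x k; induction k as [|k IH|k IH] using Z.peano_ind; auto.
  - rewrite zp_succ, hf, IH; lia.
  - rewrite zp_pred, hf, fV, IH; lia. }
destruct (least_nat (fun n => (0 < n)%nat /\ exists x, f x = Z.of_nat n)) as [d [[d0 [x hx]] hd]].
{ exists (Z.to_nat (Z.abs (f x0))); split; [lia |].
  destruct (Z_lt_le_dec (f x0) 0); [exists (x0^-1); rewrite fV | exists x0]; lia. }
assert (hdiv : forall y, (f y mod Z.of_nat d = 0)%Z).
{ intros y; assert (h := Z.mod_pos_bound (f y) (Z.of_nat d) ltac:(lia)).
  apply NNPP; intros hne.
  assert (h1 : (d <= Z.to_nat (f y mod Z.of_nat d))%nat); [| lia].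
  apply hd; split; [lia |]; exists (y · zp x (- (f y / Z.of_nat d))).
  rewrite hf, fz, hx, Z2Nat.id; [| lia].
  rewrite (Z.div_mod (f y) (Z.of_nat d)) at 1; lia. }
assert (hq : forall y, f y = (Z.of_nat d * (f y / Z.of_nat d))%Z).
{ intros y; assert (h := Z.div_mod (f y) (Z.of_nat d) ltac:(lia)); rewrite hdiv in h; lia. }
exists (fun y => (f y / Z.of_nat d)%Z); split.
- intros y z; rewrite hf, (hq y), (hq z), <- Z.mul_add_distr_l.
  rewrite !(Z.mul_comm (Z.of_nat d)), !Z.div_mul; lia.
- intros n; exists (zp x n); rewrite fz, hx; apply Z.div_mul; lia.
Qed.

(** A left order restricts to a nontrivial preorder on each nontrivial finitely generated subgroup.
    Its drift has a nonzero finitely generated image in the reals, which maps onto the integers. *)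
Lemma locally_indicable_of_drifting (G : Grp) : locally_drifting G (fun _ => True) ->
  left_orderable G -> locally_indicable G.
Proof.
intros hG [le [refl [anti [tr [tot left]]]]] s [x [hx x1]].
set (L := subgrp G _ (gen_subgroup G s)); set (j := subval G _ (gen_subgroup G s) : L -> G).
destruct (hG L j) with (le := fun a b => le (j a) (j b)) as [tau [ht [[x0 [_ hx0]] _]]]; auto.
- apply subval_hom.
- apply subval_inj.
- apply fg_gen.
- split.
  + intros a b c; apply tr.
  + intros a b; apply tot.
  + intros g a b; apply left.
- destruct (tot x gone) as [h|h].
  + exists (exist _ (x^-1) (gen_inv _ _ _ hx)); simpl; intros h1; apply x1, anti; auto.
    apply (left x) in h1; now grp in h1.
  + exists (exist _ x hx); simpl; intros h1; now apply x1, anti.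
- assert (hfg : fg L) by apply fg_gen; destruct hfg as [sL hL].
  assert (fL := full_subgroup L).
  assert (hspan : forall a, zspan (map tau sL) (tau a)).
  { intros a; assert (ha := hL a); induction ha as [b hb| |b c _ hb _ hc|b _ hb].
    - now apply zspan_in, in_map.
    - rewrite (add1 fL ht); apply zspan0.
    - rewrite ht; auto; now apply zspan_add.
    - rewrite (addV fL ht); auto; now apply zspan_opp. }
  destruct (zspan_functional _ _ (hspan x0) hx0) as [f [hf fx0]].
  destruct (surjection_to_Z L (fun a => f (tau a))) as [f' [h1 h2]].
  { intros a b; rewrite ht; auto. }
  { now exists x0. }
  destruct (sub_extend G _ (gen_subgroup G s) f' 0%Z) as [F hF].
  exists F; split.
  + intros a b ha hb; rewrite (hF a ha), (hF b hb), <- h1.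
    exact (hF (a · b) (subM (gen_subgroup G s) a b ha hb)).
  + intros n; destruct (h2 n) as [[a ha] E]; exists a; split; auto; now rewrite (hF a ha).
Qed.

(** * The Burns-Hale theorem *)

Inductive semigroup {G : Grp} (A : G -> Prop) : G -> Prop :=
| semi_in : forall x, A x -> semigroup A x
| semi_mul : forall x y, semigroup A x -> semigroup A y -> semigroup A (x · y).

Definition signed {G : Grp} (e : G -> bool) (T : list G) (x : G) : Prop :=
  exists t, In t T /\ x = if e t then t else t^-1.

(** Induction on the length of [T]. A homomorphism [f] onto the integers prescribes the sign of
    every [t] with nonzero [f t], and the other elements form a shorter list. A product of signed
    elements equal to [gone] has [f] equal to 0, so it involves only the latter. *)
Lemma signs_exist (G : Grp) : locally_indicable G -> forall T : list G,
  (forall t, In t T -> t <> gone) -> exists e, ~ semigroup (signed e T) gone.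
Proof.
intros hG T; induction T as [T IH] using (well_founded_induction
  (well_founded_ltof _ (@length G))); intros hT.
destruct T as [|t0 T0].
{ exists (fun _ => true); intros h.
  assert (none : forall x : G, semigroup (signed (fun _ => true) []) x -> False).
  { intros x hx; induction hx as [x [t [[] _]]|]; auto. }
  exact (none _ h). }
set (T := t0 :: T0) in *; assert (gT := gen_subgroup G T).
destruct (hG T) as [f [hf sf]].
{ exists t0; split; [apply gen_in; now left | apply hT; now left]. }
assert (f1 : f gone = 0%Z).
{ assert (h := hf gone gone (gen_one _ _) (gen_one _ _)); rewrite gmul1 in h; lia. }
assert (fV : forall x, gen_by G T x -> f (x^-1) = (- f x)%Z).
{ intros x hx; assert (h := hf x (x^-1) hx (gen_inv _ _ _ hx)); rewrite gmulrV, f1 in h; lia. }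
set (T1 := filter (fun t => Z.eqb (f t) 0) T).
assert (hlen : (length T1 < length T)%nat).
{ assert (hne : exists t, In t T /\ f t <> 0%Z).
  { apply NNPP; intros h; destruct (sf 1%Z) as [x [hx fx]].
    assert (fx0 : f x = 0%Z); [| lia]; clear fx.
    induction hx as [x hx| |x y hx IHx hy IHy|x hx IHx]; auto.
    - apply NNPP; intros h1; apply h; now exists x.
    - rewrite hf; auto; lia.
    - rewrite fV; auto; lia. }
  destruct hne as [t [ht ft]]; unfold T1; clear - ht ft.
  assert (hle : forall l, (length (filter (fun t => Z.eqb (f t) 0) l) <= length l)%nat)
    by (intros l; apply filter_length_le).
  induction T as [|a l IHl]; [easy |]; simpl; destruct ht as [<-|ht].
  - rewrite (proj2 (Z.eqb_neq _ _) ft); specialize (hle l); lia.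
  - specialize (IHl ht); destruct (Z.eqb (f a) 0); simpl; lia. }
destruct (IH T1 hlen) as [e1 he1].
{ intros t ht; apply filter_In in ht; now apply hT. }
set (e := fun t => if Z.eqb (f t) 0 then e1 t else Z.ltb 0 (f t)); exists e; intros h1.
assert (key : forall x, semigroup (signed e T) x ->
   gen_by G T x /\ (0 <= f x)%Z /\ (f x = 0%Z -> semigroup (signed e1 T1) x)).
{ intros x hx; induction hx as [x [t [ht ->]]|x y _ [gx [fx hx]] _ [gy [fy hy]]].
  - assert (gt : gen_by G T t) by now apply gen_in.
    unfold e; destruct (Z.eqb_spec (f t) 0) as [E|E].
    + assert (in1 : In t T1) by (apply filter_In; split; auto; now apply Z.eqb_eq).
      split; [destruct (e1 t); auto; now apply gen_inv | split].
      * destruct (e1 t); [| rewrite fV]; auto; lia.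
      * intros _; apply semi_in; now exists t.
    + destruct (Z.ltb_spec 0 (f t)).
      * split; auto; split; lia.
      * split; [now apply gen_inv |]; rewrite fV; auto; lia.
  - rewrite hf; auto; split; [now apply gen_mul |]; split; [lia |].
    intros E; apply semi_mul; [apply hx | apply hy]; lia. }
destruct (key gone h1) as [_ [_ h2]]; exact (he1 (h2 f1)).
Qed.

(** The signs chosen for finite lists converge along an ultrafilter, and the positive cone consists
    of the elements with positive sign for almost all lists. A failure of closure under products or
    of totality would write [gone] as a product of signed elements of one list. *)
Theorem burns_hale (G : Grp) : locally_indicable G -> left_orderable G.
Proof.
intros hG.
set (good := fun T : list G => forall t, In t T -> t <> gone).
assert (he : exists e : list G -> G -> bool, forall T, good T ->
   ~ semigroup (signed (e T) T) gone).
{ apply (choice (fun T e => good T -> ~ semigroup (signed e T) gone)); intros T.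
  destruct (classic (good T)) as [h|h].
  - destruct (signs_exist G hG T h) as [e he]; now exists e.
  - now exists (fun _ => true). }
destruct he as [e he].
destruct (ultrafilter_exists (list G)
   (fun P => exists x, x <> gone /\ P = fun T => good T /\ In x T)) as [U [hU hB]].
{ intros l hl.
  assert (E : exists T, good T /\ forall P, In P l -> exists x,
     In x T /\ P = fun T => good T /\ In x T).
  { induction l as [|P l IH]; [exists []; split; [now intros t [] | intros ? []] |].
    destruct IH as [T [h1 h2]]; [intros; apply hl; now right |].
    destruct (hl P (or_introl eq_refl)) as [x [hx ->]]; exists (x :: T); split.
    - intros t [<-|ht]; auto.
    - intros Q [<-|hQ]; [exists x; split; auto; now left |].
      destruct (h2 Q hQ) as [y [hy ->]]; exists y; split; auto; now right. }
  destruct E as [T [h1 h2]]; exists T; intros P hP.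
  destruct (h2 P hP) as [x [hx ->]]; now split. }
assert (ev : forall x, x <> gone -> U (fun T => good T /\ In x T))
  by (intros x hx; apply hB; now exists x).
assert (ex : forall P, U P -> exists T, P T) by apply (ultra_ex U hU).
assert (cap : forall P Q, U P -> U Q -> U (fun T => P T /\ Q T)) by apply (ultraI U hU).
set (pos := fun x => x <> gone /\ U (fun T => e T x = true)).
assert (inS : forall T x, In x T -> e T x = true -> semigroup (signed (e T) T) x).
{ intros T x hx ht; apply semi_in; exists x; now rewrite ht. }
assert (inSV : forall T x, In x T -> ~ e T x = true -> semigroup (signed (e T) T) (x^-1)).
{ intros T x hx ht; apply semi_in; exists x; split; auto; now destruct (e T x). }
assert (pM : forall x y, pos x -> pos y -> pos (x · y)).
{ intros x y [x1 ux] [y1 uy].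
  assert (uxy := cap _ _ (cap _ _ ux uy) (cap _ _ (ev x x1) (ev y y1))).
  assert (hne : x · y <> gone).
  { intros E; destruct (ex _ uxy) as [T [[ex' ey] [[gT hx] [_ hy]]]].
    apply (he T gT); rewrite <- E; apply semi_mul; auto. }
  split; auto; apply NNPP; intros h; apply (ultra_not hU) in h.
  destruct (ex _ (cap _ _ (cap _ _ h (ev _ hne)) uxy))
    as [T [[hz [gT iz]] [[ex' ey] [[_ hx] [_ hy]]]]].
  apply (he T gT); rewrite <- (gmulV _ (x · y)); apply semi_mul; auto.
  apply semi_mul; auto. }
assert (ptot : forall x, x <> gone -> pos x \/ pos (x^-1)).
{ intros x x1; assert (xV : x^-1 <> gone).
  { intros E; apply x1; now rewrite <- (ginvK x), E, ginv1. }
  apply NNPP; intros h; apply not_or_and in h as [h1 h2].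
  assert (n1 : ~ U (fun T => e T x = true)) by (intros h; apply h1; now split).
  assert (n2 : ~ U (fun T => e T (x^-1) = true)) by (intros h; apply h2; now split).
  apply (ultra_not hU) in n1, n2.
  destruct (ex _ (cap _ _ (cap _ _ n1 n2) (cap _ _ (ev x x1) (ev _ xV))))
    as [T [[hx hxV] [[gT ix] [_ ixV]]]].
  apply (he T gT); rewrite <- (gmulrV (x^-1)); apply semi_mul; auto. }
exists (fun x y => x = y \/ pos (x^-1 · y)); split; [| split; [| split; [| split]]].
- now left.
- intros x y [->|h1] [h2|h2]; auto; exfalso.
  assert (h := pM _ _ h1 h2); apply (proj1 h); now grp.
- intros x y z [->|h1] [<-|h2]; auto; right.
  assert (h := pM _ _ h1 h2); now grp in h.
- intros x y; destruct (classic (x = y)) as [h|h]; [now left; left |].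
  destruct (ptot (x^-1 · y)) as [h1|h1].
  + intros E; apply h, (gmul_cancel_l (x^-1)); now rewrite E, gmulV.
  + now left; right.
  + right; right; now grp in h1.
- intros g x y [->|h]; [now left | right; now grp].
Qed.

Theorem theorem1p2 (G : Grp) (HG : inC G) :
  left_orderable G <-> locally_indicable G.
Proof.
split; [| apply burns_hale].
now apply locally_indicable_of_drifting, extendable_drifting, inC_extendable.
Qed.
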